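(* Let $r>0$, let $U\subseteq\mathbb R^m$ be a non-empty set, and consider the forward complete system $\dot x=f(x,u)$, $x\in\mathbb R^n$, $u\in U$, with output $y=h(x)$, where $f:\mathbb R^n\times U\to\mathbb R^n$ and $h:\mathbb R^n\to\mathbb R^k$ are smooth. Assume that the following three hypotheses hold with a common constant $\sigma>0$. **(H1)** There are smooth maps $F:\mathbb R^l\times\mathbb R^k\times U\to\mathbb R^l$ and $\Psi:\mathbb R^l\to\mathbb R^n$ such that $\dot z=F(z,y+v,u)$, $\hat x=\Psi(z)$ is a Robust Global Exponential Observer for $\dot x=f(x,u)$, with decay rate $\sigma$ and gain $\gamma\ge 0$ (see context). Moreover the system $\dot z(t)=F(z(t),w(t),u(t-r))$, $\dot w(t)=L_fh(\Psi(z(t)),u(t-r))$ is forward complete for inputs $u\in L^\infty([-r,+\infty);U)$, and the system $\dot z(t)=F(z(t),w(t),u(t-r))$ is forward complete for inputs $(u,w)\in L^\infty([-r,+\infty);U)\times L^\infty_{loc}([-r,+\infty);\mathbb R^k)$. **(H2)** There is a non-empty set $A(\mathbb R_+;\mathbb R^n)$ of functions $\mathbb R_+\to\mathbb R^n$ that are absolutely continuous on every bounded interval of $\mathbb R_+$, such that $\dot x=f(x,u)$ admits a robust global exponential $r$-predictor with input $z\in A(\mathbb R_+;\mathbb R^n)$, given by continuous maps $F_p:C^0([-r,0];\mathbb R^q)\times L^\infty([-r,0];U)\times\mathbb R^n\times\mathbb R^n\to\mathbb R^q$ and $G:C^0([-r,0];\mathbb R^q)\times L^\infty([-r,0];U)\times\mathbb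 R^n\to\mathbb R^n$, with decay rate $\sigma$ and gain $P\ge 0$ (see context). Moreover, for every $(z_0,u,w)\in\mathbb R^l\times L^\infty([-r,+\infty);U)\times L^\infty_{loc}([-r,+\infty);\mathbb R^k)$, the signal $\hat x(t)=\Psi(z(t))$, where $z$ is the unique solution of $\dot z(t)=F(z(t),w(t),u(t-r))$ with $z(0)=z_0$, belongs to $A(\mathbb R_+;\mathbb R^n)$. **(H3)** There exist a constant $C>0$, a continuous function $T:\mathbb R^n\times\mathbb R^l\to\mathbb R_+$ and a non-decreasing function $N:\mathbb R_+\to\mathbb R_+$ such that for every $(x_0,z_0,u,v)\in\mathbb R^n\times\mathbb R^l\times L^\infty(\mathbb R_+;U)\times L^\infty_{loc}(\mathbb R_+;\mathbb R^k)$ the solution $(x(t),z(t))$ of $\dot x=f(x,u)$, $\dot z=F(z,h(x)+v,u)$, $\hat x=\Psi(z)$ with $(x(0),z(0))=(x_0,z_0)$ satisfies, for all $t\ge T(x_0,z_0)$, $$|L_fh(\hat x(t),u(t))-L_fh(x(t),u(t))|\le e^{-\sigma t}N(|x_0|+|z_0|+\|u\|)+C\sup_{0\le s\le t}\left(e^{-\sigma(t-s)}|v(s)|\right).$$ Let $0<b\le B$ be constants satisfying $CB\exp(\sigma B)<1$. Then there exists a non-decreasing function $Q:\mathbb R_+\to\mathbb R_+$ such that for every partition $\pi=\{\tau_i\}_{i=0}^\infty$ of $\mathbb R_+$ with $\sup_{i\ge0}(\tau_{i+1}-\tau_i)\le B$ and $\inf_{i\ge 0}(\tau_{i+1}-\tau_i)\ge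 b$, for every $(z_0,w_0,u,v)\in\mathbb R^l\times\mathbb R^k\times L^\infty([-r,+\infty);U)\times L^\infty_{loc}(\mathbb R_+;\mathbb R^k)$ and every $(x_0,\xi_0)\in C^0([-r,0];\mathbb R^n)\times C^0([-r,0];\mathbb R^q)$, the unique solution of $$\dot x(t)=f(x(t),u(t)),$$ $$\dot z(t)=F(z(t),w(t),u(t-r)),\qquad \hat x(t)=\Psi(z(t)),$$ $$\dot w(t)=L_fh(\hat x(t),u(t-r)),\quad t\in[\tau_i,\tau_{i+1}),\qquad w(\tau_{i+1})=h(x(\tau_{i+1}-r))+v(\tau_{i+1}),$$ $$\dot\xi(t)=F_p\left(\xi_t,u_t,\hat x(t),\tfrac{d\hat x}{dt}(t)\right),\qquad \tilde x(t)=G(\xi_t,u_t,\hat x(t)),$$ with initial condition $\xi(\theta)=\xi_0(\theta)$, $x(\theta)=x_0(\theta)$ for $\theta\in[-r,0]$ and $(z(0),w(0))=(z_0,w_0)$, is defined for all $t\ge0$ and satisfies, for all $t\ge 0$, $$|\tilde x(t)-x(t)|\le e^{-\sigma t}Q\left(\|x_0\|+\|\xi_0\|+\|u\|+|z_0|+|w_0|+\sup_{0\le s\le t}|v(s)|\right)+\frac{\gamma P\exp(\sigma B)}{1-CB\exp(\sigma B)}\sup_{0\le s\le t}\left(e^{-\sigma(t-s)}|v(s)|\right).$$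
   Context: Notation. $\mathbb R_+=[0,+\infty)$. A partition of $\mathbb R_+$ is a set $\{\tau_i\}_{i=0}^\infty$ with $\tau_0=0$, $\tau_{i+1}>\tau_i$ for all $i\ge 0$ and $\lim_{i\to+\infty}\tau_i=+\infty$. $L^\infty(I;U)$ (resp. $L^\infty_{loc}(I;U)$) is the space of Lebesgue measurable, essentially bounded (resp. locally essentially bounded) functions $I\to U$; $\|u\|$ is the essential supremum of $|u|$ on its interval of definition; $\|x_0\|$ is the sup norm for $x_0\in C^0([-r,0];\mathbb R^n)$. $|\cdot|$ is the Euclidean norm. $L_fh(x,u)=Dh(x)f(x,u)$, where $Dh$ is the Jacobian matrix. $(\xi_t)(\theta)=\xi(t+\theta)$ and $(u_t)(\theta)=u(t+\theta)$ for $\theta\in[-r,0]$. Differential equations hold for almost every $t\ge 0$. For $t\in[-r,0]$ the value $x(t)=x_0(t)$ is prescribed, and $\dot x=f(x,u)$ holds for $t\ge0$. A system is forward complete if for every initial condition and every input of the indicated class (for $\dot x=f(x,u)$: $u\in L^\infty_{loc}(\mathbb R_+;U)$) the solution exists for all $t\ge0$. The input $v$ is a function with pointwise values (so $v(\tau_i)$ makes sense), suprema of $|v|$ are pointwise suprema, and a bound with infinite supremum is vacuous. Robust Global Exponential Observer (rate $\sigma>0$, gain $\gamma\ge 0$): the system $\dot z=F(z,y+v,u)$, $\hat x=\Psi(z)$, with $z\in\mathbb R^l$, $F$ and $\Psi$ smooth, is a Robust Global Exponential Observer for $\dot x=f(x,u)$, $y=h(x)$, if there is a non-decreasing $M:\mathbb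 R_+\to\mathbb R_+$ such that for every $(x_0,z_0,u,v)\in\mathbb R^n\times\mathbb R^l\times L^\infty(\mathbb R_+;U)\times L^\infty_{loc}(\mathbb R_+;\mathbb R^k)$ the solution of $\dot x=f(x,u)$, $\dot z=F(z,h(x)+v,u)$, $\hat x=\Psi(z)$ with $(x(0),z(0))=(x_0,z_0)$ exists for all $t\ge0$ and satisfies for all $t\ge 0$ $$|\hat x(t)-x(t)|\le e^{-\sigma t}M(|x_0|+|z_0|+\|u\|)+\gamma\sup_{0\le s\le t}\left(e^{-\sigma(t-s)}|v(s)|\right).$$ Robust global exponential $r$-predictor with input $z\in A(\mathbb R_+;\mathbb R^n)$ (rate $\sigma>0$, gain $P\ge 0$): the system $\dot\xi(t)=F_p(\xi_t,u_t,z(t),\dot z(t))$, $\tilde x(t)=G(\xi_t,u_t,z(t))$, with $F_p,G$ continuous, is such a predictor for $\dot x=f(x,u)$ if there is a non-decreasing $a:\mathbb R_+\to\mathbb R_+$ such that for every $(x_0,\xi_0,u,z)\in C^0([-r,0];\mathbb R^n)\times C^0([-r,0];\mathbb R^q)\times L^\infty([-r,+\infty);U)\times A(\mathbb R_+;\mathbb R^n)$ the solution $(x(t),\xi(t))$ of $\dot x=f(x,u)$ together with the predictor equation, with $\xi(\theta)=\xi_0(\theta)$, $x(\theta)=x_0(\theta)$ for $\theta\in[-r,0]$, is unique, defined for all $t\ge0$ and satisfies for all $t\ge0$ $$|\tilde x(t)-x(t)|\le e^{-\sigma t}a\left(\|x_0\|+\|\xi_0\|+\|u\|+|z(0)|+\sup_{0\le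 s\le r}|\dot z(s)|\right)+P\sup_{0\le s\le t}\left(e^{-\sigma(t-s)}|z(s)-x(s-r)|\right).$$
   Formalization: Smoothness of f on R^n×U and of F on R^l×R^k×U is taken to mean restriction of a smooth map on the whole space; for non-closed U (e.g. U=(0,1)) mere smoothness on the set would make the claim false. *)

(* Defs.v *)
From HB Require Import structures.
From mathcomp Require Import all_boot all_order all_algebra.
From mathcomp Require Import all_classical all_reals all_analysis.
From mathcomp Require Import measurable_realfun ess_sup_inf.

Set Implicit Arguments.
Unset Strict Implicit.
Unset Printing Implicit Defensive.
Import Order.TTheory GRing.Theory Num.Theory.
Import numFieldNormedType.Exports.
Local Open Scope classical_set_scope.
Local Open Scope ring_scope.

(* Vectors are row vectors.  A function defined on an interval I of the real
   line, or on the product of a vector space with the input set U, is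
   represented by a total function of which only the restriction to that domain
   is ever constrained or inspected. *)

Section Spaces.
Context {R : realType}.

(* The library norm on matrices is the max norm. *)
Definition enorm (n : nat) (x : 'rV[R]_n) : R :=
  Num.sqrt (\sum_(i < n) x ord0 i ^+ 2).

Fixpoint Ck (V W : normedModType R) (k : nat) (g : V -> W) {struct k} : Prop :=
  match k with
  | 0%N => continuous g
  | k'.+1 => (forall p, differentiable g p) /\ (forall v, Ck k' ('D_v g))
  end.

(* For a closed D this is equivalent to the existence of smooth extensions
   locally around every point of D.  For other D it is stronger, and ensures
   that g and its derivatives are bounded on every bounded subset of D. *)
Definition smooth_on (V W : normedModType R) (D : set V) (g : V -> W) : Prop :=
  exists2 G : V -> W, (forall k, Ck k G) & (forall p, D p -> g p = G p).

Definition lebesgue_measurable (E : set R) : Prop :=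
  (completed_algebra_gen (@lebesgue_measure R)).-sigma.-measurable E.

Definition lebesgue_measurable_fun (m : nat) (I : set R) (u : R -> 'rV[R]_m) :
    Prop :=
  forall O : set 'rV[R]_m, open O -> lebesgue_measurable (I `&` u @^-1` O).

Definition ess_norm (m : nat) (I : set R) (u : R -> 'rV[R]_m) : \bar R :=
  ess_sup (@lebesgue_measure R)
    (fun t => if t \in I then (enorm (u t))%:E else 0%E).

Definition Linf (m : nat) (I : set R) (U : set 'rV[R]_m) (u : R -> 'rV[R]_m) :
    Prop :=
  [/\ lebesgue_measurable_fun I u,
      (forall t, I t -> U (u t)) &
      (ess_norm I u < +oo)%E].

Definition Linf_loc (m : nat) (I : set R) (U : set 'rV[R]_m)
    (u : R -> 'rV[R]_m) : Prop :=
  [/\ lebesgue_measurable_fun I u,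
      (forall t, I t -> U (u t)) &
      (forall a b, `[a, b] `<=` I -> (ess_norm `[a, b] u < +oo)%E)].

Definition Linf_norm (m : nat) (I : set R) (u : R -> 'rV[R]_m) : R :=
  fine (ess_norm I u).

Definition C0 (n : nat) (r : R) (phi : R -> 'rV[R]_n) : Prop :=
  {within `[- r, 0], continuous phi}.

Definition C0_norm (n : nat) (r : R) (phi : R -> 'rV[R]_n) : R :=
  sup [set enorm (phi theta) | theta in `[- r, 0]].

Definition hist (n : nat) (t : R) (x : R -> 'rV[R]_n) : R -> 'rV[R]_n :=
  fun theta => x (t + theta).

Definition abs_cont (n : nat) (a b : R) (x : R -> 'rV[R]_n) : Prop :=
  forall e : R, 0 < e -> exists2 d : R, 0 < d &
    forall (N : nat) (s s' : 'I_N -> R),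
      (forall i, a <= s i /\ s i <= s' i /\ s' i <= b) ->
      trivIset setT (fun i : 'I_N => `]s i, s' i[%classic) ->
      \sum_(i < N) (s' i - s i) < d ->
      \sum_(i < N) enorm (x (s' i) - x (s i)) < e.

(* [x] solves dx/dt = rhs (t) on [a, T). *)
Definition solves (n : nat) (a : R) (T : \bar R) (x rhs : R -> 'rV[R]_n) :
    Prop :=
  (forall b : R, a <= b -> (b%:E < T)%E -> abs_cont a b x) /\
  {ae @lebesgue_measure R, forall t : R,
     a <= t -> (t%:E < T)%E -> is_derive t 1 x (rhs t)}.

(* Non-decreasing functions from [0, +oo) to [0, +oo). *)
Definition nondecreasing_gain (M : R -> R) : Prop :=
  (forall s, 0 <= s -> 0 <= M s) /\
  (forall s s', 0 <= s -> s <= s' -> M s <= M s').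

(* [sup] is 0 on unbounded sets: estimates that involve [sup_norm v t] or
   [exp_sup sigma v t] are stated under [sup_finite v t]. *)
Definition sup_finite (k : nat) (v : R -> 'rV[R]_k) (t : R) : Prop :=
  has_ubound [set enorm (v s) | s in `[0, t]].

Definition sup_norm (k : nat) (v : R -> 'rV[R]_k) (t : R) : R :=
  sup [set enorm (v s) | s in `[0, t]].

Definition exp_sup (k : nat) (sigma : R) (v : R -> 'rV[R]_k) (t : R) : R :=
  sup [set expR (- (sigma * (t - s))) * enorm (v s) | s in `[0, t]].

Definition is_partition (tau : nat -> R) : Prop :=
  [/\ tau 0%N = 0, (forall i, tau i < tau i.+1) & (tau @ \oo --> +oo)].

End Spaces.

Notation Rplus := (`[0, +oo[)%classic.

Section Systems.
Context {R : realType}.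
Variables (n m k l q : nat) (r : R) (U : set 'rV[R]_m).
Variables (f : 'rV[R]_n -> 'rV[R]_m -> 'rV[R]_n) (h : 'rV[R]_n -> 'rV[R]_k).

Definition Lfh (x : 'rV[R]_n) (u : 'rV[R]_m) : 'rV[R]_k := 'd h x (f x u).

Definition forward_complete_plant : Prop :=
  forall (x0 : 'rV[R]_n) (u : R -> 'rV[R]_m), Linf_loc Rplus U u ->
  exists x : R -> 'rV[R]_n,
    x 0 = x0 /\ solves 0 +oo%E x (fun t => f (x t) (u t)).

Section Observer.
Variables (F : 'rV[R]_l -> 'rV[R]_k -> 'rV[R]_m -> 'rV[R]_l).
Variables (Psi : 'rV[R]_l -> 'rV[R]_n).

Definition plant_observer_solution (x0 : 'rV[R]_n) (z0 : 'rV[R]_l)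
    (u : R -> 'rV[R]_m) (v : R -> 'rV[R]_k)
    (x : R -> 'rV[R]_n) (z : R -> 'rV[R]_l) : Prop :=
  [/\ x 0 = x0, z 0 = z0,
      solves 0 +oo%E x (fun t => f (x t) (u t)) &
      solves 0 +oo%E z (fun t => F (z t) (h (x t) + v t) (u t))].

Definition robust_exp_observer (sigma gamma : R) : Prop :=
  exists2 M : R -> R, nondecreasing_gain M &
  forall (x0 : 'rV[R]_n) (z0 : 'rV[R]_l)
         (u : R -> 'rV[R]_m) (v : R -> 'rV[R]_k),
    Linf Rplus U u -> Linf_loc Rplus setT v ->
    (exists x z, plant_observer_solution x0 z0 u v x z) /\
    (forall x z, plant_observer_solution x0 z0 u v x z ->
     forall t, 0 <= t -> sup_finite v t ->
       enorm (Psi (z t) - x t) <=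
         expR (- (sigma * t)) * M (enorm x0 + enorm z0 + Linf_norm Rplus u)
         + gamma * exp_sup sigma v t).

Definition delayed_observer_solution (z0 : 'rV[R]_l)
    (u : R -> 'rV[R]_m) (w : R -> 'rV[R]_k) (z : R -> 'rV[R]_l) : Prop :=
  z 0 = z0 /\ solves 0 +oo%E z (fun t => F (z t) (w t) (u (t - r))).

Definition forward_complete_delayed_observer : Prop :=
  forall (z0 : 'rV[R]_l) (u : R -> 'rV[R]_m) (w : R -> 'rV[R]_k),
    Linf `[- r, +oo[ U u -> Linf_loc `[- r, +oo[ setT w ->
    exists z, delayed_observer_solution z0 u w z.

Definition forward_complete_intersample : Prop :=
  forall (z0 : 'rV[R]_l) (w0 : 'rV[R]_k) (u : R -> 'rV[R]_m),
    Linf `[- r, +oo[ U u ->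
    exists (z : R -> 'rV[R]_l) (w : R -> 'rV[R]_k),
      [/\ z 0 = z0, w 0 = w0,
          solves 0 +oo%E z (fun t => F (z t) (w t) (u (t - r))) &
          solves 0 +oo%E w (fun t => Lfh (Psi (z t)) (u (t - r)))].

Definition output_derivative_bound (sigma C : R) : Prop :=
  exists (T : 'rV[R]_n * 'rV[R]_l -> R) (N : R -> R),
  [/\ continuous T, (forall p, 0 <= T p), nondecreasing_gain N &
  forall (x0 : 'rV[R]_n) (z0 : 'rV[R]_l)
         (u : R -> 'rV[R]_m) (v : R -> 'rV[R]_k),
    Linf Rplus U u -> Linf_loc Rplus setT v ->
    forall x z, plant_observer_solution x0 z0 u v x z ->
    forall t, T (x0, z0) <= t -> sup_finite v t ->
      enorm (Lfh (Psi (z t)) (u t) - Lfh (x t) (u t)) <=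
        expR (- (sigma * t)) * N (enorm x0 + enorm z0 + Linf_norm Rplus u)
        + C * exp_sup sigma v t].

End Observer.

(* Sets of functions on [0, +oo) that are absolutely continuous on bounded
   intervals; the last clause says that membership only depends on the values
   on [0, +oo). *)
Definition predictor_input_class (A : set (R -> 'rV[R]_n)) : Prop :=
  [/\ A !=set0,
      (forall z, A z -> forall b, 0 <= b -> abs_cont 0 b z) &
      (forall z z', (forall t, 0 <= t -> z t = z' t) -> A z -> A z')].

Section Predictor.
Variables (Fp : (R -> 'rV[R]_q) -> (R -> 'rV[R]_m) ->
                'rV[R]_n -> 'rV[R]_n -> 'rV[R]_q).
Variables (G : (R -> 'rV[R]_q) -> (R -> 'rV[R]_m) -> 'rV[R]_n -> 'rV[R]_n).

(* Continuity on C^0([-r,0]) x L^oo([-r,0];U) x R^n x R^n, with the sup norm,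
   the essential sup norm and the Euclidean norms.  In particular the value does
   not depend on the arguments outside [-r, 0], nor on the representative of
   the second one. *)
Definition continuous_dynamics : Prop :=
  forall phi mu a b, C0 r phi -> Linf `[- r, 0] U mu ->
  forall e : R, 0 < e -> exists2 d : R, 0 < d &
  forall phi' mu' a' b', C0 r phi' -> Linf `[- r, 0] U mu' ->
    C0_norm r (phi' \- phi) < d -> Linf_norm `[- r, 0] (mu' \- mu) < d ->
    enorm (a' - a) < d -> enorm (b' - b) < d ->
    enorm (Fp phi' mu' a' b' - Fp phi mu a b) < e.

Definition continuous_output : Prop :=
  forall phi mu a, C0 r phi -> Linf `[- r, 0] U mu ->
  forall e : R, 0 < e -> exists2 d : R, 0 < d &
  forall phi' mu' a', C0 r phi' -> Linf `[- r, 0] U mu' ->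
    C0_norm r (phi' \- phi) < d -> Linf_norm `[- r, 0] (mu' \- mu) < d ->
    enorm (a' - a) < d ->
    enorm (G phi' mu' a' - G phi mu a) < e.

(* Solutions on [-r, T). *)
Definition plant_predictor_solution (x0 : R -> 'rV[R]_n) (xi0 : R -> 'rV[R]_q)
    (u : R -> 'rV[R]_m) (z : R -> 'rV[R]_n) (T : \bar R)
    (x : R -> 'rV[R]_n) (xi : R -> 'rV[R]_q) : Prop :=
  [/\ (forall theta, - r <= theta <= 0 -> x theta = x0 theta),
      (forall theta, - r <= theta <= 0 -> xi theta = xi0 theta),
      solves 0 T x (fun t => f (x t) (u t)) &
      solves 0 T xi
        (fun t => Fp (hist t xi) (hist t u) (z t) (derive1 z t))].

(* The derivative of z exists almost everywhere only, hence the essential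
   supremum. *)
Definition robust_exp_predictor (A : set (R -> 'rV[R]_n)) (sigma P : R) :
    Prop :=
  exists2 a : R -> R, nondecreasing_gain a &
  forall (x0 : R -> 'rV[R]_n) (xi0 : R -> 'rV[R]_q)
         (u : R -> 'rV[R]_m) (z : R -> 'rV[R]_n),
    C0 r x0 -> C0 r xi0 -> Linf `[- r, +oo[ U u -> A z ->
    [/\ (exists x xi, plant_predictor_solution x0 xi0 u z +oo%E x xi),
        (forall T x xi x' xi',
           plant_predictor_solution x0 xi0 u z T x xi ->
           plant_predictor_solution x0 xi0 u z T x' xi' ->
           forall t, 0 <= t -> (t%:E < T)%E -> x t = x' t /\ xi t = xi' t) &
        (forall x xi, plant_predictor_solution x0 xi0 u z +oo%E x xi ->
         forall t, 0 <= t -> (ess_norm `[0%R, r] (derive1 z) < +oo)%E ->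
           enorm (G (hist t xi) (hist t u) (z t) - x t) <=
             expR (- (sigma * t)) *
               a (C0_norm r x0 + C0_norm r xi0 + Linf_norm `[- r, +oo[ u
                  + enorm (z 0) + Linf_norm `[0, r] (derive1 z))
             + P * exp_sup sigma (fun s => z s - x (s - r)) t)].

End Predictor.

(* Solutions on [-r, T) of the sampled-data closed loop.  Between samplings w
   starts from its value at tau i, so that it is right-continuous with jumps at
   the sampling times. *)
Definition closed_loop_solution
    (F : 'rV[R]_l -> 'rV[R]_k -> 'rV[R]_m -> 'rV[R]_l)
    (Psi : 'rV[R]_l -> 'rV[R]_n)
    (Fp : (R -> 'rV[R]_q) -> (R -> 'rV[R]_m) ->
          'rV[R]_n -> 'rV[R]_n -> 'rV[R]_q)
    (tau : nat -> R)
    (x0 : R -> 'rV[R]_n) (z0 : 'rV[R]_l) (w0 : 'rV[R]_k) (xi0 : R -> 'rV[R]_q)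
    (u : R -> 'rV[R]_m) (v : R -> 'rV[R]_k) (T : \bar R)
    (x : R -> 'rV[R]_n) (z : R -> 'rV[R]_l)
    (w : R -> 'rV[R]_k) (xi : R -> 'rV[R]_q) : Prop :=
  [/\ [/\ (forall theta, - r <= theta <= 0 -> x theta = x0 theta),
          (forall theta, - r <= theta <= 0 -> xi theta = xi0 theta),
          z 0 = z0 & w 0 = w0],
      solves 0 T x (fun t => f (x t) (u t)),
      solves 0 T z (fun t => F (z t) (w t) (u (t - r))),
      (forall i : nat,
         solves (tau i) (Order.min (tau i.+1)%:E T) w
           (fun t => Lfh (Psi (z t)) (u (t - r))) /\
         (((tau i.+1)%:E < T)%E ->
            w (tau i.+1) = h (x (tau i.+1 - r)) + v (tau i.+1))) &
      solves 0 T xi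
        (fun t => Fp (hist t xi) (hist t u) (Psi (z t))
                     (derive1 (Psi \o z) t))].

End Systems.

(* Main.v *)
Require Import Defs.
From HB Require Import structures.
From mathcomp Require Import all_boot all_order all_algebra.
From mathcomp Require Import all_classical all_reals all_analysis.
From mathcomp Require Import measurable_realfun ess_sup_inf.
From mathcomp Require Import ring lra.

Set Implicit Arguments.
Unset Strict Implicit.
Unset Printing Implicit Defensive.
Import Order.TTheory GRing.Theory Num.Theory.
Import numFieldNormedType.Exports.
Local Open Scope classical_set_scope.
Local Open Scope ring_scope.

(* Shift time by r: the plant state x(t) and the observer state z(t + r) solve
   the plant-observer system with measurement error e(t) = w(t + r) - h(x(t)).
   At a sampling time e equals v, and in between its derivative is the difference
   of Lie derivatives bounded by (H3); since a sampling interval has length at most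
   B, the weighted supremum of |e| is at most a constant plus the weighted supremum
   of e^(sigma B) |v| plus C B e^(sigma B) times itself, and C B e^(sigma B) < 1.
   The observer and predictor estimates then give the bound.

   The constants must be uniform in the data, which requires that a forward complete
   system has bounded reachable sets in bounded time.  If it does not, some point y0
   has, in each of its neighbourhoods, points with unbounded reachable sets; then
   another such point lies arbitrarily far away along trajectories starting
   arbitrarily close to y0.  Since the flow is open in the initial condition, one
   can perturb initial conditions and concatenate inputs so as to obtain in the limit
   one bounded input and one initial condition whose trajectory escapes in finite
   time, against forward completeness. *)

(** * Euclidean norm *)

(** Bounded reachable sets cannot be obtained by passing to the limit in a sequence of inputs: U is
    an arbitrary non-empty set and f need not be affine in u, so that weak limits of inputs need not
    drive limits of trajectories. Inputs are therefore only shifted, concatenated and glued, and all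
    compactness comes from initial conditions, which lie in a finite-dimensional space. The fields
    are Lipschitz on bounded sets only, which forces the estimates to be made over short times on
    balls.

    The uniform bounds are needed because the observer estimate starts at time r and (H3) after
    T(x0,z0); before that, weighted errors are controlled by constants alone. They also control the
    derivative of the estimate on [0, r], which enters the predictor inequality. The lower bound b
    limits the number of samplings in bounded time. The factor e^(sigma B) is the most that the
    weight can grow from one sampling time to the next. Finally Q sees v up to time t only, although
    the hypotheses speak of whole solutions; causality of the loop settles this. *)

Section Norms.
Context {R : realType}.

Lemma enorm_ge0 n (x : 'rV[R]_n) : 0 <= enorm x.
Proof. exact: sqrtr_ge0. Qed.

Lemma enorm0 n : enorm (0 : 'rV[R]_n) = 0.
Proof.
rewrite /enorm big1 ?sqrtr0 // => i _; by rewrite mxE expr0n.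
Qed.

Lemma sqr_enorm n (x : 'rV[R]_n) : enorm x ^+ 2 = \sum_(i < n) x ord0 i ^+ 2.
Proof. by rewrite /enorm sqr_sqrtr // sumr_ge0 // => i _; rewrite sqr_ge0. Qed.

(** Lagrange's identity: the double sum of squares is twice the difference of the two sides. *)
Lemma cauchy_schwarz n (x y : 'I_n -> R) :
  (\sum_i x i * y i) ^+ 2 <= (\sum_i x i ^+ 2) * (\sum_i y i ^+ 2).
Proof.
have : 0 <= \sum_i \sum_j (x i * y j - x j * y i) ^+ 2.
  by apply: sumr_ge0 => i _; apply: sumr_ge0 => j _; exact: sqr_ge0.
have -> : \sum_i \sum_j (x i * y j - x j * y i) ^+ 2 =
    ((\sum_i x i ^+ 2) * (\sum_i y i ^+ 2)) *+ 2
    - ((\sum_i x i * y i) ^+ 2) *+ 2.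
  rewrite [X in _ = X *+ 2 - _]big_distrlr /= expr2 big_distrlr /=.
  have swap : \sum_i \sum_j x i ^+ 2 * y j ^+ 2 = \sum_i \sum_j x j ^+ 2 * y i ^+ 2.
    exact: exchange_big.
  rewrite !mulr2n [X in _ = _ + X - _]swap -!big_split /= -sumrB.
  apply: eq_bigr => i _; rewrite -!big_split /= -sumrB.
  by apply: eq_bigr => j _; ring.
by rewrite -mulrnBl pmulrn_lge0 // subr_ge0.
Qed.

Lemma enormD n (x y : 'rV[R]_n) : enorm (x + y) <= enorm x + enorm y.
Proof.
rewrite -(ler_pXn2r (n := 2)) ?nnegrE ?addr_ge0 ?enorm_ge0 //.
rewrite sqrrD !sqr_enorm.
have -> : \sum_(i < n) (x + y) ord0 i ^+ 2 = \sum_(i < n) x ord0 i ^+ 2 +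
    (\sum_(i < n) x ord0 i * y ord0 i) *+ 2 + \sum_(i < n) y ord0 i ^+ 2.
  rewrite -sumrMnl -!big_split /=; apply: eq_bigr => i _; rewrite mxE; ring.
rewrite lerD2r lerD2l ler_pMn2r //.
apply: le_trans (ler_norm _) _.
rewrite -(ler_pXn2r (n := 2)) ?nnegrE ?mulr_ge0 ?enorm_ge0 //.
by rewrite exprMn !sqr_enorm real_normK ?num_real // cauchy_schwarz.
Qed.

Lemma enormN n (x : 'rV[R]_n) : enorm (- x) = enorm x.
Proof. by rewrite /enorm; congr Num.sqrt; apply: eq_bigr => i _; rewrite mxE sqrrN. Qed.

Lemma enormB n (x y : 'rV[R]_n) : enorm (x - y) = enorm (y - x).
Proof. by rewrite -enormN opprB. Qed.

Lemma enormZ n (a : R) (x : 'rV[R]_n) : enorm (a *: x) = `|a| * enorm x.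
Proof.
rewrite /enorm -sqrtr_sqr -sqrtrM ?sqr_ge0 // mulr_sumr.
by congr Num.sqrt; apply: eq_bigr => i _; rewrite mxE exprMn.
Qed.

Lemma norm_coord n (x : 'rV[R]_n) (i : 'I_n) : `|x ord0 i| <= `|x|.
Proof.
by rewrite [leRHS]/Num.norm /= mx_normrE; apply: (le_bigmax _ _ (ord0, i)).
Qed.

Lemma rV_norm_le n (x : 'rV[R]_n) (c : R) :
  0 <= c -> (forall i, `|x ord0 i| <= c) -> `|x| <= c.
Proof.
move=> c0 H; rewrite /Num.norm /= mx_normrE; apply/bigmax_leP; split => // -[a i] _ /=.
by rewrite ord1; exact: H.
Qed.

Lemma coord_enorm n (x : 'rV[R]_n) (i : 'I_n) : `|x ord0 i| <= enorm x.
Proof.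
rewrite -(ler_pXn2r (n := 2)) ?nnegrE ?enorm_ge0 //.
rewrite real_normK ?num_real // sqr_enorm (bigD1 i) //= lerDl.
by apply: sumr_ge0 => j _; exact: sqr_ge0.
Qed.

Lemma norm_le_enorm n (x : 'rV[R]_n) : `|x| <= enorm x.
Proof. by apply: rV_norm_le; [exact: enorm_ge0 | exact: coord_enorm]. Qed.

Lemma enorm_le_norm n (x : 'rV[R]_n) : enorm x <= n%:R * `|x|.
Proof.
rewrite -(ler_pXn2r (n := 2)) ?nnegrE ?mulr_ge0 ?enorm_ge0 //.
rewrite sqr_enorm exprMn.
apply: (@le_trans _ _ (\sum_(i < n) `|x| ^+ 2)).
  apply: ler_sum => i _; rewrite -(real_normK (num_real (x ord0 i))).
  by rewrite ler_pXn2r ?nnegrE // norm_coord.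
rewrite sumr_const card_ord -[leLHS]mulr_natl ler_wpM2r ?sqr_ge0 //.
by rewrite -natrX ler_nat; case: n {x} => // n; rewrite leq_pmulr.
Qed.

Lemma enorm_eq0 n (x : 'rV[R]_n) : enorm x = 0 -> x = 0.
Proof.
move=> x0; apply/eqP; rewrite -normr_eq0 eq_le normr_ge0 andbT -x0.
exact: norm_le_enorm.
Qed.

Lemma enorm_row_mx n1 n2 (x : 'rV[R]_n1) (y : 'rV[R]_n2) :
  enorm (row_mx x y) <= enorm x + enorm y.
Proof.
rewrite -(ler_pXn2r (n := 2)) ?nnegrE ?addr_ge0 ?enorm_ge0 //.
rewrite sqrrD !sqr_enorm big_split_ord /=.
under eq_bigr do rewrite row_mxEl.
under [X in _ + X <= _]eq_bigr do rewrite row_mxEr.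
by rewrite lerD2r lerDl mulrn_wge0 // mulr_ge0 ?enorm_ge0.
Qed.

Lemma enorm_lsubmx n1 n2 (x : 'rV[R]_(n1 + n2)) : enorm (lsubmx x) <= enorm x.
Proof.
rewrite -(ler_pXn2r (n := 2)) ?nnegrE ?enorm_ge0 //.
rewrite !sqr_enorm big_split_ord /=.
under eq_bigr do rewrite mxE.
by rewrite lerDl sumr_ge0 // => i _; exact: sqr_ge0.
Qed.

Lemma enorm_rsubmx n1 n2 (x : 'rV[R]_(n1 + n2)) : enorm (rsubmx x) <= enorm x.
Proof.
rewrite -(ler_pXn2r (n := 2)) ?nnegrE ?enorm_ge0 //.
rewrite !sqr_enorm big_split_ord /=.
under eq_bigr do rewrite mxE.
by rewrite lerDr sumr_ge0 // => i _; exact: sqr_ge0.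
Qed.

End Norms.

(** * Real induction *)

Section RealInduction.
Context {R : realType}.

(** The step jumps from the left of [c] to its right, which merges the limit and the successor cases
    and does not pass through [P c]. *)
Lemma real_induction (a b : R) (P : R -> Prop) : a <= b -> P a ->
  (forall c, a <= c <= b -> exists2 d : R, 0 < d & forall s t,
     a <= s -> c - d < s -> s <= c -> c <= t -> t < c + d -> t <= b ->
     P s -> P t) ->
  P b.
Proof.
move=> ab Pa step.
pose S := [set t | a <= t <= b /\ P t].
have Sa : S a by split; rewrite ?lexx.
have ubS : ubound S b by move=> t [/andP[]].
have hs : has_sup S by split; [exists a | exists b].
have ac : a <= sup S by apply: ub_le_sup => //; exists b.
have cb : sup S <= b by apply: ge_sup => //; exists a.
have [|d d0 H] := step (sup S); first by rewrite ac cb.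
have [s [/andP[as_ sb] Ps] ds] := sup_adherent d0 hs.
have sc : s <= sup S by apply: ub_le_sup; [exists b | split => //; rewrite as_ sb].
have [bd|bd] := ltP b (sup S + d); first by apply: (H s b).
have : S (sup S + d / 2).
  split; last by apply: (H s) => //; [rewrite lerDl divr_ge0 // ltW | rewrite ltrD2l; lra | lra].
  apply/andP; split; lra.
move=> /(ub_le_sup (ex_intro _ b ubS)); lra.
Qed.

End RealInduction.

(** * Mean value inequality for absolutely continuous functions *)

Section MeanValue.
Context {R : realType}.

Lemma lebesgue_negligible_set1 (a : R) : lebesgue_measure.-negligible [set a].
Proof.
by exists [set a]; split => //; exact: lebesgue_measure_set1.
Qed.

Lemma is_derive_approx (V : normedModType R) (x : R -> V) (c : R) (y : V) :
  is_derive c 1 x y -> forall e : R, 0 < e -> exists2 d : R, 0 < d &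
    forall t, `|t - c| < d -> `|x t - x c - (t - c) *: y| <= e * `|t - c|.
Proof.
case=> dx xy e e0.
have /cvgrPdist_le /(_ e e0) : h^-1 *: ((x \o shift c) (h *: (1 : R)) - x c) @[h --> 0^'] --> y.
  by rewrite -xy; exact: dx.
case=> d /= d0 H; exists d => // t td.
have [->|tc] := eqVneq t c; first by rewrite !subrr scale0r subr0 !normr0 mulr0.
have tc0 : t - c != 0 by rewrite subr_eq0.
have := H (t - c); rewrite /ball_ /= sub0r normrN => /(_ td tc0).
have -> : (t - c) *: (1 : R) + c = t by rewrite [_ *: _]mulr1 subrK.
move=> H1.

have -> : x t - x c - (t - c) *: y = - ((t - c) *: (y - (t - c)^-1 *: (x t - x c))).
  by rewrite scalerBr scalerA divff // scale1r opprB.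
by rewrite normrN normrZ mulrC ler_wpM2r.
Qed.

(** Intervals are listed from left to right and may touch: the open ones are still disjoint. *)
Lemma sum_disjoint_itv (N : nat) (s s' : nat -> R) (W : set R) :
  measurable W ->
  (forall i, (i < N)%N -> s i <= s' i /\ `[s i, s' i] `<=` W) ->
  (forall i j, (i < j < N)%N -> s' i <= s j) ->
  trivIset setT (fun i : 'I_N => `]s i, s' i[%classic) /\
  ((\sum_(i < N) (s' i - s i))%:E <= lebesgue_measure W)%E.
Proof.
move=> mO sO sep.
have tri : trivIset setT (fun i : 'I_N => `]s i, s' i[%classic).
  move=> i j _ _ [t [/=]]; rewrite !in_itv /= => /andP[t1 t2] /andP[t3 t4].
  apply/eqP; rewrite -val_eqE /=; apply/contraT; rewrite neq_ltn => /orP[ij|ij].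
    have := sep i j; rewrite ij ltn_ord => /(_ erefl); lra.
  have := sep j i; rewrite ij ltn_ord => /(_ erefl); lra.
split=> //.
have mI (k : 'I_N) : measurable (`]s k, s' k[%classic : set R) by [].
apply: (@le_trans _ _ (lebesgue_measure (\big[setU/set0]_(i < N) (`]s i, s' i[%classic : set R)))).
  rewrite measure_bigsetU_ord //= -sumEFin.
  apply: lee_sum => i _; rewrite lebesgue_measure_itv /= lte_fin.
  case: ltP => // H; by rewrite lee_fin; lra.
apply: le_measure => //.
- by rewrite inE; apply: bigsetU_measurable.
- by rewrite inE.
apply: (big_ind (fun A : set R => A `<=` W)) => [|A B HA HB|i _]; first exact: sub0set.
  by rewrite subUset.
have [_] := sO i (ltn_ord i); apply: subset_trans.
exact: subset_itv_oo_cc.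
Qed.

(** [nu] is either the Euclidean norm, in which the estimates are stated, or the max norm, in which
    balls and neighbourhoods are given. *)
Variables (n : nat) (nu : 'rV[R]_n -> R) (cn : R).
Hypothesis cn0 : 0 <= cn.
Hypothesis nuD : forall x y, nu (x + y) <= nu x + nu y.
Hypothesis nu_norm : forall x, nu x <= cn * `|x|.
Hypothesis nu_enorm : forall x, nu x <= enorm x.
Hypothesis nuZ : forall a x, nu (a *: x) = `|a| * nu x.

(* Real induction on t: up to an error (K + e)(t - a), the increment of x on
   [a, t] is at most the variation of x over finitely many disjoint intervals
   contained in an open neighbourhood W of the exceptional null set; absolute
   continuity makes that variation small with the measure of W. *)
Lemma abs_cont_mean_value (a b : R) (x rhs : R -> 'rV[R]_n) (K : R) :
  a <= b -> 0 <= K -> abs_cont a b x ->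
  {ae @lebesgue_measure R, forall t : R, a < t -> t < b ->
     is_derive t 1 x (rhs t) /\ nu (rhs t) <= K} ->
  nu (x b - x a) <= K * (b - a).
Proof.
move=> ab K0 acx [A [mA A0 badA]].
have nu00 : nu 0 = 0 by rewrite -(scale0r 0) nuZ normr0 mul0r.
have nuN y : nu (- y) = nu y by rewrite -scaleN1r nuZ normrN1 mul1r.
(* [e] is used twice: as the error of the linear approximation where the derivative exists, which
   costs [cn * e] per unit of time, and as the bound of the variation over the intervals in [W]. *)
have step1 e : 0 < e -> nu (x b - x a) <= (K + cn * e) * (b - a) + e.
  move=> e0.
  have [d d0 acd] := acx e e0.
  (* [a] and [b] join the null set because the derivative is controlled in the open interval
     only. *)
  pose E := A `|` ([set a] `|` [set b]).
  have mE : measurable E.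
    by apply: measurableU => //; apply: measurableU; exact: measurable_set1.
  have E0 : lebesgue_measure E = 0%E.
    apply/(@negligibleP _ _ _ lebesgue_measure) => //.
    apply: negligibleU; first by exists A; split.
    by apply: negligibleU; exact: lebesgue_negligible_set1.
  have Efin : (lebesgue_measure E < +oo)%E by rewrite E0 ltry.
  have [W [oO EO mOE]] := lebesgue_regularity_outer mE Efin d0.
  have mO : measurable W by exact: open_measurable.
  have mOd : (lebesgue_measure W < d%:E)%E.
    apply: le_lt_trans mOE; rewrite -{1}(setDUK EO).
    apply: le_trans (measureU2 _ _ _) _ => //; first exact: measurableD.
    by rewrite [X in (X + _)%E](E0 : _ = 0%E) add0e.
  pose P (t : R) := exists (N : nat) (s s' : nat -> R),
    [/\ (forall i, (i < N)%N -> [/\ a <= s i, s i <= s' i, s' i <= t & `[s i, s' i] `<=` W]),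
        (forall i j, (i < j < N)%N -> s' i <= s j) &
        nu (x t - x a) <= (K + cn * e) * (t - a)
                             + \sum_(i < N) enorm (x (s' i) - x (s i))].
  have : P b.
    apply: (real_induction ab).
      exists 0%N, (fun=> 0), (fun=> 0); split; last by rewrite !subrr nu00 mulr0 big_ord0 addr0.
        by move=> i; rewrite ltn0.
      by move=> i j; rewrite ltn0 andbF.
    move=> c /andP[ac cb].
    (* Near a point of [W] the interval from [s] to [t] is appended to the list; elsewhere the slope
       of [x] at [c] pays for it and the list is kept. *)
    have [Oc|nOc] := pselect (W c).
      have [d1 /= d10 Hd1] := open_nbhs_nbhs (conj oO Oc).
      exists d1 => // s t as_ cs sc ct td tb [N [r [r' [rr sep est]]]].
      exists N.+1, (fun i => if (i < N)%N then r i else s), (fun i => if (i < N)%N then r' i else t); split.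
      + move=> i; rewrite ltnS leq_eqVlt => /orP[/eqP -> |iN].
          rewrite ltnn; split => //; first exact: le_trans ct.
          move=> p /=; rewrite in_itv /= => /andP[sp pt]; apply: Hd1.
          by rewrite /ball_ /= ltr_distl; apply/andP; split; lra.
        rewrite iN; have [h1 h2 h3 h4] := rr _ iN; split => //; lra.
      + move=> i j /andP[ij]; rewrite ltnS leq_eqVlt => /orP[/eqP jN |jN].
          rewrite jN ltnn; move: ij; rewrite jN => iN; rewrite iN.
          by have [_ _] := rr _ iN.
        by rewrite jN (ltn_trans ij jN); apply: sep; rewrite ij.
      + rewrite big_ord_recr /= ltnn.
        under eq_bigr => i _ do rewrite ltn_ord.
        have -> : x t - x a = (x s - x a) + (x t - x s) by rewrite [RHS]addrC subrKA.
        apply: le_trans (nuD _ _) _.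
        rewrite addrA; apply: lerD; last exact: nu_enorm.
        apply: le_trans est _; rewrite lerD2r.
        by apply: ler_wpM2l; [rewrite addr_ge0 // mulr_ge0 // ltW | lra].
    have acl : a < c by rewrite lt_neqAle ac andbT; apply/eqP => ace; apply: nOc; apply: EO; rewrite -ace; right; left.
    have clb : c < b by rewrite lt_neqAle cb andbT; apply/eqP => ace; apply: nOc; apply: EO; rewrite ace; right; right.
    have [dc Kc] : is_derive c 1 x (rhs c) /\ nu (rhs c) <= K.
      apply: contrapT => H; apply: nOc; apply: EO; left; apply: badA => /= H1.
      by apply: H; exact: H1.
    have [d1 d10 Hd1] := is_derive_approx dc e0.
    have loc t : `|t - c| < d1 -> nu (x t - x c) <= (K + cn * e) * `|t - c|.
      move=> /Hd1 H.
      rewrite -(subrK ((t - c) *: rhs c) (x t - x c)).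
      apply: le_trans (nuD _ _) _; rewrite addrC mulrDl; apply: lerD.
        by rewrite nuZ mulrC ler_wpM2r.
      by apply: le_trans (nu_norm _) _; rewrite -mulrA ler_wpM2l.
    exists d1 => // s t as_ cs sc ct td tb [N [r [r' [rr sep est]]]].
    exists N, r, r'; split => //.
      by move=> i /rr[h1 h2 h3 h4]; split => //; lra.
    have -> : x t - x a = (x s - x a) + ((x t - x c) - (x s - x c)).
      by rewrite opprB subrKA [RHS]addrC subrKA.
    apply: le_trans (nuD _ _) _.
    apply: le_trans (lerD est (nuD _ _)) _; rewrite nuN.
    have /loc : `|t - c| < d1 by rewrite ltr_distl; apply/andP; split; lra.
    have /loc : `|s - c| < d1 by rewrite ltr_distl; apply/andP; split; lra.
    rewrite [`|s - c|]ler0_norm ?subr_le0 // [`|t - c|]ger0_norm ?subr_ge0 //.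
    lra.
  case=> N [s [s' [rr sep est]]].
  have [||tri len] := sum_disjoint_itv (N := N) (s := s) (s' := s') mO.
  - by move=> i /rr[].
  - exact: sep.
  apply: le_trans est _; rewrite lerD2l; apply: ltW.
  apply: (acd N (fun i => s i) (fun i => s' i)) => //.
    by move=> i; have [] := rr i (ltn_ord i).
  by rewrite -lte_fin; apply: le_lt_trans mOd.
apply/ler_addgt0Pr => e e0.
(* Dividing [e] by a positive majorant of [cn * (b - a) + 1] makes the total error at most [e]. *)
have [c1 c10 Hc] : exists2 c1, 0 < c1 & cn * (b - a) + 1 <= c1.
  exists (cn * (b - a) + 1) => //.
  by rewrite ltr_wpDl // mulr_ge0 // subr_ge0.
apply: le_trans (step1 (e / c1) _) _; first by rewrite divr_gt0.
rewrite mulrDl -addrA lerD2l.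
have -> : cn * (e / c1) * (b - a) + e / c1 =
   (cn * (b - a) + 1) * (e / c1) by ring.
have c1' : (cn * (b - a) + 1) / c1 <= 1 by rewrite ler_pdivrMr // mul1r.
by rewrite mulrCA; apply: ler_piMr => //; exact: ltW.
Qed.

End MeanValue.

(** * Translation invariance of Lebesgue measure *)

Section Translation.
Context {R : realType}.

Lemma measurable_translation (s : R) (A : set R) :
  measurable A -> measurable [set t | A (t + s)].
Proof.
move=> mA.
have mf : measurable_fun [set: R] (fun t : R => t + s).
  apply: continuous_measurable_fun => x; apply: continuousD; [exact: cvg_id|exact: cvg_cst].
by have := mf measurableT _ mA; rewrite setTI.
Qed.

Lemma lebesgue_measure_translation (s : R) (A : set R) :
  measurable A -> lebesgue_measure [set t | A (t + s)] = lebesgue_measure A.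
Proof.
move=> mA.
have mf : measurable_fun [set: measurableTypeR R] (fun t : R => t + s : measurableTypeR R).
  by move=> _ B mB; rewrite setTI; exact: measurable_translation.
rewrite [RHS](@lebesgue_measure_unique _ (pushforward lebesgue_measure (fun t : R => t + s : measurableTypeR R))) //.
move=> X /ocitvP[->|[[a b] /= ab ->]]; first by rewrite !measure0.
rewrite /pushforward.
have -> : (fun t : R => t + s) @^-1` `]a, b] = `]a - s, b - s]%classic.
  by apply/seteqP; split => t /=; rewrite !in_itv /= ltrBlDr lerBrDr.
rewrite !lebesgue_measure_itv /= !lte_fin ltrD2r; case: ltP => // _.
by rewrite -!EFinB; congr EFin; ring.
Qed.

Lemma negligible_translation (s : R) (N : set R) :
  lebesgue_measure.-negligible N -> lebesgue_measure.-negligible [set t | N (t + s)].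
Proof.
case=> A [mA A0 NA]; exists [set t | A (t + s)]; split.
- exact: measurable_translation.
- by rewrite lebesgue_measure_translation.
- by move=> t /=; exact: NA.
Qed.

Lemma ae_translation (s : R) (P : R -> Prop) :
  {ae @lebesgue_measure R, forall t, P t} ->
  {ae @lebesgue_measure R, forall t, P (t + s)}.
Proof. exact: negligible_translation. Qed.

Lemma ae_imply (P Q : R -> Prop) : (forall t, P t -> Q t) ->
  {ae @lebesgue_measure R, forall t, P t} -> {ae @lebesgue_measure R, forall t, Q t}.
Proof. by move=> PQ; apply: negligibleS => t /= nQ /PQ. Qed.

Lemma ae_imply2 (P Q S : R -> Prop) : (forall t, P t -> Q t -> S t) ->
  {ae @lebesgue_measure R, forall t, P t} ->
  {ae @lebesgue_measure R, forall t, Q t} ->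
  {ae @lebesgue_measure R, forall t, S t}.
Proof.
move=> PQS aeP aeQ; apply: negligibleS (negligibleU aeP aeQ) => t /= nS.
by have [p|] := pselect (P t); [right => q; apply: nS; exact: PQS | left].
Qed.

Lemma ae_all (P : R -> Prop) : (forall t, P t) -> {ae @lebesgue_measure R, forall t, P t}.
Proof.
by move=> allP; apply: negligibleS (@negligible_set0 _ _ _ lebesgue_measure) => t /=; apply.
Qed.

Lemma ae_neq (a : R) : {ae @lebesgue_measure R, forall t, t <> a}.
Proof.
apply: negligibleS (lebesgue_negligible_set1 a) => t /=; exact: contrapT.
Qed.

(** The form in which translation is applied: a Borel part and a negligible part, moved
    separately. *)
Lemma lebesgue_measurableP (E : set R) :
  lebesgue_measurable E <-> exists A N, [/\ measurable A,
    (@lebesgue_measure R).-negligible N & A `|` N = E].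
Proof.
rewrite /lebesgue_measurable g_sigma_completed_algebra_genE; split.
  by case=> A mA [N nN <-]; exists A, N.
by case=> A [N [mA nN <-]]; exists A => //; exists N.
Qed.

Lemma lebesgue_measurable_translation (s : R) (E : set R) :
  lebesgue_measurable E -> lebesgue_measurable [set t | E (t + s)].
Proof.
move=> /lebesgue_measurableP[A [N [mA nN <-]]]; apply/lebesgue_measurableP.
exists [set t | A (t + s)], [set t | N (t + s)]; split => //.
  exact: measurable_translation.
exact: negligible_translation.
Qed.

Lemma measurable_lebesgue (E : set R) : measurable E -> lebesgue_measurable E.
Proof.
move=> mE; apply/lebesgue_measurableP; exists E, set0; split => //.
  exact: negligible_set0.
by rewrite setU0.
Qed.

Lemma lebesgue_measurableU (E D : set R) :
  lebesgue_measurable E -> lebesgue_measurable D -> lebesgue_measurable (E `|` D).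
Proof. by move=> mE mD; apply: measurableU. Qed.

Lemma lebesgue_measurableI (E D : set R) :
  lebesgue_measurable E -> lebesgue_measurable D -> lebesgue_measurable (E `&` D).
Proof. by move=> mE mD; apply: measurableI. Qed.

Lemma lebesgue_measurable_bigcup (E : nat -> set R) :
  (forall i, lebesgue_measurable (E i)) -> lebesgue_measurable (\bigcup_i E i).
Proof. by move=> mE; apply: bigcupT_measurable. Qed.

Lemma lebesgue_measurable_itv (i : interval R) : lebesgue_measurable [set` i].
Proof. by apply: measurable_lebesgue; exact: measurable_itv. Qed.

End Translation.

(** * Absolutely continuous functions *)

Section AbsCont.
Context {R : realType}.

Lemma mean_value_enorm n (a b : R) (x rhs : R -> 'rV[R]_n) (K : R) :
  a <= b -> 0 <= K -> abs_cont a b x ->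
  {ae @lebesgue_measure R, forall t : R, a < t -> t < b ->
     is_derive t 1 x (rhs t) /\ enorm (rhs t) <= K} ->
  enorm (x b - x a) <= K * (b - a).
Proof.
apply: (abs_cont_mean_value (cn := n%:R)) => //.
- exact: enormD.
- exact: enorm_le_norm.
- exact: enormZ.
Qed.

Lemma abs_contS n (a b a' b' : R) (x : R -> 'rV[R]_n) :
  a <= a' -> b' <= b -> abs_cont a b x -> abs_cont a' b' x.
Proof.
move=> aa bb ac e e0; have [d d0 H] := ac e e0; exists d => // N s s' ss.
by apply: H => i; have [h1 [h2 h3]] := ss i; split; [|split]; lra.
Qed.

Lemma eq_abs_cont n (a b : R) (x y : R -> 'rV[R]_n) :
  (forall t, a <= t <= b -> x t = y t) -> abs_cont a b x -> abs_cont a b y.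
Proof.
move=> xy ac e e0; have [d d0 H] := ac e e0; exists d => // N s s' ss tri sm.
apply: le_lt_trans (H N s s' ss tri sm).
apply: ler_sum => i _; have [h1 [h2 h3]] := ss i.
by rewrite !xy //; apply/andP; split; lra.
Qed.

Lemma abs_cont_comp n p (a b L : R) (x : R -> 'rV[R]_n) (y : R -> 'rV[R]_p) :
  0 <= L -> (forall s t, a <= s <= b -> a <= t <= b ->
    enorm (y t - y s) <= L * enorm (x t - x s)) ->
  abs_cont a b x -> abs_cont a b y.
Proof.
move=> L0 xy ac e e0.
(* [L + 1] because [L] may vanish. *)
have eL : 0 < e / (L + 1) by rewrite divr_gt0 // ltr_wpDl.
have [d d0 H] := ac _ eL; exists d => // N s s' ss tri sm.
have := H N s s' ss tri sm; rewrite ltr_pdivlMr ?ltr_wpDl // => H1.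
apply: le_lt_trans H1; rewrite mulr_suml.
apply: ler_sum => i _; have [h1 [h2 h3]] := ss i.
apply: le_trans (xy _ _ _ _) _; [apply/andP; split; lra | apply/andP; split; lra|].
by rewrite mulrC ler_wpM2l ?enorm_ge0 // lerDl.
Qed.

(** The target is a third space so that juxtaposition and difference are both instances. *)
Lemma abs_contD_bound n p q (a b : R) (x : R -> 'rV[R]_n) (y : R -> 'rV[R]_p)
  (z : R -> 'rV[R]_q) :
  (forall s t, a <= s <= b -> a <= t <= b ->
    enorm (z t - z s) <= enorm (x t - x s) + enorm (y t - y s)) ->
  abs_cont a b x -> abs_cont a b y -> abs_cont a b z.
Proof.
move=> xyz acx acy e e0.
have e2 : 0 < e / 2 by rewrite divr_gt0.
have [d1 d10 H1] := acx _ e2; have [d2 d20 H2] := acy _ e2.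
exists (Num.min d1 d2) => [|N s s' ss tri]; first by rewrite lt_min d10.
rewrite lt_min => /andP[/(H1 N s s' ss tri) sm1 /(H2 N s s' ss tri) sm2].
rewrite (splitr e); apply: le_lt_trans (ltrD sm1 sm2).
rewrite -big_split /=; apply: ler_sum => i _; have [h1 [h2 h3]] := ss i.
by apply: xyz; apply/andP; split; lra.
Qed.

Lemma abs_cont_row_mx n p (a b : R) (x : R -> 'rV[R]_n) (y : R -> 'rV[R]_p) :
  abs_cont a b x -> abs_cont a b y -> abs_cont a b (fun t => row_mx (x t) (y t)).
Proof.
apply: abs_contD_bound => s t _ _.
by rewrite opp_row_mx add_row_mx enorm_row_mx.
Qed.

Lemma abs_contB n (a b : R) (x y : R -> 'rV[R]_n) :
  abs_cont a b x -> abs_cont a b y -> abs_cont a b (fun t => x t - y t).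
Proof.
apply: abs_contD_bound => s t _ _.
have -> : x t - y t - (x s - y s) = (x t - x s) - (y t - y s).
  by rewrite !opprD !opprK addrACA.
by apply: le_trans (enormD _ _) _; rewrite enormN.
Qed.

Lemma abs_cont_shift n (a b s : R) (x : R -> 'rV[R]_n) :
  abs_cont (a + s) (b + s) x -> abs_cont a b (fun t => x (t + s)).
Proof.
move=> ac e e0; have [d d0 H] := ac e e0; exists d => // N r r' rr tri sm.
apply: (H N (fun i => r i + s) (fun i => r' i + s)).
- by move=> i; have [h1 [h2 h3]] := rr i; split; [|split]; lra.
- move=> i j _ _ [t [/=]]; rewrite !in_itv /= => /andP[t1 t2] /andP[t3 t4].
  apply: tri => //; exists (t - s); split; rewrite /= in_itv /=; apply/andP; split; lra.
- by under eq_bigr do rewrite opprD addrACA subrr addr0.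
Qed.

Lemma abs_cont_cat n (a b c : R) (x : R -> 'rV[R]_n) :
  abs_cont a b x -> abs_cont b c x -> abs_cont a c x.
Proof.
move=> acx acy e e0.
have e2 : 0 < e / 2 by rewrite divr_gt0.
have [d1 d10 H1] := acx _ e2; have [d2 d20 H2] := acy _ e2.
exists (Num.min d1 d2) => [|N s s' ss tri]; first by rewrite lt_min d10.
have [cb|bc] := ltP c b.
  have cb' := ltW cb.
  rewrite lt_min => /andP[sm _]; apply: lt_trans (H1 N s s' _ tri sm) _; last lra.
  by move=> i; have [h1 [h2 h3]] := ss i; split; [|split]; lra.
have [ba|ab] := ltP b a.
  have cb' := ltW ba.
  rewrite lt_min => /andP[_ sm]; apply: lt_trans (H2 N s s' _ tri sm) _; last lra.
  by move=> i; have [h1 [h2 h3]] := ss i; split; [|split]; lra.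
(* An interval may straddle [b]. Clipping sends it to one interval on each side, and the increments
   add up through [x b]; a clipped interval that collapses to [b] contributes 0. *)
pose lo t := Num.min t b; pose hi t := Num.max t b.
have lohi (i : 'I_N) : [/\ lo (s i) <= lo (s' i), hi (s i) <= hi (s' i),
    lo (s' i) - lo (s i) <= s' i - s i & hi (s' i) - hi (s i) <= s' i - s i].
  have := ss i; rewrite /lo /hi /Num.min /Num.max; clear => -[h1 [h2 h3]].
  by case: ltP => p1; case: ltP => p2; split; lra.
rewrite lt_min => /andP[sm1 sm2].
have B1 : \sum_(i < N) enorm (x (lo (s' i)) - x (lo (s i))) < e / 2.
  apply: (H1 N (fun i => lo (s i)) (fun i => lo (s' i))).
  - move=> i; have := ss i; move: ab bc; clear => ab bc [h1 [h2 h3]]; rewrite /lo /Num.min.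
    by case: ltP => p1; case: ltP => p2; split; [|split| |split| |split| |split]; lra.
  - move=> i j _ _ [t [/=]]; rewrite !in_itv /= => ti tj.
    apply: tri => //; exists t; split; rewrite /= in_itv /=.
      by have [_ [h2 _]] := ss i; move: ti h2; clear; rewrite /lo /Num.min; case: (ltP (s i) b) => p1; case: (ltP (s' i) b) => p2 /andP[q1 q2] h2; apply/andP; split; lra.
    by have [_ [h2 _]] := ss j; move: tj h2; clear; rewrite /lo /Num.min; case: (ltP (s j) b) => p1; case: (ltP (s' j) b) => p2 /andP[q1 q2] h2; apply/andP; split; lra.
  - by apply: le_lt_trans sm1; apply: ler_sum => i _; have [] := lohi i.
have B2 : \sum_(i < N) enorm (x (hi (s' i)) - x (hi (s i))) < e / 2.
  apply: (H2 N (fun i => hi (s i)) (fun i => hi (s' i))).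
  - move=> i; have := ss i; move: ab bc; clear => ab bc [h1 [h2 h3]]; rewrite /hi /Num.max.
    by case: ltP => p1; case: ltP => p2; split; [|split| |split| |split| |split]; lra.
  - move=> i j _ _ [t [/=]]; rewrite !in_itv /= => ti tj.
    apply: tri => //; exists t; split; rewrite /= in_itv /=.
      by have [_ [h2 _]] := ss i; move: ti h2; clear; rewrite /hi /Num.max; case: (ltP (s i) b) => p1; case: (ltP (s' i) b) => p2 /andP[q1 q2] h2; apply/andP; split; lra.
    by have [_ [h2 _]] := ss j; move: tj h2; clear; rewrite /hi /Num.max; case: (ltP (s j) b) => p1; case: (ltP (s' j) b) => p2 /andP[q1 q2] h2; apply/andP; split; lra.
  - by apply: le_lt_trans sm2; apply: ler_sum => i _; have [] := lohi i.
rewrite (splitr e); apply: le_lt_trans (ltrD B1 B2).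
rewrite -big_split /=; apply: ler_sum => i _.
rewrite /lo /hi /Num.min /Num.max; have [h1 [h2 h3]] := ss i.
case: ltP => p1; case: ltP => p2.
- by rewrite subrr enorm0 addr0.
- lra.
- by rewrite addrC; apply: le_trans (enormD _ _); rewrite subrKA.
- by rewrite subrr enorm0 add0r.
Qed.

Lemma abs_cont_continuous n (a b : R) (x : R -> 'rV[R]_n) :
  abs_cont a b x -> {within `[a, b], continuous x}.
Proof.
move=> ac; apply/subspace_continuousP => t; rewrite /= in_itv /= => /andP[at_ tb].
apply/(@cvgrPdist_lt _ _ _ _ (within_filter _ (nbhs_filter t))) => e e0.
have [d d0 H] := ac e e0.
have /= key s s' : a <= s -> s <= s' -> s' <= b -> s' - s < d -> enorm (x s' - x s) < e.
  move=> h1 h2 h3 sd; have := H 1%N (fun=> s) (fun=> s'); rewrite !big_ord1; apply => //.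
  by move=> i j _ _ _; rewrite !ord1.
apply: filterS (nbhsx_ballx t _ d0) => s; rewrite -ball_normE /= ltr_distl => /andP[s1 s2].
rewrite in_itv /= => /andP[as_ sb]; apply: le_lt_trans (norm_le_enorm _) _.
by have [st|ts] := leP s t; [|rewrite enormB]; apply: key; lra.
Qed.

End AbsCont.

(** * Caratheodory solutions *)

Section Solves.
Context {R : realType}.

Lemma is_derive_translation (V : normedModType R) (s t : R) (x : R -> V) (y : V) :
  is_derive (t + s) 1 x y -> is_derive t 1 (fun t => x (t + s)) y.
Proof.
have e : (fun h : R => h^-1 *: (((fun t => x (t + s)) \o shift t) (h *: (1 : R)) - x (t + s)))
  = (fun h : R => h^-1 *: ((x \o shift (t + s)) (h *: (1 : R)) - x (t + s))).
  by apply/funext => h /=; rewrite addrA.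
case; rewrite /derivable /derive => d v.
by split; rewrite /derivable /derive e.
Qed.

Lemma is_derive_near (V : normedModType R) (t : R) (x y : R -> V) (d : V) :
  (\forall s \near t, x s = y s) -> is_derive t 1 x d -> is_derive t 1 y d.
Proof. by move=> xy; apply: near_eq_is_derive; rewrite ?oner_neq0. Qed.

Variable n : nat.
Implicit Types (x y rhs : R -> 'rV[R]_n) (a b : R) (T : \bar R).

Lemma solvesW a a' T T' x rhs :
  a <= a' -> (T' <= T)%E -> solves a T x rhs -> solves a' T' x rhs.
Proof.
move=> aa TT [ac de]; split.
  move=> b ab bT; apply: abs_contS (ac b _ _) => //; first exact: le_trans ab.
  exact: lt_le_trans TT.
by apply: ae_imply de => t H at_ tT; apply: H; [exact: le_trans at_ | exact: lt_le_trans TT].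
Qed.

Lemma near_open_interval a T t : a < t -> (t%:E < T)%E ->
  \forall s \near t, a <= s /\ (s%:E < T)%E.
Proof.
move=> at_ tT.
have [T' TT' tT'] : exists2 T' : R, (T'%:E <= T)%E & t < T'.
  case: T tT => [T|_|//]; first by rewrite lte_fin => tT; exists T.
  by exists (t + 1); rewrite ?leey // ltrDl.
have d0 : 0 < Num.min (t - a) (T' - t) by rewrite lt_min !subr_gt0 at_.
apply: filterS (nbhsx_ballx t _ d0) => s.
rewrite -ball_normE /= ltr_distl => /andP[s1 s2].
have m1 : Num.min (t - a) (T' - t) <= t - a by rewrite ge_min lexx.
have m2 : Num.min (t - a) (T' - t) <= T' - t by rewrite ge_min lexx orbT.
by split; [lra | apply: lt_le_trans TT'; rewrite lte_fin; lra].
Qed.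

(** Derivatives in [solves] are two-sided, so that [x] and [y] have to agree around [t]; this can
    fail only at [a], a null set. For the same reason the right-hand sides are compared for
    [t > a]. *)
Lemma eq_solves a T x y rhs rhs' :
  (forall t, a <= t -> (t%:E < T)%E -> x t = y t) ->
  (forall t, a < t -> (t%:E < T)%E -> rhs t = rhs' t) ->
  solves a T x rhs -> solves a T y rhs'.
Proof.
move=> xy rr [ac de]; split.
  move=> b ab bT; apply: eq_abs_cont (ac b ab bT) => t /andP[at_ tb]; apply: xy => //.
  by apply: le_lt_trans bT; rewrite lee_fin.
apply: (ae_imply2 _ de (ae_neq a)) => t H ta at_ tT.
have at' : a < t by rewrite lt_neqAle at_ andbT eq_sym; apply/eqP.
rewrite -rr //; apply: is_derive_near (H at_ tT).
by apply: filterS (near_open_interval at' tT) => s [? ?]; exact: xy.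
Qed.

Lemma solves_shift a T s x rhs :
  solves (a + s) (T + s%:E)%E x rhs ->
  solves a T (fun t => x (t + s)) (fun t => rhs (t + s)).
Proof.
case=> ac de; split.
  move=> b ab bT; apply: abs_cont_shift; apply: ac; first by rewrite lerD2r.
  by rewrite EFinD lteD2rE.
apply: ae_imply (ae_translation s de) => t H at_ tT.
apply: is_derive_translation; apply: H; first by rewrite lerD2r.
by rewrite EFinD lteD2rE.
Qed.

(** [solves a b] constrains [x] strictly before [b]; absolute continuity up to [b] excludes a jump
    there. *)
Lemma solves_cat a b T x rhs :
  a <= b -> abs_cont a b x -> solves a b%:E x rhs -> solves b T x rhs ->
  solves a T x rhs.
Proof.
move=> ab acab [_ de1] [ac2 de2]; split.
  move=> c ac cT; have [bc|cb] := leP b c.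
    by apply: abs_cont_cat acab _; exact: ac2.
  by apply: abs_contS acab => //; exact: ltW.
apply: (ae_imply2 _ de1 de2) => t H1 H2 at_ tT.
by have [bt|tb] := leP b t; [exact: H2 | apply: H1].
Qed.

Lemma solves_continuous a T x rhs b :
  solves a T x rhs -> (b%:E < T)%E -> {within `[a, b], continuous x}.
Proof.
case=> ac _ bT; have [ab|ba] := leP a b.
  by apply: abs_cont_continuous; exact: ac.
by rewrite set_itv_ge -?ltNge ?bnd_simp // ; exact: continuous_subspace0.
Qed.

Lemma solves_mean_value a T x rhs s t (K : R) :
  solves a T x rhs -> a <= s -> s <= t -> (t%:E < T)%E -> 0 <= K ->
  {ae @lebesgue_measure R, forall p, s < p -> p < t -> enorm (rhs p) <= K} ->
  enorm (x t - x s) <= K * (t - s).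
Proof.
move=> [ac de] as_ st tT K0 bd.
apply: (mean_value_enorm (rhs := rhs)) => //.
  by apply: abs_contS (ac t (le_trans as_ st) tT).
apply: (ae_imply2 _ de bd) => p H1 H2 sp pt; split; last exact: H2.
apply: H1; first by apply: le_trans as_ _; exact: ltW.
by apply: lt_trans tT; rewrite lte_fin.
Qed.

End Solves.

(** * Smooth maps on finite-dimensional spaces *)

Section FiniteDimension.
Context {R : realType}.

(** Finite dimension as a continuous linear parametrisation with a section of linear growth, not
    assumed linear. It passes to products, the domains on which [f] and [F] are smooth. *)
Definition finite_coords (V : normedModType R) : Prop :=
  exists (N : nat) (phi : {linear 'rV[R]_N -> V}) (psi : V -> 'rV[R]_N) (c : R),
  [/\ continuous phi, 0 <= c, cancel psi phi & forall v, `|psi v| <= c * `|v|].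

Lemma finite_coords_rV n : finite_coords 'rV[R]_n.
Proof.
by exists n, idfun, idfun, 1; split => // [x|v]; [exact: cvg_id | rewrite mul1r].
Qed.

Lemma norm_row_mx n p (x : 'rV[R]_n) (y : 'rV[R]_p) :
  `|row_mx x y| <= Num.max `|x| `|y|.
Proof.
apply: rV_norm_le => [|i]; first by rewrite le_max normr_ge0.
by case: (split_ordP i) => j ->; rewrite ?row_mxEl ?row_mxEr le_max norm_coord ?orbT.
Qed.

Lemma finite_coords_prod (V W : normedModType R) :
  finite_coords V -> finite_coords W -> finite_coords (V * W)%type.
Proof.
move=> [N1 [phi1 [psi1 [c1 [cphi1 c10 K1 b1]]]]] [N2 [phi2 [psi2 [c2 [cphi2 c20 K2 b2]]]]].
pose phi (y : 'rV[R]_(N1 + N2)) : V * W := (phi1 (lsubmx y), phi2 (rsubmx y)).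
have phi_lin : linear phi.
  by move=> a y z; rewrite /phi !linearD !linearZ.
pose phiL := GRing.isLinear.Build R _ _ _ phi phi_lin.
pose phi' : {linear 'rV[R]_(N1 + N2) -> (V * W)%type} := HB.pack phi phiL.
exists (N1 + N2)%N, phi', (fun p => row_mx (psi1 p.1) (psi2 p.2)), (Num.max c1 c2); split.
- have cl : continuous (phi1 \o @lsubmx R 1 N1 N2).
    by move=> y; apply: continuous_comp; [exact: continuous_lsubmx | exact: cphi1].
  have cr : continuous (phi2 \o @rsubmx R 1 N1 N2).
    by move=> y; apply: continuous_comp; [exact: continuous_rsubmx | exact: cphi2].
  by move=> y; exact: (cvg_pair (cl y) (cr y)).
- by rewrite le_max c10.
- by move=> [v w]; rewrite /= /phi /= row_mxKl row_mxKr K1 K2.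
- move=> [v w]; apply: le_trans (norm_row_mx _ _) _; rewrite prod_normE /= ge_max.
  apply/andP; split.
    by apply: le_trans (b1 _) _; apply: ler_pM => //; rewrite le_max lexx.
  by apply: le_trans (b2 _) _; apply: ler_pM => //; rewrite le_max lexx orbT.
Qed.

Lemma closed_ball_rV_compact n (r : R) : compact [set v : 'rV[R]_n | `|v| <= r].
Proof.
apply: bounded_closed_compact.
  by exists r; split; [exact: num_real | move=> x rx v /= vr; apply: le_trans vr (ltW rx)].
have -> : [set v : 'rV[R]_n | `|v| <= r] = (fun v => `|v|) @^-1` [set x | x <= r] by [].
by apply: closed_comp => [v _|]; [exact: norm_continuous | exact: closed_le].
Qed.

(** [psi] maps the ball into a ball of coordinates of radius [c * r], which is compact. *)
Lemma continuous_bounded (V W : normedModType R) (g : V -> W) (r : R) :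
  finite_coords V -> continuous g ->
  exists2 K : R, 0 <= K & forall v, `|v| <= r -> `|g v| <= K.
Proof.
move=> [N [phi [psi [c [cphi c0 K b]]]]] cg.
have cgphi : {within [set y : 'rV[R]_N | `|y| <= c * r], continuous (g \o phi)}.
  by apply: continuous_subspaceT => y; apply: continuous_comp; [exact: cphi | exact: cg].
have [M [_ HM]] := compact_bounded (continuous_compact cgphi (@closed_ball_rV_compact N (c * r))).
exists (`|M| + 1) => [|v vr]; first by rewrite addr_ge0.
apply: (HM (`|M| + 1)); first by rewrite (le_lt_trans (ler_norm _)) // ltrDl.
exists (psi v); last by rewrite /= K.
by apply: le_trans (b v) _; rewrite ler_wpM2l.
Qed.

(** Differentiability holds at every point of [0, 1]: real induction meets no exceptional set, and
    the slack [e] absorbs the remainder. *)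
Lemma derive_bound_lipschitz (W : normedModType R) (y dy : R -> W) (K : R) :
  (forall t : R, 0 <= t <= 1 -> is_derive t 1 y (dy t) /\ `|dy t| <= K) ->
  `|y 1 - y 0| <= K.
Proof.
move=> H; have K0 : 0 <= K.
  by have [|_] := H 0; [rewrite lexx ler01 | exact: le_trans].
apply/ler_addgt0Pr => e e0.
suff : `|y 1 - y 0| <= (K + e) * 1 by rewrite mulr1.
apply: (@real_induction R 0 1 (fun t => `|y t - y 0| <= (K + e) * t)) => //.
  by rewrite subrr normr0 mulr0.
move=> c c01; have [dc Kc] := H c c01.
have [d d0 Hd] := is_derive_approx dc e0; exists d => // s t s0 cs sc ct td t1 est.
have loc p : `|p - c| < d -> `|y p - y c| <= (K + e) * `|p - c|.
  move=> /Hd Hp; rewrite -(subrK ((p - c) *: dy c) (y p - y c)).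
  apply: le_trans (ler_normD _ _) _; rewrite addrC mulrDl; apply: lerD => //.
  by rewrite normrZ mulrC ler_wpM2r.
have /loc : `|t - c| < d by rewrite ltr_distl; apply/andP; split; lra.
have /loc : `|s - c| < d by rewrite ltr_distl; apply/andP; split; lra.
rewrite [`|s - c|]ler0_norm ?subr_le0 // [`|t - c|]ger0_norm ?subr_ge0 // => e1 e2.
have -> : y t - y 0 = (y t - y c) - (y s - y c) + (y s - y 0).
  by rewrite opprB subrKA subrKA.
apply: le_trans (ler_normD _ _) _; apply: le_trans (lerD (ler_normB _ _) (lexx _)) _.
lra.
Qed.

Lemma is_derive_comp (V W : normedModType R) (g : V -> W) (x : R -> V) (t : R) (y : V) :
  differentiable g (x t) -> is_derive t 1 x y ->
  is_derive t 1 (fun t => g (x t)) ('d g (x t) y).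
Proof.
move=> dg [dx <-].
have dx' : differentiable x t by apply/derivable1_diffP.
have dgx : differentiable (g \o x) t by exact: differentiable_comp.
split; first exact/derivable1_diffP.
by rewrite !deriveE // diff_comp.
Qed.

Lemma is_derive_line (V : normedModType R) (q w : V) (t : R) :
  is_derive t 1 (fun t : R => q + t *: w) w.
Proof.
have H : is_diff t (fun t : R => t *: w) (fun t : R => t *: w) := is_diff_scalel t w.
rewrite -[X in is_derive _ _ _ X]add0r; apply: (is_deriveD (f := cst q)).
split; first by apply/derivable1_diffP; case: H.
by rewrite deriveE ?diff_val ?scale1r //; case: H.
Qed.

(** Finitely many directional derivatives, along the images of the basis vectors, are bounded on the
    ball by compactness; the others are combinations of them, and the segment from [q] to [p] stays
    in the ball. *)
Lemma C1_lipschitz (V W : normedModType R) (g : V -> W) (r : R) :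
  finite_coords V -> (forall p, differentiable g p) ->
  (forall v, continuous ('D_v g)) ->
  exists2 L : R, 0 <= L & forall p q, `|p| <= r -> `|q| <= r ->
    `|g p - g q| <= L * `|p - q|.
Proof.
move=> fV dg cg; have [N [phi [psi [c [cphi c0 psiK b]]]]] := fV.
pose e i := phi (delta_mx ord0 i).
have /choice [K HK] : forall i, exists K : R, 0 <= K /\ forall v, `|v| <= r -> `|'D_(e i) g v| <= K.
  by move=> i; have [K ? ?] := @continuous_bounded V W _ r fV (cg (e i)); exists K.
have dec v : v = \sum_i psi v ord0 i *: e i.
  by rewrite -{1}(psiK v) {1}(row_sum_delta (psi v)) linear_sum; apply: eq_bigr => i _; rewrite linearZ.
have bd p v : `|p| <= r -> `|'D_v g p| <= (\sum_i K i) * c * `|v|.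
  move=> pr; rewrite deriveE // {1}(dec v) linear_sum /=.
  apply: le_trans (ler_norm_sum _ _ _) _; rewrite -mulrA mulr_suml.
  apply: ler_sum => i _; rewrite linearZ /= normrZ mulrC -deriveE //.
  have [K0 HKi] := HK i; apply: ler_pM => //; first exact: HKi.
  by apply: le_trans (norm_coord _ _) _; exact: b.
exists ((\sum_i K i) * c) => [|p q pr qr].
  by rewrite mulr_ge0 // sumr_ge0 // => i _; have [] := HK i.
have := @derive_bound_lipschitz W (fun t => g (q + t *: (p - q))) (fun t => 'D_(p - q) g (q + t *: (p - q))).
rewrite scale1r addrCA subrr addr0 scale0r addr0; apply => t t01.
split; last first.
  apply: bd; have -> : q + t *: (p - q) = (1 - t) *: q + t *: p.
    by rewrite scalerBr scalerBl scale1r addrAC addrA.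
  apply: le_trans (ler_normD _ _) _; rewrite !normrZ.
  have /andP[t0 t1] := t01.
  rewrite [`|1 - t|]ger0_norm ?subr_ge0 // [`|t|]ger0_norm //.
  have h1 : (1 - t) * `|q| <= (1 - t) * r by rewrite ler_wpM2l // subr_ge0.
  have h2 : t * `|p| <= t * r by rewrite ler_wpM2l.
  lra.
rewrite deriveE //.
by apply: (is_derive_comp (x := fun t => q + t *: (p - q))) => //; exact: is_derive_line.
Qed.

End FiniteDimension.

(** * Lipschitz estimates on balls *)

Section LocallyLipschitz.
Context {R : realType}.

(** The same constant bounds the values, which tells in which ball the outer map of a composition is
    used. *)
Definition locally_lipschitz n p (g : 'rV[R]_n -> 'rV[R]_p) : Prop :=
  forall r : R, exists2 L : R, 0 <= L & forall x x', enorm x <= r -> enorm x' <= r ->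
    enorm (g x) <= L /\ enorm (g x - g x') <= L * enorm (x - x').

(** Uniform over inputs of bounded norm in [U]; the second argument is never varied, since
    trajectories are compared under a common input. *)
Definition lipschitz_field n m p (U : set 'rV[R]_m)
    (g : 'rV[R]_n -> 'rV[R]_m -> 'rV[R]_p) : Prop :=
  forall r : R, exists2 L : R, 0 <= L & forall x x' u,
    enorm x <= r -> enorm x' <= r -> U u -> enorm u <= r ->
    enorm (g x u) <= L /\ enorm (g x u - g x' u) <= L * enorm (x - x').

(** The bounds are those of a smooth extension to the whole space, so that segments between points
    of [D] may leave [D]. *)
Lemma smooth_on_lipschitz (V : normedModType R) p (D : set V) (g : V -> 'rV[R]_p) (r : R) :
  finite_coords V -> smooth_on D g ->
  exists2 L : R, 0 <= L & forall x x', D x -> D x' -> `|x| <= r -> `|x'| <= r ->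
    enorm (g x) <= L /\ enorm (g x - g x') <= L * `|x - x'|.
Proof.
move=> fV [g' smg' gg'].
have [dg' cg'] := smg' 1%N.
have cont : continuous g' := smg' 0%N.
have [K K0 HK] := continuous_bounded r fV cont.
have [L L0 HL] := C1_lipschitz r fV dg' cg'.
exists (p%:R * (K + L)) => [|x x' Dx Dx' xr xr']; first by rewrite mulr_ge0 // addr_ge0.
rewrite (gg' x) // (gg' x') //; split; apply: le_trans (enorm_le_norm _) _.
  by rewrite ler_wpM2l //; apply: le_trans (HK _ xr) _; rewrite lerDl.
rewrite -mulrA ler_wpM2l //; apply: le_trans (HL _ _ xr xr') _.
by rewrite ler_wpM2r // lerDr.
Qed.

Lemma smooth_locally_lipschitz n p (g : 'rV[R]_n -> 'rV[R]_p) :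
  smooth_on setT g -> locally_lipschitz g.
Proof.
move=> sg r; have [L L0 HL] := smooth_on_lipschitz r (@finite_coords_rV R n) sg.
exists L => // x x' xr xr'; have [||h1 h2] := HL x x' I I.
- exact: le_trans (norm_le_enorm _) xr.
- exact: le_trans (norm_le_enorm _) xr'.
split => //; apply: le_trans h2 _; rewrite ler_wpM2l //; exact: norm_le_enorm.
Qed.

Lemma smooth_lipschitz_field n m p (U : set 'rV[R]_m)
    (f : 'rV[R]_n -> 'rV[R]_m -> 'rV[R]_p) :
  smooth_on [set p : 'rV[R]_n * 'rV[R]_m | U p.2] (fun p => f p.1 p.2) ->
  lipschitz_field U f.
Proof.
move=> sf r.
have fc : finite_coords ('rV[R]_n * 'rV[R]_m)%type.
  by apply: finite_coords_prod; exact: finite_coords_rV.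
have [L L0 HL] := smooth_on_lipschitz r fc sf.
exists L => // x x' u xr xr' Uu ur.
have b (y : 'rV[R]_n) : enorm y <= r -> `|(y, u)| <= r.
  move=> yr; rewrite prod_normE /= ge_max.
  by rewrite (le_trans (norm_le_enorm y)) // (le_trans (norm_le_enorm u)).
have [h1 h2] := HL (x, u) (x', u) Uu Uu (b _ xr) (b _ xr').
split => //; apply: le_trans h2 _; rewrite ler_wpM2l // prod_normE /= subrr normr0.
by rewrite ge_max norm_le_enorm enorm_ge0.
Qed.

Lemma smooth3_lipschitz_field l k m p (U : set 'rV[R]_m)
    (F : 'rV[R]_l -> 'rV[R]_k -> 'rV[R]_m -> 'rV[R]_p) :
  smooth_on [set p : 'rV[R]_l * 'rV[R]_k * 'rV[R]_m | U p.2]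
    (fun p => F p.1.1 p.1.2 p.2) ->
  lipschitz_field U (fun (y : 'rV[R]_(l + k)) u => F (lsubmx y) (rsubmx y) u).
Proof.
move=> sf r.
have fc : finite_coords ('rV[R]_l * 'rV[R]_k * 'rV[R]_m)%type.
  by apply: finite_coords_prod; [apply: finite_coords_prod|]; exact: finite_coords_rV.
have [L L0 HL] := smooth_on_lipschitz r fc sf.
exists L => // x x' u xr xr' Uu ur.
have b (y : 'rV[R]_(l + k)) : enorm y <= r -> `|(lsubmx y, rsubmx y, u)| <= r.
  move=> yr; rewrite !prod_normE /= !ge_max (le_trans (norm_le_enorm u)) // andbT.
  rewrite (le_trans (norm_le_enorm _) (le_trans (enorm_lsubmx _) _)) //.
  by rewrite (le_trans (norm_le_enorm _) (le_trans (enorm_rsubmx _) _)).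
have [h1 h2] := HL (lsubmx x, rsubmx x, u) (lsubmx x', rsubmx x', u) Uu Uu (b _ xr) (b _ xr').
split => //; apply: le_trans h2 _; rewrite ler_wpM2l // !prod_normE /= subrr normr0.
rewrite !ge_max enorm_ge0 andbT -!linearB /=.
rewrite (le_trans (norm_le_enorm _) (enorm_lsubmx _)) //.
by rewrite (le_trans (norm_le_enorm _) (enorm_rsubmx _)).
Qed.

Lemma smooth_differentiable n p (g : 'rV[R]_n -> 'rV[R]_p) :
  smooth_on setT g -> forall x, differentiable g x.
Proof.
move=> [g' smg' gg'] x; have -> : g = g' by apply/funext => y; exact: gg'.
by have [] := smg' 1%N.
Qed.

Lemma enorm_sum p N (a : 'I_N -> 'rV[R]_p) : enorm (\sum_i a i) <= \sum_i enorm (a i).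
Proof.
elim/big_ind2 : _ => // [|x1 x2 y1 y2 H1 H2]; first by rewrite enorm0.
by apply: le_trans (enormD _ _) _; exact: lerD.
Qed.

Lemma linear_family_lipschitz n p (D : 'rV[R]_n -> 'rV[R]_n -> 'rV[R]_p)
    (E : 'I_n -> 'rV[R]_n -> 'rV[R]_p) (r : R) :
  (forall x v, D x v = \sum_i v ord0 i *: E i x) ->
  (forall i, locally_lipschitz (E i)) ->
  exists2 L : R, 0 <= L & forall x x' v v' : 'rV[R]_n, enorm x <= r -> enorm x' <= r ->
    enorm (D x v) <= L * enorm v /\
    enorm (D x v - D x' v') <= L * enorm v * enorm (x - x') + L * enorm (v - v').
Proof.
move=> dec lE.
have /choice [L HL] : forall i : 'I_n, exists L : R, 0 <= L /\
    forall x x', enorm x <= r -> enorm x' <= r ->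
    enorm (E i x) <= L /\ enorm (E i x - E i x') <= L * enorm (x - x').
  by move=> i; have [L L0 H] := lE i r; exists L.
have first_bound x v : enorm x <= r -> enorm (D x v) <= (\sum_i L i) * enorm v.
  move=> xr; rewrite dec; apply: le_trans (enorm_sum _) _; rewrite mulr_suml.
  apply: ler_sum => i _; rewrite enormZ mulrC.
  have [L0 H] := HL i; apply: ler_pM; rewrite ?enorm_ge0 ?coord_enorm //.
  by have [] := H x x xr xr.
exists (\sum_i L i) => [|x x' v v' xr xr']; first by apply: sumr_ge0 => i _; have [] := HL i.
split; first exact: first_bound.
(* One argument is varied at a time, through [D x' v]. *)
have -> : D x v - D x' v' = (D x v - D x' v) + D x' (v - v').
  rewrite !dec -!sumrB -big_split /=; apply: eq_bigr => i _.
  by rewrite !mxE scalerDl scaleNr subrKA.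
apply: le_trans (enormD _ _) _; apply: lerD; last exact: first_bound.
rewrite !dec -sumrB; apply: le_trans (enorm_sum _) _; rewrite -mulrA mulr_suml.
apply: ler_sum => i _; rewrite -scalerBr enormZ mulrCA.
have [L0 H] := HL i; apply: ler_pM; rewrite ?enorm_ge0 ?coord_enorm //.
by have [] := H x x' xr xr'.
Qed.

(* The differential is linear in its second argument, so that its dependence on
   the base point reduces to that of the finitely many partial derivatives. *)
Lemma diff_lipschitz n p (h : 'rV[R]_n -> 'rV[R]_p) (r : R) :
  smooth_on setT h ->
  exists2 L : R, 0 <= L & forall x x' v v' : 'rV[R]_n, enorm x <= r -> enorm x' <= r ->
    enorm ('d h x v) <= L * enorm v /\
    enorm ('d h x v - 'd h x' v') <= L * enorm v * enorm (x - x') + L * enorm (v - v').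
Proof.
move=> sh; apply: (@linear_family_lipschitz n p (fun x v => 'd h x v)
  (fun i => 'D_(delta_mx ord0 i) h)).
- move=> x v; rewrite {1}(row_sum_delta v) linear_sum; apply: eq_bigr => i _.
  by rewrite linearZ deriveE //; exact: smooth_differentiable.
- move=> i; apply: smooth_locally_lipschitz.
  case: sh => h' smh' hh'; have -> : h = h' by apply/funext => y; exact: hh'.
  by exists ('D_(delta_mx ord0 i) h') => // j; have [_ HD] := smh' j.+1; exact: HD.
Qed.

Lemma lipschitz_field_Lfh n m k (U : set 'rV[R]_m) (f : 'rV[R]_n -> 'rV[R]_m -> 'rV[R]_n)
    (h : 'rV[R]_n -> 'rV[R]_k) :
  lipschitz_field U f -> smooth_on setT h -> lipschitz_field U (Lfh f h).
Proof.
move=> lf sh r.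
have [K K0 HK] := lf r; have [L L0 HL] := diff_lipschitz r sh.
exists (L * K + L * K) => [|x x' u xr xr' Uu ur]; first by rewrite addr_ge0 // mulr_ge0.
have [f1 f2] := HK x x' u xr xr' Uu ur.
have [h1 h2] := HL x x' (f x u) (f x' u) xr xr'.
split.
  apply: le_trans h1 _; apply: (@le_trans _ _ (L * K)); first by rewrite ler_wpM2l.
  by rewrite lerDl mulr_ge0.
apply: le_trans h2 _; rewrite mulrDl; apply: lerD.
  by rewrite ler_wpM2r ?enorm_ge0 // ler_wpM2l.
by rewrite -mulrA ler_wpM2l.
Qed.

Lemma lipschitz_field_comp n n' m p (U : set 'rV[R]_m)
    (g : 'rV[R]_n -> 'rV[R]_m -> 'rV[R]_p) (Psi : 'rV[R]_n' -> 'rV[R]_n) :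
  lipschitz_field U g -> locally_lipschitz Psi ->
  lipschitz_field U (fun z u => g (Psi z) u).
Proof.
move=> lg lP r; have [K K0 HK] := lP r; have [L L0 HL] := lg (Num.max K r).
exists (L * K + L) => [|z z' u zr zr' Uu ur]; first by rewrite addr_ge0 // mulr_ge0.
have [p1 p2] := HK z z' zr zr'; have [p1' _] := HK z' z zr' zr.
have m1 : K <= Num.max K r by rewrite le_max lexx.
have m2 : r <= Num.max K r by rewrite le_max lexx orbT.
have [h1 h2] := HL (Psi z) (Psi z') u (le_trans p1 m1) (le_trans p1' m1) Uu (le_trans ur m2).
split; first by apply: le_trans h1 _; rewrite lerDr mulr_ge0.
apply: le_trans h2 _; rewrite mulrDl.
apply: (@le_trans _ _ (L * K * enorm (z - z'))); first by rewrite -mulrA ler_wpM2l.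
by rewrite lerDl mulr_ge0 // enorm_ge0.
Qed.

Lemma locally_lipschitz_lsubmx n p : locally_lipschitz (@lsubmx R 1 n p).
Proof.
move=> r; exists (Num.max 1 r) => [|x x' xr xr']; first by rewrite le_max ler01.
split; first by apply: le_trans (enorm_lsubmx _) _; rewrite le_max xr orbT.
rewrite -linearB; apply: le_trans (enorm_lsubmx _) _.
by rewrite ler_peMl ?enorm_ge0 // le_max lexx.
Qed.

Lemma locally_lipschitz_comp n p q (g : 'rV[R]_p -> 'rV[R]_q) (h : 'rV[R]_n -> 'rV[R]_p) :
  locally_lipschitz g -> locally_lipschitz h -> locally_lipschitz (g \o h).
Proof.
move=> lg lh r; have [K K0 HK] := lh r; have [L L0 HL] := lg K.
exists (L * K + L) => [|z z' zr zr']; first by rewrite addr_ge0 // mulr_ge0.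
have [p1 p2] := HK z z' zr zr'; have [p1' _] := HK z' z zr' zr.
have [h1 h2] := HL (h z) (h z') p1 p1'.
split; first by apply: le_trans h1 _; rewrite lerDr mulr_ge0.
apply: le_trans h2 _; rewrite mulrDl.
apply: (@le_trans _ _ (L * K * enorm (z - z'))); first by rewrite -mulrA ler_wpM2l.
by rewrite lerDl mulr_ge0 // enorm_ge0.
Qed.

Lemma lipschitz_field_row_mx n m p q (U : set 'rV[R]_m)
    (g1 : 'rV[R]_n -> 'rV[R]_m -> 'rV[R]_p) (g2 : 'rV[R]_n -> 'rV[R]_m -> 'rV[R]_q) :
  lipschitz_field U g1 -> lipschitz_field U g2 ->
  lipschitz_field U (fun y u => row_mx (g1 y u) (g2 y u)).
Proof.
move=> l1 l2 r; have [K K0 HK] := l1 r; have [L L0 HL] := l2 r.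
exists (K + L) => [|x x' u xr xr' Uu ur]; first by rewrite addr_ge0.
have [f1 f2] := HK x x' u xr xr' Uu ur; have [h1 h2] := HL x x' u xr xr' Uu ur.
rewrite opp_row_mx add_row_mx mulrDl; split; apply: le_trans (enorm_row_mx _ _) _.
  exact: lerD.
exact: lerD.
Qed.

End LocallyLipschitz.

(** * Continuous paths and inputs *)

Section ContinuousPaths.
Context {R : realType}.

Lemma within_continuousP n (a b : R) (x : R -> 'rV[R]_n) :
  {within `[a, b], continuous x} <->
  forall t, a <= t <= b -> forall e, 0 < e -> exists2 d : R, 0 < d &
    forall s, a <= s <= b -> `|s - t| < d -> `|x s - x t| < e.
Proof.
split.
  move=> /subspace_continuousP cx t tab e e0.
  have /(@cvgrPdist_lt _ _ _ _ (within_filter _ (nbhs_filter t))) /(_ e e0) := cx t tab.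
  case=> d /= d0 H; exists d => // s sab std.
  by rewrite distrC; apply: H => //=; rewrite distrC.
move=> H; apply/subspace_continuousP => t; rewrite /= in_itv /= => tab.
apply/(@cvgrPdist_lt _ _ _ _ (within_filter _ (nbhs_filter t))) => e e0.
have [d d0 Hd] := H t tab e e0.
apply: filterS (nbhsx_ballx t _ d0) => s; rewrite -ball_normE /= => ts.
by rewrite in_itv /= => sab; rewrite distrC; apply: Hd => //; rewrite distrC.
Qed.

Lemma continuous_path_bounded n (a b : R) (x : R -> 'rV[R]_n) :
  {within `[a, b], continuous x} ->
  exists2 K : R, 0 <= K & forall t, a <= t <= b -> `|x t| <= K.
Proof.
move=> cx.
have [M [_ HM]] := compact_bounded (continuous_compact cx (@segment_compact R a b)).
exists (`|M| + 1) => [|t tab]; first by rewrite addr_ge0.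
apply: (HM (`|M| + 1)); first by rewrite (le_lt_trans (ler_norm _)) // ltrDl.
by exists t => //=; rewrite in_itv.
Qed.

(** [s] is the supremum of the times up to which the path stays strictly inside the ball; if it
    starts on the sphere, [s = a]. *)
Lemma first_hitting n (a b r : R) (x : R -> 'rV[R]_n) :
  a <= b -> {within `[a, b], continuous x} -> `|x a| <= r -> r < `|x b| ->
  exists s, [/\ a <= s, s <= b, `|x s| = r & forall t, a <= t <= s -> `|x t| <= r].
Proof.
move=> ab /within_continuousP cx; rewrite le_eqVlt => /orP[/eqP xa _|xa xb].
  exists a; split => // t; rewrite -eq_le => /eqP <-; by rewrite xa.
pose S := [set t | a <= t <= b /\ forall p, a <= p <= t -> `|x p| < r].
have Sa : S a by split; rewrite ?lexx // => p; rewrite -eq_le => /eqP <-.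
have ubS : ubound S b by move=> t [/andP[]].
have hs : has_sup S by split; [exists a | exists b].
have ac : a <= sup S by apply: ub_le_sup => //; exists b.
have cb : sup S <= b by apply: ge_sup => //; exists a.
have cab : a <= sup S <= b by rewrite ac.
have below p : a <= p -> p < sup S -> `|x p| < r.
  move=> ap pS; have e0 : 0 < sup S - p by rewrite subr_gt0.
  have [t [_ Ht]] := sup_adherent e0 hs.
  by rewrite opprB addrCA subrr addr0 => pt; apply: Ht; rewrite ap ltW.
have xs : `|x (sup S)| = r.
  apply/eqP; rewrite eq_le; apply/andP; split; rewrite leNgt; apply/negP => H.
    have e0 : 0 < `|x (sup S)| - r by rewrite subr_gt0.
    have [d d0 Hd] := cx _ cab _ e0.
    have aS : a < sup S.
      rewrite lt_neqAle ac andbT; apply/eqP => aS; move: H; rewrite -aS => H.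
      by have := lt_trans xa H; rewrite ltxx.
    have [p [ap pS dp]] : exists p, [/\ a <= p, p < sup S & `|p - sup S| < d].
      exists (Num.max a (sup S - d / 2)); split.
      - by rewrite le_max lexx.
      - by rewrite gt_max aS /=; lra.
      - have p1 : Num.max a (sup S - d / 2) < sup S by rewrite gt_max aS /=; lra.
        have p2 : sup S - d / 2 <= Num.max a (sup S - d / 2) by rewrite le_max lexx orbT.
        by rewrite ltr0_norm; lra.
    have pab : a <= p <= b by rewrite ap (le_trans (ltW pS)).
    have := Hd p pab dp; have := below p ap pS.
    have := lerB_dist (x (sup S)) (x p); rewrite distrC; lra.
  have e0 : 0 < r - `|x (sup S)| by rewrite subr_gt0.
  have [d d0 Hd] := cx _ cab _ e0.
  have small p : a <= p <= b -> `|p - sup S| < d -> `|x p| < r.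
    move=> pab pd; have := Hd p pab pd; have := lerB_dist (x p) (x (sup S)); lra.
  have Sb : sup S < b.
    rewrite lt_neqAle cb andbT; apply/eqP => Sb.
    by move: H; rewrite Sb => H; have := lt_trans xb H; rewrite ltxx.
  have [p [Sp pb dp]] : exists p, [/\ sup S < p, p <= b & p - sup S < d].
    exists (Num.min b (sup S + d / 2)); split.
    - by rewrite lt_min Sb /=; lra.
    - by rewrite ge_min lexx.
    - have p2 : Num.min b (sup S + d / 2) <= sup S + d / 2 by rewrite ge_min lexx orbT.
      lra.
  have : S p.
    split; first by rewrite pb andbT (le_trans ac) // ltW.
    move=> t /andP[at_ tp]; have [tS|St] := ltP t (sup S); first exact: below.
    by apply: small; [rewrite at_ (le_trans tp) | rewrite ger0_norm ?subr_ge0 //; lra].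
  by move=> /(ub_le_sup (ex_intro _ b ubS)); lra.
exists (sup S); split => // t /andP[at_]; rewrite le_eqVlt => /orP[/eqP ->|tS].
  by rewrite xs.
by apply: ltW; exact: below.
Qed.

(** Compactness of closed balls, phrased so that no subsequence has to be extracted. *)
Lemma bounded_sequence_cluster n (q : nat -> 'rV[R]_n) (r : R) :
  (forall i, `|q i| <= r) ->
  exists2 p, `|p| <= r & forall e, 0 < e -> forall j : nat, exists2 i, (j <= i)%N & `|q i - p| < e.
Proof.
move=> qr.
have FA : (q @ \oo) [set v | `|v| <= r] by exists 0%N => // i _ /=; exact: qr.
have [p [pr cp]] := @closed_ball_rV_compact R n r (q @ \oo) _ FA.
exists p => // e e0 j.
have FB : (q @ \oo) [set v | exists2 i, (j <= i)%N & v = q i].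
  by exists j => // i /= ji; exists i.
have [v [[i ji ->]]] := cp _ _ FB (nbhsx_ballx p _ e0).
by rewrite -ball_normE /= distrC => H; exists i.
Qed.

End ContinuousPaths.

(** * Measurable inputs: shift, concatenation, gluing *)

Section Inputs.
Context {R : realType}.
Variables (m : nat) (U : set 'rV[R]_m).

(** Inputs live on the whole line with values in [U] everywhere, so that shifting, concatenating and
    gluing need no domains. *)
Definition bounded_input (rho : R) (u : R -> 'rV[R]_m) : Prop :=
  [/\ (forall O, open O -> lebesgue_measurable (u @^-1` O)),
      (forall t, U (u t)) &
      {ae @lebesgue_measure R, forall t, enorm (u t) <= rho}].

Lemma bounded_input_shift rho u (s : R) :
  bounded_input rho u -> bounded_input rho (fun t => u (t + s)).
Proof.
case=> mu Uu bu; split => //.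
- by move=> W oW; apply: (lebesgue_measurable_translation s (mu W oW)).
- exact: (ae_translation s bu).
Qed.

Definition concat (T : Type) (s : R) (u v : R -> T) : R -> T :=
  fun t => if t < s then u t else v (t - s).

Lemma bounded_input_concat rho u v (s : R) :
  bounded_input rho u -> bounded_input rho v -> bounded_input rho (concat s u v).
Proof.
move=> [mu Uu bu] /(bounded_input_shift (- s)) [mv Uv bv]; split.
- move=> W oW.
  have -> : concat s u v @^-1` W =
      (`]-oo, s[ `&` u @^-1` W) `|` (`[s, +oo[ `&` (fun t => v (t - s)) @^-1` W).
    apply/seteqP; split => t /=; rewrite /concat !in_itv /= andbT.
      by case: ltP => ts Wt; [left | right].
    by case=> -[]; case: ltP.
  by apply: lebesgue_measurableU; apply: lebesgue_measurableI;
     [exact: lebesgue_measurable_itv | exact: mu | exact: lebesgue_measurable_itv | exact: mv].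
- by move=> t; rewrite /concat; case: ifP.
- by apply: (ae_imply2 _ bu bv) => t; rewrite /concat; case: ifP.
Qed.

(** The times [s i] may be bounded; beyond all of them the value is [u0]. The common bound [rho]
    survives because countably many exceptional sets still form a null set. *)
Lemma bounded_input_glue rho (u : nat -> R -> 'rV[R]_m) (s : nat -> R) (u0 : 'rV[R]_m) :
  U u0 -> enorm u0 <= rho ->
  (forall i, bounded_input rho (u i)) ->
  (forall i j t, (i <= j)%N -> t < s i -> u j t = u i t) ->
  exists2 v, bounded_input rho v & forall i t, t < s i -> v t = u i t.
Proof.
move=> Uu0 u0r bu cons.
have ex t : exists a, (forall i, t < s i -> a = u i t) /\ ((forall i, s i <= t) -> a = u0).
  have [[i ti]|H] := pselect (exists i, t < s i).
    exists (u i t); split => [j tj|/(_ i)]; last by rewrite leNgt ti.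
    by have [ij|/ltnW ji] := leqP i j; [rewrite (cons i j)|rewrite (cons j i)].
  exists u0; split => // i ti; exfalso; apply: H; by exists i.
have [v Hv] := choice ex.
have vE i t : t < s i -> v t = u i t by move=> ti; have [H _] := Hv t; exact: H.
exists v => //; split.
- move=> W oW.
  have -> : v @^-1` W = (\bigcup_i (`]-oo, s i[ `&` u i @^-1` W)) `|`
     ((~` \bigcup_i `]-oo, s i[%classic) `&` [set t | W u0]).
    apply/seteqP; split => t /=.
      move=> Wt; have [[i ti]|H] := pselect (exists i, t < s i).
        by left; exists i => //; split; rewrite /= ?in_itv //= -(vE i t).
      right; split; first by case=> i _ /=; rewrite in_itv /= => ti; apply: H; exists i.
      have [_ Hv2] := Hv t; rewrite -Hv2 // => i; rewrite leNgt; apply/negP => ti.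
      by apply: H; exists i.
    case=> [[i _ [/=]]|[H Wu0]]; first by rewrite in_itv /= => ti; rewrite (vE i).
    have [_ ->] // := Hv t; move=> i; rewrite leNgt; apply/negP => ti; apply: H.
    by exists i => //=; rewrite in_itv.
  apply: lebesgue_measurableU.
    apply: lebesgue_measurable_bigcup => i; apply: lebesgue_measurableI.
      exact: lebesgue_measurable_itv.
    by have [mu _ _] := bu i; exact: mu.
  apply: measurable_lebesgue; apply: measurableI.
    by apply: measurableC; apply: bigcupT_measurable => i; exact: measurable_itv.
  have [Wu0|Wu0] := pselect (W u0).
    by rewrite (_ : [set t | _] = setT) //; apply/seteqP; split.
  by rewrite (_ : [set t | _] = set0) //; apply/seteqP; split.
- move=> t; have [[i ti]|H] := pselect (exists i, t < s i).
    by rewrite (vE i) //; have [_ Uu _] := bu i.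
  have [_ ->] // := Hv t; move=> i; rewrite leNgt; apply/negP => ti; apply: H; by exists i.
- have : {ae @lebesgue_measure R, forall t, forall i, enorm (u i t) <= rho}.
    pose E := \bigcup_i [set t | ~ enorm (u i t) <= rho].
    apply: (@negligibleS _ _ _ lebesgue_measure E).
      by move=> t /= /existsNP[i Hi]; exists i.
    by apply: negligible_bigcup => i; have [_ _] := bu i.
  apply: ae_imply => t H; have [[i ti]|H1] := pselect (exists i, t < s i).
    by rewrite (vE i).
  have [_ ->] // := Hv t; move=> i; rewrite leNgt; apply/negP => ti; apply: H1; by exists i.
Qed.

End Inputs.

(** * Trajectories of control systems *)

Section Flow.
Context {R : realType}.
Variables (N m : nat) (U : set 'rV[R]_m) (g : 'rV[R]_N -> 'rV[R]_m -> 'rV[R]_N).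
Hypothesis g_lip : lipschitz_field U g.

(** The Lipschitz property in the max norm, in which hitting times and cluster points are expressed;
    [L] is made positive to be divided by. *)
Lemma field_bound (r rho : R) : exists2 L : R, 0 < L & forall y y' u,
  `|y| <= r -> `|y'| <= r -> U u -> enorm u <= rho ->
  `|g y u| <= L /\ `|g y u - g y' u| <= L * `|y - y'|.
Proof.
have [L L0 HL] := g_lip (Num.max (N%:R * r) rho).
have N1 : 1 <= N%:R + 1 :> R by rewrite lerDr.
exists ((N%:R + 1) * (L + 1)) => [|y y' u yr yr' Uu ur].
  by rewrite mulr_gt0 // ltr_wpDl.
have b (x : 'rV[R]_N) : `|x| <= r -> enorm x <= Num.max (N%:R * r) rho.
  move=> xr; apply: le_trans (enorm_le_norm x) _.
  by rewrite le_max ler_wpM2l.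
have [|h1 h2] := HL y y' u (b _ yr) (b _ yr') Uu; first by rewrite le_max ur orbT.
split; apply: le_trans (norm_le_enorm _) _.
  apply: le_trans h1 _; apply: (@le_trans _ _ (1 * (L + 1))); first by rewrite mul1r lerDl.
  by rewrite ler_wpM2r // addr_ge0.
apply: le_trans h2 _; rewrite [X in _ <= X * _]mulrC -mulrA.
apply: ler_pM; rewrite ?enorm_ge0 ?lerDl //.
apply: le_trans (enorm_le_norm _) _.
by rewrite ler_wpM2r // lerDl.
Qed.

Definition trajectory (a : R) (T : \bar R) (u : R -> 'rV[R]_m) (y : R -> 'rV[R]_N) : Prop :=
  solves a T y (fun t => g (y t) (u t)).

Lemma solves_sub n (a : R) (T : \bar R) (x y rx ry : R -> 'rV[R]_n) :
  solves a T x rx -> solves a T y ry ->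
  solves a T (fun t => x t - y t) (fun t => rx t - ry t).
Proof.
move=> [acx dx] [acy dy]; split; first by move=> b ab bT; apply: abs_contB; [exact: acx | exact: acy].
apply: (ae_imply2 _ dx dy) => t H1 H2 at_ tT.
by apply: is_deriveB; [exact: H1 | exact: H2].
Qed.

Lemma solves_mean_value_norm n (a : R) (T : \bar R) (x rhs : R -> 'rV[R]_n) s t (K : R) :
  solves a T x rhs -> a <= s -> s <= t -> (t%:E < T)%E -> 0 <= K ->
  {ae @lebesgue_measure R, forall p, s < p -> p < t -> `|rhs p| <= K} ->
  `|x t - x s| <= K * (t - s).
Proof.
move=> [ac de] as_ st tT K0 bd.
have ler0 : 0 <= 1 :> R by [].
apply: (@abs_cont_mean_value R n (fun x => `|x|) 1 ler0 _ _ _ _ s t x rhs) => //.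
- exact: ler_normD.
- by move=> z; rewrite mul1r.
- exact: norm_le_enorm.
- exact: normrZ.
- by apply: abs_contS (ac t (le_trans as_ st) tT).
apply: (ae_imply2 _ de bd) => p H1 H2 sp pt; split; last exact: H2.
apply: H1; first by apply: le_trans as_ _; exact: ltW.
by apply: lt_trans tT; rewrite lte_fin.
Qed.

Variable rho : R.
Let inputs := bounded_input U rho.

(** Leaving the ball of radius [r + 1] takes a displacement of at least 1 at speed at most [L],
    hence time at least 1 / L. *)
Lemma trajectory_stays (a r L : R) (T : \bar R) u y b :
  inputs u -> trajectory a T u y -> (b%:E < T)%E ->
  (forall x u, `|x| <= r + 1 -> U u -> enorm u <= rho -> `|g x u| <= L) -> 0 < L ->
  `|y a| <= r -> L * (b - a) < 1 ->
  forall t, a <= t <= b -> `|y t| <= r + 1.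
Proof.
move=> [_ Uu bu] ty bT HL L0 yar Lb t /andP[at_ tb].
have tT : (t%:E < T)%E by apply: le_lt_trans bT; rewrite lee_fin.
rewrite leNgt; apply/negP => ytr.
have yar1 : `|y a| <= r + 1 by lra.
have [s [as_ st ysr below]] := first_hitting at_ (solves_continuous ty tT) yar1 ytr.
have : `|y s - y a| <= L * (s - a).
  apply: (solves_mean_value_norm ty) => //; last 2 first.
  - exact: ltW.
  - apply: ae_imply bu => p up ap ps; apply: HL => //.
    by apply: below; rewrite !ltW.
  by apply: le_lt_trans tT; rewrite lee_fin.
have := lerB_dist (y s) (y a); rewrite ysr.
have : L * (s - a) <= L * (b - a) by rewrite ler_wpM2l ?(ltW L0) // lerD2r (le_trans st).
lra.
Qed.

(** A short-time substitute for Gronwall: the largest difference [D] satisfies [D <= |d a| + D / 4],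
    so that increments are at most [|d a| / 3]. *)
Lemma trajectory_short (a b r L : R) (T : \bar R) u y y' :
  a <= b -> inputs u -> trajectory a T u y -> trajectory a T u y' -> (b%:E < T)%E ->
  (forall x x' u, `|x| <= r -> `|x'| <= r -> U u -> enorm u <= rho ->
     `|g x u - g x' u| <= L * `|x - x'|) -> 0 < L ->
  (forall t, a <= t <= b -> `|y t| <= r /\ `|y' t| <= r) ->
  L * (b - a) <= 1 / 4 ->
  forall t, a <= t <= b ->
    `|(y t - y' t) - (y a - y' a)| <= 1 / 2 * `|y a - y' a|.
Proof.
move=> ab [_ Uu bu] ty ty' bT HL L0 bd Lb.
pose d t := y t - y' t; pose S := [set `|d t| | t in `[a, b]].
have daa : S `|d a| by exists a => //=; rewrite in_itv /= lexx.
have hs : has_sup S.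
  split; first by exists `|d a|.
  exists (r + r) => z [t /=]; rewrite in_itv /= => /bd[h1 h2] <-.
  by apply: le_trans (ler_normB _ _) _; exact: lerD.
pose D := sup S.
have dD t : a <= t <= b -> `|d t| <= D.
  by move=> tab; apply: ub_le_sup; [case: hs | exists t => //=; rewrite in_itv].
have D0 : 0 <= D by apply: le_trans (dD a _); rewrite ?lexx.
have inc t : a <= t <= b -> `|d t - d a| <= 1 / 4 * D.
  move=> /andP[at_ tb].
  apply: (@le_trans _ _ (L * D * (t - a))).
    apply: (solves_mean_value_norm (solves_sub ty ty')) => //.
    - by apply: le_lt_trans bT; rewrite lee_fin.
    - by rewrite mulr_ge0 // ltW.
    apply: ae_imply bu => p up ap pt.
    have pab : a <= p <= b by rewrite ltW //= (le_trans (ltW pt)).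
    have [b1 b2] := bd p pab; apply: le_trans (HL _ _ _ b1 b2 (Uu p) up) _.
    by rewrite ler_wpM2l ?(ltW L0) //; exact: dD.
  rewrite mulrAC ler_wpM2r // (le_trans _ Lb) // ler_wpM2l ?(ltW L0) //; lra.
have Dle : D <= `|d a| + 1 / 4 * D.
  apply: ge_sup; first by case: hs.
  move=> z [t /=]; rewrite in_itv /= => tab <-.
  have := inc t tab; have := lerB_dist (d t) (d a); lra.
move=> t /inc; rewrite -/(d t) -/(d a).
have := normr_ge0 (d a); lra.
Qed.

Lemma trajectory_unique (a : R) (T : \bar R) u y y' :
  inputs u -> trajectory a T u y -> trajectory a T u y' -> y a = y' a ->
  forall t, a <= t -> (t%:E < T)%E -> y t = y' t.
Proof.
move=> iu ty ty' yy b ab bT.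
have [K1 K10 HK1] := continuous_path_bounded (solves_continuous ty bT).
have [K2 K20 HK2] := continuous_path_bounded (solves_continuous ty' bT).
have [L L0 HL] := field_bound (Num.max K1 K2) rho.
(* The two sides of [c] together have length at most 1 / (4 L), as [trajectory_short] requires. *)
have L8 : 0 < 1 / (8 * L) by rewrite divr_gt0 // mulr_gt0.
apply: (@real_induction R a b (fun t => y t = y' t)) => //.
move=> c cab; exists (1 / (8 * L)) => // s t as_ cs sc ct td tb ys.
have st : s <= t by lra.
have tT : (t%:E < T)%E by apply: le_lt_trans bT; rewrite lee_fin.
have := @trajectory_short s t (Num.max K1 K2) L T u y y' st iu (solvesW as_ (lexx _) ty)
  (solvesW as_ (lexx _) ty') tT.
move=> H.
have : `|(y t - y' t) - (y s - y' s)| <= 1 / 2 * `|y s - y' s|.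
  apply: H => //.
  - by move=> x x' v xr xr' Uv vr; have [] := HL x x' v xr xr' Uv vr.
  - move=> p /andP[sp pt]; have pab : a <= p <= b by apply/andP; split; lra.
    by split; rewrite le_max ?HK1 // HK2 // orbT.
  - have e : L * (1 / (8 * L) + 1 / (8 * L)) = 1 / 4 by field; rewrite gt_eqF.
    by clear ys; rewrite -e ler_wpM2l ?(ltW L0) //; lra.
  - by rewrite lexx st.
by rewrite ys subrr normr0 mulr0 subr0 normr_le0 subr_eq0 => /eqP.
Qed.

End Flow.

(** * Bounded reachability *)

Section Archimedean.
Context {R : realType}.

Lemma exists_nat_gt (x : R) : exists j : nat, forall i, (j <= i)%N -> x < i%:R.
Proof.
exists (Num.trunc `|x|).+1 => i ji; apply: le_lt_trans (ler_norm x) _.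
apply: (@lt_le_trans _ _ (Num.trunc `|x|).+1%:R); first exact: truncnS_gt.
by rewrite ler_nat.
Qed.

Lemma exists_invS_lt (e : R) : 0 < e ->
  exists j : nat, forall i, (j <= i)%N -> i.+1%:R^-1 < e.
Proof.
move=> e0; have [j Hj] := exists_nat_gt e^-1; exists j => i /Hj ie.
by rewrite -[e]invrK ltf_pV2 ?posrE ?invr_gt0 // (lt_trans ie) // ltr_nat.
Qed.

Lemma continuous_path_endpoint n (a b : R) (x y : R -> 'rV[R]_n) :
  a < b -> {within `[a, b], continuous x} -> {within `[a, b], continuous y} ->
  (forall t, a <= t -> t < b -> x t = y t) -> x b = y b.
Proof.
move=> ab /within_continuousP cx /within_continuousP cy xy.
have bab : a <= b <= b by rewrite lexx ltW.
apply/eqP; rewrite -subr_eq0 -normr_eq0; apply/eqP; apply: contrapT => /eqP H.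
have e0 : 0 < `|x b - y b| / 2 by rewrite divr_gt0 // lt_neqAle eq_sym H normr_ge0.
have [d1 d10 H1] := cx b bab _ e0; have [d2 d20 H2] := cy b bab _ e0.
have m1 : Num.min d1 d2 <= d1 by rewrite ge_min lexx.
have m2 : Num.min d1 d2 <= d2 by rewrite ge_min lexx orbT.
have m0 : 0 < Num.min d1 d2 by rewrite lt_min d10.
pose p := Num.max a (b - Num.min d1 d2 / 2).
have p1 : a <= p by rewrite /p le_max lexx.
have p2 : p < b by rewrite /p gt_max ab /=; lra.
have p3 : b - Num.min d1 d2 / 2 <= p by rewrite /p le_max lexx orbT.
have pab : a <= p <= b by rewrite p1 ltW.
have {}H1 : `|x p - x b| < `|x b - y b| / 2 by apply: H1 => //; rewrite ltr0_norm; lra.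
have {}H2 : `|y p - y b| < `|x b - y b| / 2 by apply: H2 => //; rewrite ltr0_norm; lra.
have : `|x b - y b| <= `|x p - x b| + `|y p - y b|.
  have -> : x b - y b = - (x p - x b) + (y p - y b).
    by rewrite (xy p p1 p2) opprB subrKA.
  by apply: le_trans (ler_normD _ _) _; rewrite normrN.
move: e0 H1 H2; clear; lra.
Qed.

End Archimedean.

Section Reach.
Context {R : realType}.
Variables (N m : nat) (U : set 'rV[R]_m) (g : 'rV[R]_N -> 'rV[R]_m -> 'rV[R]_N).
Hypothesis g_lip : lipschitz_field U g.
Variable rho : R.
Local Notation inputs := (bounded_input U rho).
Hypothesis complete : forall u y0, inputs u ->
  exists y, y 0 = y0 /\ trajectory g 0 +oo%E u y.
Variable u0 : 'rV[R]_m.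
Hypotheses (Uu0 : U u0) (u0_rho : enorm u0 <= rho).

(** Chosen through forward completeness; for [t >= 0] the choice is immaterial by uniqueness. *)
Definition flow (u : R -> 'rV[R]_m) (y0 : 'rV[R]_N) : R -> 'rV[R]_N :=
  xget (cst y0) [set y | y 0 = y0 /\ trajectory g 0 +oo%E u y].

Lemma flowP u y0 : inputs u -> flow u y0 0 = y0 /\ trajectory g 0 +oo%E u (flow u y0).
Proof.
move=> iu.
exact: (@xgetPex _ (cst y0) [set y | y 0 = y0 /\ trajectory g 0 +oo%E u y] (complete y0 iu)).
Qed.

Lemma flow_unique u y0 (b : R) y : inputs u -> trajectory g 0 b%:E u y -> y 0 = y0 ->
  forall t, 0 <= t -> t < b -> y t = flow u y0 t.
Proof.
move=> iu ty yy0 t t0 tb; have [f0 tf] := flowP y0 iu.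
apply: (trajectory_unique g_lip iu ty (solvesW (lexx _) (leey _) tf)) => //.
by rewrite f0.
Qed.

Lemma flow_continuous u y0 (a b : R) : inputs u -> 0 <= a ->
  {within `[a, b], continuous (flow u y0)}.
Proof.
move=> iu a0; have [_ tf] := flowP y0 iu.
by apply: solves_continuous (solvesW a0 (lexx _) tf) _; exact: ltry.
Qed.

Lemma flow_shift u y0 (s t : R) : inputs u -> 0 <= s -> 0 <= t ->
  flow u y0 (t + s) = flow (fun p => u (p + s)) (flow u y0 s) t.
Proof.
move=> iu s0 t0; have [_ tf] := flowP y0 iu.
apply: (@flow_unique _ _ (t + 1) (fun t => flow u y0 (t + s))) => //.
- exact: bounded_input_shift.
- apply: (solves_shift (rhs := fun t => g (flow u y0 t) (u t))).
  by apply: solvesW tf; rewrite ?leey // add0r.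
- by rewrite add0r.
- by rewrite ltrDl.
Qed.

(** Before [s] this is uniqueness of trajectories; time [s] itself is reached by continuity. *)
Lemma flow_causal u v y0 (s t : R) : inputs u -> inputs v ->
  (forall p, 0 < p -> p < s -> u p = v p) -> 0 <= t <= s -> flow u y0 t = flow v y0 t.
Proof.
move=> iu iv uv /andP[t0]; have [f0 tf] := flowP y0 iu; have [f0' tf'] := flowP y0 iv.
have before p : 0 <= p -> p < s -> flow u y0 p = flow v y0 p.
  apply: flow_unique => //; apply: eq_solves (solvesW (lexx _) (leey _) tf) => // q q0 qs.
  by rewrite uv.
rewrite le_eqVlt => /orP[/eqP ts|]; last exact: before.
move: t0; rewrite le_eqVlt => /orP[/eqP <-|t0]; first by rewrite f0 f0'.
apply: (continuous_path_endpoint t0); try exact: flow_continuous.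
by move=> p p0 pt; apply: before; rewrite -?ts.
Qed.

(* The flow map over a short time is the identity plus a contraction, hence open:
   no solution backwards in time is needed. *)
Lemma flow_short (r : R) : exists2 d : R, 0 < d & forall u y y' t,
  inputs u -> `|y| <= r -> `|y'| <= r -> 0 <= t <= d ->
  `|(flow u y t - flow u y' t) - (y - y')| <= 1 / 2 * `|y - y'|.
Proof.
have [L L0 HL] := field_bound g_lip (r + 1) rho.
exists (1 / (4 * L)) => [|u y y' t iu yr yr' td]; first by rewrite divr_gt0 // mulr_gt0.
have e : L * (1 / (4 * L) - 0) = 1 / 4 by field; rewrite gt_eqF.
have d0 : 0 <= 1 / (4 * L) by rewrite divr_ge0 // mulr_ge0 // ltW.
have [f0 tf] := flowP y iu; have [f0' tf'] := flowP y' iu.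
have stays z : `|z| <= r -> forall p, 0 <= p <= 1 / (4 * L) -> `|flow u z p| <= r + 1.
  move=> zr; have [z0 tz] := flowP z iu.
  apply: (trajectory_stays iu tz (ltry _) _ L0).
  - by move=> x v xr Uv vr; have [] := HL x x v xr xr Uv vr.
  - by rewrite z0.
  - rewrite e; lra.
have := @trajectory_short R N m U g rho 0 (1 / (4 * L)) (r + 1) L +oo%E u _ _ d0 iu tf tf' (ltry _) _ L0 _ _ t td.
rewrite f0 f0'; apply.
- by move=> x x' v xr xr' Uv vr; have [] := HL x x' v xr xr' Uv vr.
- by move=> p pd; split; apply: stays.
- by rewrite e.
Qed.

(** Fixed point iteration: adding the residual [p - flow u (a i) t] to [a i] at least halves the
    residual, since the flow differs from the identity by a 1/2-contraction. A cluster point of the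
    iterates replaces the limit. *)
Lemma flow_short_open (r : R) : exists2 d : R, 0 < d & forall u y p t,
  inputs u -> `|y| <= r -> 0 <= t <= d -> 2 * `|p - flow u y t| <= 1 ->
  exists2 y', `|y' - y| <= 2 * `|p - flow u y t| & flow u y' t = p.
Proof.
have [d d0 short] := flow_short (r + 1).
exists d => // u y p t iu yr td small.
pose e0 := `|p - flow u y t|.
pose a := fix a i := if i is i'.+1 then a i' + (p - flow u (a i') t) else y.
pose e i := `|p - flow u (a i) t|.
have in_ball z : `|z - y| <= 2 * e0 -> `|z| <= r + 1.
  move=> zy; rewrite -(subrK y z); apply: le_trans (ler_normD _ _) _.
  by rewrite addrC lerD // (le_trans zy).
have step i : `|a i - y| <= 2 * e0 -> `|a i.+1 - y| <= 2 * e0 -> e i.+1 <= 1 / 2 * e i.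
  move=> /in_ball ai /in_ball ai'; have := short u _ _ t iu ai' ai td.
  have -> : a i.+1 - a i = p - flow u (a i) t by rewrite /= addrC addKr.
  rewrite /e => H.
  have -> : p - flow u (a i.+1) t = - ((flow u (a i.+1) t - flow u (a i) t) - (p - flow u (a i) t)).
    by rewrite !opprB subrKA.
  by rewrite normrN.
(* Twice the current residual is a budget for the remaining displacement: a step spends [e i] and
   leaves [e i >= 2 * e i.+1]. The bound [e0 / i.+1] is weaker than halving and suffices for the
   limit. *)
have inv i : `|a i - y| <= 2 * e0 - 2 * e i /\ e i <= e0 / i.+1%:R.
  elim: i => [|i [IH1 IH2]]; first by rewrite subrr normr0 subrr lexx divr1.
  have ei : 0 <= e i := normr_ge0 _.
  have b1 : `|a i - y| <= 2 * e0 by lra.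
  have b2 : `|a i.+1 - y| <= 2 * e0 - e i.
    have -> : a i.+1 - y = (a i - y) + (p - flow u (a i) t) by rewrite /= addrAC.
    apply: le_trans (ler_normD _ _) _; rewrite -/(e i); lra.
  have b3 : e i.+1 <= 1 / 2 * e i by apply: step => //; lra.
  split; first lra.
  apply: le_trans b3 _; apply: (@le_trans _ _ (1 / 2 * (e0 / i.+1%:R))); first by rewrite ler_wpM2l.
  have i0 : 0 < i.+1%:R :> R by [].
  rewrite mulrCA ler_wpM2l // ?normr_ge0 //.
  rewrite mul1r -invfM lef_pV2 ?posrE ?mulr_gt0 //.
  by rewrite -natrM ler_nat mul2n -addnn addSn addnS !ltnS leq_addr.
have inb i : `|a i - y| <= 2 * e0.
  by have [h _] := inv i; apply: le_trans h _; rewrite lerBlDr lerDl mulr_ge0 // normr_ge0.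
have [q qr cq] := bounded_sequence_cluster (fun i => in_ball _ (inb i)).
have qy : `|q - y| <= 2 * e0.
  apply/ler_addgt0Pr => e1 e10; have [i _ Hi] := cq _ e10 0%N.
  have -> : q - y = (a i - y) - (a i - q) by rewrite opprB [RHS]addrC subrKA.
  apply: le_trans (ler_normB _ _) _; apply: lerD; [exact: inb | exact: ltW].
exists q => //; apply/eqP; rewrite eq_sym -subr_eq0 -normr_le0.
apply/ler_addgt0Pr => e1 e10; rewrite add0r.
have e3 : 0 < e1 / (2 * (e0 + 1)) by rewrite divr_gt0 // mulr_gt0 // ltr_wpDl ?normr_ge0.
have e4 : 0 < e1 / 4 by rewrite divr_gt0.
have [j Hj] := exists_invS_lt e3.
have [i ji Hi] := cq _ e4 j.
(* The residual at [a i] tends to 0, and the other two terms are controlled by the distance from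
   [a i] to [q]. *)
have -> : p - flow u q t = (p - flow u (a i) t) + ((flow u (a i) t - flow u q t) - (a i - q)) + (a i - q).
  by rewrite -addrA subrK subrKA.
have h1 := short u _ _ t iu (in_ball _ (inb i)) qr td.
have [_ h2'] := inv i; have h2 : `|p - flow u (a i) t| <= e0 / i.+1%:R := h2'.
have h3 : e0 / i.+1%:R <= e1 / 2.
  apply: (@le_trans _ _ ((e0 + 1) * (e1 / (2 * (e0 + 1))))).
    by apply: ler_pM; rewrite ?normr_ge0 ?invr_ge0 ?lerDl //; apply: ltW; exact: Hj.
  rewrite le_eqVlt; apply/orP; left; apply/eqP; field.
  by rewrite gt_eqF // ltr_wpDl ?normr_ge0.
apply: le_trans (ler_normD _ _) _; apply: le_trans (lerD (ler_normD _ _) (lexx _)) _.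
have Hi' := ltW Hi.
apply: le_trans (lerD (lerD (le_trans h2 h3) (le_trans h1 _)) Hi') _.
  exact: (ler_wpM2l _ Hi').
lra.
Qed.

Lemma flow_last_step u y (d s : R) : inputs u -> 0 <= d -> d <= s ->
  flow u y s = flow (fun p => u (p + (s - d))) (flow u y (s - d)) d.
Proof.
move=> iu d0 ds; rewrite -flow_shift ?subr_ge0 //.
by rewrite addrC subrK.
Qed.

(** The factor 3/2 of a short step is rounded up to 2. Only the reference trajectory is assumed
    bounded; the smallness condition keeps the other one close to it. *)
Lemma flow_lipschitz (r : R) : exists2 d : R, 0 < d & forall (k : nat) u y y' s,
  inputs u -> 0 <= s <= k%:R * d -> (forall t, 0 <= t <= s -> `|flow u y t| <= r) ->
  2 ^+ k * `|y' - y| <= 1 ->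
  `|flow u y' s - flow u y s| <= 2 ^+ k * `|y' - y|.
Proof.
have [d d0 short] := flow_short (r + 1).
exists d => //; elim=> [|k IH] u y y' s iu /andP[s0 sk] bd.
  have -> : s = 0 by apply/eqP; rewrite eq_le s0 andbT; move: sk; rewrite mul0r.
  by have [-> _] := flowP y iu; have [-> _] := flowP y' iu; rewrite expr0 mul1r.
rewrite exprS -mulrA => small.
have y0 := normr_ge0 (y' - y).
have p1 : 1 <= 2 ^+ k :> R by apply: exprn_ege1; rewrite ler1n.
have twice : `|y' - y| <= 2 ^+ k * `|y' - y| by rewrite ler_peMl.
have one (v : R -> 'rV[R]_m) z z' t : inputs v -> `|z| <= r -> `|z' - z| <= 1 -> 0 <= t <= d ->
    `|flow v z' t - flow v z t| <= 2 * `|z' - z|.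
  move=> iv zr zz td.
  have zr1 : `|z| <= r + 1 by rewrite (le_trans zr) // lerDl.
  have zr' : `|z'| <= r + 1.
    by rewrite -(subrK z z'); apply: le_trans (ler_normD _ _) _; rewrite addrC lerD.
  have H := short v z' z t iv zr' zr1 td.
  rewrite -(subrK (z' - z) (flow v z' t - flow v z t)).
  apply: le_trans (ler_normD _ _) _; apply: le_trans (lerD H (lexx _)) _.
  have := normr_ge0 (z' - z); lra.
have yr : `|y| <= r by have [e _] := flowP y iu; rewrite -e; apply: bd; rewrite lexx.
have [sd|ds] := leP s d.
  apply: le_trans (one u y y' s iu yr _ _) _; [lra | by rewrite s0 | lra].
have sd0 : 0 <= s - d by lra.
have ds' : d <= s by exact: ltW.
have {}IH : `|flow u y' (s - d) - flow u y (s - d)| <= 2 ^+ k * `|y' - y|.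
  apply: IH => //; last lra.
    by rewrite sd0 /=; move: sk; rewrite -natr1 mulrDl mul1r => sk; lra.
  by move=> t /andP[t0 ts]; apply: bd; rewrite t0 /=; lra.
rewrite !(flow_last_step _ iu (ltW d0) ds').
apply: le_trans (one _ _ _ d (bounded_input_shift _ iu) _ _ _) _.
- apply: bd; rewrite sd0 /=; lra.
- lra.
- by rewrite lexx ltW.
- lra.
Qed.

(** The target is pulled back through the last short step to a target at time [s - d], to which the
    induction applies; each step at most doubles the displacement. *)
Lemma flow_open (r : R) : exists2 d : R, 0 < d & forall (k : nat) u y p s,
  inputs u -> 0 <= s <= k%:R * d -> (forall t, 0 <= t <= s -> `|flow u y t| <= r) ->
  2 ^+ k * `|p - flow u y s| <= 1 ->
  exists2 y', `|y' - y| <= 2 ^+ k * `|p - flow u y s| & flow u y' s = p.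
Proof.
have [d d0 short] := flow_short_open r.
exists d => //; elim=> [|k IH] u y p s iu /andP[s0 sk] bd.
  have -> : s = 0 by apply/eqP; rewrite eq_le s0 andbT; move: sk; rewrite mul0r.
  move=> _; exists p; last by have [-> _] := flowP p iu.
  by have [-> _] := flowP y iu; rewrite expr0 mul1r.
rewrite exprS -mulrA => small.
have p1 : 1 <= 2 ^+ k :> R by apply: exprn_ege1; rewrite ler1n.
have twice : `|p - flow u y s| <= 2 ^+ k * `|p - flow u y s| by rewrite ler_peMl.
have [sd|ds] := leP s d.
  have yr : `|y| <= r by have [e _] := flowP y iu; rewrite -e; apply: bd; rewrite lexx.
  have [||y' y1 y2] := short u y p s iu yr; [by rewrite s0 | lra |].
  exists y' => //; lra.
have sd0 : 0 <= s - d by lra.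
have ds' : d <= s by exact: ltW.
move: small twice; rewrite (flow_last_step _ iu (ltW d0) ds') => small twice.
have [|||q q1 q2] := short _ (flow u y (s - d)) p d (bounded_input_shift (s - d) iu).
- apply: bd; rewrite sd0 /=; lra.
- by rewrite lexx ltW.
- lra.
have q3 : 2 ^+ k * `|q - flow u y (s - d)| <=
    2 * (2 ^+ k * `|p - flow (fun t => u (t + (s - d))) (flow u y (s - d)) d|).
  by rewrite mulrCA ler_wpM2l // exprn_ge0.
have [|||y' y1 y2] := IH u y q (s - d) iu.
- by rewrite sd0 /=; move: sk; rewrite -natr1 mulrDl mul1r => sk; lra.
- by move=> t /andP[t0 ts]; apply: bd; rewrite t0 /=; lra.
- lra.
exists y'; first lra.
by rewrite (flow_last_step _ iu (ltW d0) ds') y2.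
Qed.

(** Nearby initial points are allowed, which makes the property pass to cluster points of points
    from which ever larger norms are reached. *)
Definition unbounded_reach (y : 'rV[R]_N) (T : R) : Prop :=
  forall e K : R, 0 < e -> exists y' u t,
    [/\ inputs u, `|y' - y| < e, 0 <= t <= T & K < `|flow u y' t|].

Lemma unbounded_reachW y T T' : T <= T' -> unbounded_reach y T -> unbounded_reach y T'.
Proof.
move=> TT H e K e0; have [y' [u [t [iu yy /andP[t0 tT] Kt]]]] := H e K e0.
by exists y', u, t; split => //; rewrite t0 (le_trans tT).
Qed.

(** Escaping trajectories are cut at the sphere of radius [r]. Their hitting points accumulate at a
    point that still has unbounded reach, and openness of the flow redirects one trajectory exactly
    to it. [eta] pays for replacing hitting times by their cluster point. *)
Lemma unbounded_reach_step y (T r e eta : R) :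
  unbounded_reach y T -> `|y| < r -> 0 < e -> 0 < eta ->
  exists y' u s, [/\ inputs u, `|y' - y| < e, 0 <= s <= T, r <= `|flow u y' s| &
    unbounded_reach (flow u y' s) (T - s + eta)].
Proof.
move=> bad yr e0 eta0.
(* Cutting at the first hitting time keeps the trajectories in a ball, as [flow_open] requires, and
   leaves a continuation that still exceeds [j]. *)
have /choice [w Hw] : forall j : nat, exists w : 'rV[R]_N * (R -> 'rV[R]_m) * R,
  [/\ inputs w.1.2, `|w.1.1 - y| < j.+1%:R^-1, 0 <= w.2 <= T,
      `|flow w.1.2 w.1.1 w.2| = r /\ (forall t, 0 <= t <= w.2 -> `|flow w.1.2 w.1.1 t| <= r) &
      exists2 t, 0 <= t <= T - w.2 &
        j%:R < `|flow (fun p => w.1.2 (p + w.2)) (flow w.1.2 w.1.1 w.2) t|].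
  move=> j.
  have e1 : 0 < Num.min j.+1%:R^-1 (r - `|y|) by rewrite lt_min invr_gt0 ltr0Sn subr_gt0.
  have [y' [u [t [iu yy /andP[t0 tT] Kt]]]] := bad _ (Num.max r j%:R) e1.
  move: yy; rewrite lt_min => /andP[yy1 yy2].
  move: Kt; rewrite gt_max => /andP[Kt1 Kt2].
  have [f0 _] := flowP y' iu.
  have yr' : `|flow u y' 0| <= r.
    by rewrite f0; have := lerB_dist y' y; lra.
  have [s [s0 st sr below]] := first_hitting t0 (flow_continuous iu (lexx 0)) yr' Kt1.
  exists (y', u, s) => /=; split => //; first by rewrite s0 (le_trans st).
  exists (t - s); first by rewrite subr_ge0 st lerD2r.
  by rewrite -flow_shift ?subr_ge0 // subrK.
pose p j := flow (w j).1.2 (w j).1.1 (w j).2.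
have T0 : 0 <= T by have [_ _ /andP[a1 a2] _ _] := Hw 0%N; exact: le_trans a1 a2.
(* The hitting time is appended as one more coordinate, so that a single cluster point serves points
   and times. *)
have [q qb cq] : exists2 q : 'rV[R]_(N + 1), True & forall e, 0 < e -> forall j : nat,
    exists2 i, (j <= i)%N & `|row_mx (p i) (const_mx (w i).2) - q| < e.
  have [i|q _ H] := @bounded_sequence_cluster R (N + 1) (fun i => row_mx (p i) (const_mx (w i).2)) (Num.max r T).
    apply: le_trans (norm_row_mx _ _) _.
    have [_ _ /andP[s0 sT] [-> _] _] := Hw i.
    rewrite ge_max le_max lexx /= le_max; apply/orP; right.
    by apply: rV_norm_le => // k; rewrite mxE ger0_norm.
  by exists q.
pose pq := lsubmx q; pose sq := rsubmx q ord0 ord0.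
have split_dist i e1 : `|row_mx (p i) (const_mx (w i).2) - q| < e1 ->
    `|p i - pq| < e1 /\ `|(w i).2 - sq| < e1.
  move=> H.
  have -> : p i - pq = lsubmx (row_mx (p i) (const_mx (w i).2) - q).
    by rewrite linearB /= row_mxKl.
  have -> : (w i).2 - sq = (rsubmx (row_mx (p i) (const_mx (w i).2) - q)) ord0 ord0.
    by rewrite linearB /= row_mxKr /sq !mxE.
  split; apply: le_lt_trans H.
    by apply: rV_norm_le => // k; rewrite mxE norm_coord.
  by rewrite mxE norm_coord.
(* The points [p i] accumulate at [pq] and reach beyond [i] in the remaining time; [eta / 2] covers
   the distance from [sq] to the hitting time. *)
have badq : unbounded_reach pq (T - sq + eta / 2).
  move=> e1 K e10.
  have [j Hj] := exists_nat_gt K.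
  have e2 : 0 < Num.min e1 (eta / 2) by rewrite lt_min e10 divr_gt0.
  have [i ji /split_dist[]] := cq _ e2 j.
  rewrite !lt_min => /andP[d1 _] /andP[_ d2].
  have [iw _ _ _ [t tT Kt]] := Hw i.
  exists (p i), (fun t => (w i).1.2 (t + (w i).2)), t; split => //.
  - exact: bounded_input_shift.
  - move: tT => /andP[-> tT] /=; move: d2; rewrite ltr_norml => /andP[d2 d3]; lra.
  - by apply: lt_trans Kt; exact: Hj.
have [d d0 opn] := flow_open r.
have [k Hk] := exists_nat_gt (T / d).
have kd : T <= k%:R * d by have := Hk k (leqnn k); rewrite ltr_pdivrMr // => /ltW.
have k0 : 0 < 2 ^+ k :> R by rewrite exprn_gt0.
(* [2 ^+ k] is the loss in [flow_open]: moving the hitting point to [pq] moves the initial point by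
   less than [e / 2], and the other [e / 2] covers its distance to [y]. *)
have e3 : 0 < Num.min (Num.min 1 (e / 2) / 2 ^+ k) (eta / 2).
  by rewrite !lt_min !divr_gt0 // lt_min ltr01 divr_gt0.
have e2 : 0 < e / 2 by rewrite divr_gt0.
have [j Hj] := exists_invS_lt e2.
have [i ji /split_dist[]] := cq _ e3 j.
rewrite !lt_min => /andP[d1 _] /andP[_ d2].
have [iw yw /andP[s0 sT] [pr bd] _] := Hw i.
move: d1; rewrite ltr_pdivlMr // mulrC lt_min distrC => /andP[d11 d12].
have [|//||y' y1 y2] := opn k (w i).1.2 (w i).1.1 pq (w i).2 iw.
- by rewrite s0 (le_trans sT).
- exact: ltW.
have pqr : `|pq| = r.
  apply/eqP; rewrite -subr_eq0 -normr_le0; apply/ler_addgt0Pr => e1 e10; rewrite add0r.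
  have [i' _ /split_dist[dd _]] := cq _ e10 0%N.
  have [_ _ _ [<- _] _] := Hw i'.
  by apply: le_trans (ler_dist_dist _ _) _; rewrite distrC ltW.
exists y', (w i).1.2, (w i).2; split => //.
- have -> : y' - y = (y' - (w i).1.1) + ((w i).1.1 - y) by rewrite subrKA.
  apply: le_lt_trans (ler_normD _ _) _.
  have h1 := Hj i ji; rewrite (splitr e); apply: ltrD; first exact: le_lt_trans d12.
  exact: lt_trans h1.
- by rewrite s0.
- by rewrite y2 pqr.
- rewrite y2; apply: unbounded_reachW badq.
  move: d2; rewrite ltr_norml => /andP[d2 d3]; lra.
Qed.

(* The limit of the centers of a sequence of stages lies in all their balls, so that
   its trajectory under the concatenated input stays within distance 1 of the prescribed
   far away points. *)
Record stage := Stage {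
  center : 'rV[R]_N; input : R -> 'rV[R]_m; time : R; further : R; radius : R }.

(** [further] is a time within which points near the current end point still go arbitrarily far; the
    strict inequality leaves slack for the stages to come. *)
Definition valid_stage (Tmax : R) (w : stage) : Prop :=
  [/\ inputs (input w), 0 <= time w /\ time w + further w < Tmax, 0 < radius w,
      unbounded_reach (flow (input w) (center w) (time w)) (further w) &
      forall c, `|c - center w| <= radius w ->
        `|flow (input w) c (time w) - flow (input w) (center w) (time w)| <= 1].

Definition next_stage (K : R) (w w' : stage) : Prop :=
  [/\ `|center w' - center w| + radius w' <= radius w, time w <= time w',
      forall t, t < time w -> input w' t = input w t &
      K <= `|flow (input w') (center w') (time w')|].

Lemma next_stage_exists (Tmax K : R) (w : stage) :
  valid_stage Tmax w -> exists2 w', valid_stage Tmax w' & next_stage K w w'.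
Proof.
case: w => c u s T' e [/= iu [s0 sT] e0 bad _].
have [r0 _ Hr0] := continuous_path_bounded (flow_continuous iu (lexx 0) (b := s) (y0 := c)).
have [d d0 opn] := flow_open r0.
have [k Hk] := exists_nat_gt (s / d).
have kd : s <= k%:R * d by have := Hk k (leqnn k); rewrite ltr_pdivrMr // => /ltW.
have k0 : 0 < 2 ^+ k :> R by rewrite exprn_gt0.
have e3 : 0 < Num.min 1 (e / 2) / 2 ^+ k by rewrite divr_gt0 // lt_min ltr01 divr_gt0.
(* Half of the slack below [Tmax] is spent here, the other half is kept. *)
pose eta := (Tmax - (s + T')) / 2.
have eta0 : 0 < eta by rewrite divr_gt0 // subr_gt0.
(* The target radius has to exceed the norm of the current end point, also when [K] does not. *)
have pr : `|flow u c s| < Num.max K (`|flow u c s| + 1) by rewrite lt_max ltrDl ltr01 orbT.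
have [y' [v [s1 [iv yy /andP[s10 s1T] rK bad1]]]] :=
  unbounded_reach_step bad pr e3 eta0.
move: yy; rewrite ltr_pdivlMr // mulrC lt_min => /andP[yy1 yy2].
(* The continuation starts at [y'] instead of the current end point; openness moves the center to
   [c'], from which the earlier input leads exactly to [y']. *)
have [|//||c' c1 c2] := opn k u c y' s iu.
- by rewrite s0.
- exact: ltW.
have iw : inputs (concat s u v) by exact: bounded_input_concat.
have pw : flow (concat s u v) c' (s + s1) = flow v y' s1.
  rewrite addrC flow_shift //.
  have -> : flow (concat s u v) c' s = y'.
    rewrite -c2; apply: (@flow_causal _ _ c' s s iw iu) => [p p0 ps|]; last by rewrite s0 lexx.
    by rewrite /concat ps.
  apply: (@flow_causal _ _ y' s1 s1 (bounded_input_shift s iw) iv) => [p p0 ps|]; last first.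
    by rewrite s10 lexx.
  rewrite /concat addrK; case: ltP => // h1; exfalso; lra.
have s'0 : 0 <= s + s1 by lra.
have [r1 _ Hr1] := continuous_path_bounded
  (flow_continuous iw (lexx 0) (b := s + s1) (y0 := c')).
have [d1 d10 lip] := flow_lipschitz r1.
have [k1 Hk1] := exists_nat_gt ((s + s1) / d1).
have kd1 : s + s1 <= k1%:R * d1 by have := Hk1 k1 (leqnn k1); rewrite ltr_pdivrMr // => /ltW.
have k10 : 0 < 2 ^+ k1 :> R by rewrite exprn_gt0.
(* Half of the old radius is spent on moving the center and half is left for the new ball;
   [1 / 2 ^+ k1] keeps end points within 1 by [flow_lipschitz]. *)
pose e' := Num.min (1 / 2 ^+ k1) (e / 2).
have e'0 : 0 < e' by rewrite lt_min !divr_gt0.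
have e'1 : 2 ^+ k1 * e' <= 1 by rewrite mulrC -ler_pdivlMr // ge_min lexx.
have e'2 : e' <= e / 2 by rewrite ge_min lexx orbT.
exists (Stage c' (concat s u v) (s + s1) (T' - s1 + eta) e'); split => //=.
- by split => //; rewrite /eta; lra.
- by rewrite pw.
- move=> c3 c3c; apply: le_trans (lip k1 _ _ _ _ iw _ Hr1 _) _.
  + by rewrite s'0.
  + by apply: le_trans e'1; rewrite ler_wpM2l // ltW.
  + by apply: le_trans e'1; rewrite ler_wpM2l // ltW.
- lra.
- by rewrite lerDl.
- by move=> t ts; rewrite /concat ts.
- by rewrite pw; apply: le_trans rK; rewrite le_max lexx.
Qed.

Lemma stage_sequence (Tmax : R) (w0 : stage) : valid_stage Tmax w0 ->
  exists w : nat -> stage, forall j, valid_stage Tmax (w j) /\ next_stage j%:R (w j) (w j.+1).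
Proof.
move=> v0.
(* The counter is part of the state, since the required norm grows with the number of the step. *)
pose X := {jw : nat * stage | valid_stage Tmax jw.2}.
pose nxt (x y : X) := (sval y).1 = (sval x).1.+1 /\
  next_stage (sval x).1%:R (sval x).2 (sval y).2.
have ex x : {y : X | nxt x y}.
  apply: cid; case: x => -[j w] /= vw.
  have [w' vw' nw'] := next_stage_exists j%:R vw.
  by exists (exist _ (j.+1, w') vw').
have [f [f0 fS]] := dependent_choice ex (exist _ (0%N, w0) v0).
have fj j : (sval (f j)).1 = j.
  by elim: j => [|j IH]; [rewrite f0 | have [-> _] := fS j; rewrite IH].
exists (fun j => (sval (f j)).2) => j; split; first exact: (svalP (f j)).
by have [_] := fS j; rewrite fj.
Qed.

Lemma no_unbounded_reach (y : 'rV[R]_N) (T : R) : ~ unbounded_reach y T.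
Proof.
move=> bad.
have iu0 : inputs (fun=> u0).
  split => //; last exact: ae_all.
  move=> W oW; have [Wu|nWu] := pselect (W u0).
    rewrite (_ : _ @^-1` W = setT); last by apply/seteqP; split.
    by apply: measurable_lebesgue; exact: measurableT.
  rewrite (_ : _ @^-1` W = set0); last by apply/seteqP; split.
  by apply: measurable_lebesgue; exact: measurable0.
have f0 z : flow (fun=> u0) z 0 = z by have [] := flowP z iu0.
(* At time 0 the flow is the identity, so that radius 1 is admissible; [T + 1] leaves slack above
   [T]. *)
have v0 : valid_stage (T + 1) (Stage y (fun=> u0) 0 T 1).
  by split => //=; rewrite ?f0 ?add0r ?ltrDl // => c; rewrite !f0.
have [w Hw] := stage_sequence v0.
have chain i j : (i <= j)%N -> [/\ `|center (w j) - center (w i)| + radius (w j) <= radius (w i),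
    time (w i) <= time (w j) & forall t, t < time (w i) -> input (w j) t = input (w i) t].
  elim: j => [|j IH]; first by rewrite leqn0 => /eqP ->; rewrite subrr normr0 add0r.
  rewrite leq_eqVlt => /orP[/eqP ->|]; first by rewrite subrr normr0 add0r.
  rewrite ltnS => /IH[h1 h2 h3]; have [_ [g1 g2 g3 _]] := Hw j; split.
  - have -> : center (w j.+1) - center (w i) =
       (center (w j.+1) - center (w j)) + (center (w j) - center (w i)) by rewrite subrKA.
    have := ler_normD (center (w j.+1) - center (w j)) (center (w j) - center (w i)); lra.
  - exact: le_trans g2.
  - by move=> t ti; rewrite g3 ?h3 // (lt_le_trans ti).
have iw j : inputs (input (w j)) by have [[]] := Hw j.
have t0 j : 0 <= time (w j) by have [[_ []]] := Hw j.
have tT j : time (w j) <= T + 1.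
  have [[_ [_ b1] _ b2 _] _] := Hw j.
  have [_ [_ [t [_ _ /andP[t0' t1] _]]]] := b2 1 0 ltr01; lra.
have rad j : 0 < radius (w j) by have [[_ _]] := Hw j.
have consistent i j t : (i <= j)%N -> t < time (w i) -> input (w j) t = input (w i) t.
  by move=> ij; have [_ _ h] := chain i j ij; exact: h.
have [v iv Hv] := @bounded_input_glue R m U rho (fun j => input (w j)) (fun j => time (w j)) u0
  Uu0 u0_rho iw consistent.
have bd j : `|center (w j)| <= `|center (w 0%N)| + radius (w 0%N).
  have [h _ _] := chain 0%N j (leq0n j); have rj := rad j.
  have := lerB_dist (center (w j)) (center (w 0%N)); lra.
have [c cr cc] := @bounded_sequence_cluster R N (fun j => center (w j)) (`|center (w 0%N)| + radius (w 0%N)) bd.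
have cw j : `|c - center (w j)| <= radius (w j).
  apply/ler_addgt0Pr => e e0; have [i ji Hi] := cc e e0 j.
  have [h1 _ _] := chain j i ji; have ri := rad i.
  have -> : c - center (w j) = - (center (w i) - c) + (center (w i) - center (w j)).
    by rewrite opprB subrKA.
  apply: le_trans (ler_normD _ _) _; rewrite normrN; lra.
have far j : j%:R <= `|flow v c (time (w j.+1))| + 1.
  have [_ [_ _ _ h1]] := Hw j; have [[_ _ _ _ h2] _] := Hw j.+1.
  have {}h2 := h2 c (cw j.+1).
  have -> : flow v c (time (w j.+1)) = flow (input (w j.+1)) c (time (w j.+1)).
    apply: (@flow_causal _ _ c (time (w j.+1)) _ iv (iw j.+1)).
      by move=> p _ pj; exact: Hv.
    by rewrite t0 lexx.
  apply: le_trans h1 _; rewrite -lerBlDl; apply: le_trans (lerB_dist _ _) _.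
  by rewrite distrC.
(* All stage times lie in [0, T + 1], where a single trajectory is bounded. *)
have [K _ HK] := continuous_path_bounded
  (flow_continuous iv (lexx 0) (b := T + 1) (y0 := c)).
have [j Hj] := exists_nat_gt (K + 1).
have : `|flow v c (time (w j.+1))| <= K by apply: HK; rewrite t0 tT.
have := far j; have := Hj j (leqnn j); lra.
Qed.

(** A sequence of violations has its initial points in a ball, and any cluster point of these has
    unbounded reach. Trajectories may end at [b], so that solutions on bounded intervals are covered
    as well. *)
Theorem reachable_bounded (r T : R) : exists2 K : R, 0 <= K &
  forall u y (b : R), inputs u -> b <= T -> trajectory g 0 b%:E u y -> `|y 0| <= r ->
  forall t, 0 <= t -> t < b -> `|y t| <= K.
Proof.
apply: contrapT => nK.
have /choice [w Hw] : forall j : nat, exists w : 'rV[R]_N * (R -> 'rV[R]_m) * R,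
  [/\ inputs w.1.2, `|w.1.1| <= r, 0 <= w.2 <= T & j%:R < `|flow w.1.2 w.1.1 w.2|].
  move=> j; apply: contrapT => nw; apply: nK; exists j%:R => // u y b iu bT ty yr t t0 tb.
  rewrite leNgt; apply/negP => yt; apply: nw; exists (y 0, u, t); split => //=.
    by rewrite t0 ltW // (lt_le_trans tb).
  by rewrite -(flow_unique iu ty).
have [q qr cq] := @bounded_sequence_cluster R N (fun j => (w j).1.1) r
  (fun j => let: And4 _ h _ _ := Hw j in h).
apply: (@no_unbounded_reach q T) => e K e0.
have [j Hj] := exists_nat_gt K; have [i ji Hi] := cq e e0 j.
have [h1 h2 h3 h4] := Hw i.
by exists (w i).1.1, (w i).1.2, (w i).2; split => //; apply: lt_trans h4; exact: Hj.
Qed.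

End Reach.

(** * Essentially bounded inputs *)

Section EssNorm.
Context {R : realType}.
Local Notation mu := (@lebesgue_measure R).

(** Over a null space an essential supremum would be -oo; positivity makes that of a non-negative
    function non-negative. *)
Lemma lebesgue_setT_gt0 : (0 < mu [set: R])%E.
Proof.
apply: (@lt_le_trans _ _ (mu `[0, 1]%classic)).
  by rewrite lebesgue_measure_itv /= lte01 oppr0 adde0 lte01.
by apply: le_measure; rewrite ?inE.
Qed.

(** [0 <= K] because [ess_norm] sees the value 0 outside [I]. *)
Lemma ess_norm_leP m (I : set R) (u : R -> 'rV[R]_m) (K : R) : 0 <= K ->
  (ess_norm I u <= K%:E)%E <-> {ae mu, forall t, I t -> enorm (u t) <= K}.
Proof.
move=> K0; split.
  move=> /ess_supP; apply: ae_imply => t + It.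
  by rewrite mem_set // lee_fin.
move=> H; apply/ess_supP; apply: ae_imply H => t H.
by case: ifPn => [/set_mem/H|_]; rewrite lee_fin.
Qed.

Lemma ess_norm_ge0 m (I : set R) (u : R -> 'rV[R]_m) : (0 <= ess_norm I u)%E.
Proof.
apply: ess_sup_gee; first exact: lebesgue_setT_gt0.
by apply: ae_all => t; case: ifP; rewrite lee_fin ?enorm_ge0.
Qed.

Lemma Linf_norm_ge0 m (I : set R) (u : R -> 'rV[R]_m) : 0 <= Linf_norm I u.
Proof. exact: fine_ge0 (ess_norm_ge0 _ _). Qed.

Lemma Linf_norm_ae m (I : set R) (u : R -> 'rV[R]_m) : (ess_norm I u < +oo)%E ->
  {ae mu, forall t, I t -> enorm (u t) <= Linf_norm I u}.
Proof.
move=> uoo; apply/ess_norm_leP; first exact: Linf_norm_ge0.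
by rewrite /Linf_norm fineK // ge0_fin_numE // ess_norm_ge0.
Qed.

Lemma Linf_norm_le m (I : set R) (u : R -> 'rV[R]_m) (K : R) : 0 <= K ->
  {ae mu, forall t, I t -> enorm (u t) <= K} ->
  (ess_norm I u < +oo)%E /\ Linf_norm I u <= K.
Proof.
move=> K0 /(ess_norm_leP _ _ K0) uK.
have uoo : (ess_norm I u < +oo)%E := le_lt_trans uK (ltry K).
split => //.
by rewrite -lee_fin /Linf_norm fineK // ge0_fin_numE // ess_norm_ge0.
Qed.

Lemma bounded_input_Linf m (U : set 'rV[R]_m) rho u (I : set R) :
  0 <= rho -> lebesgue_measurable I -> bounded_input U rho u -> Linf I U u.
Proof.
move=> rho0 mI [mu_ Uu bu]; split.
- by move=> W oW; apply: lebesgue_measurableI => //; exact: mu_.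
- by move=> t _.
- by have [] := @Linf_norm_le m I u rho rho0 (ae_imply (fun t h _ => h) bu).
Qed.

Lemma Linf_Linf_loc m (U : set 'rV[R]_m) (I : set R) u : Linf I U u -> Linf_loc I U u.
Proof.
case=> mI Uu uoo; split => // a b abI.
have [] := @Linf_norm_le m `[a, b]%classic u _ (Linf_norm_ge0 I u) => //.
by apply: ae_imply (Linf_norm_ae uoo) => t H /abI.
Qed.

Lemma LinfS m (U : set 'rV[R]_m) (I J : set R) u : lebesgue_measurable J -> J `<=` I ->
  Linf I U u -> Linf J U u /\ Linf_norm J u <= Linf_norm I u.
Proof.
move=> mJ JI [mI Uu uoo].
have [|joo jle] := @Linf_norm_le m J u _ (Linf_norm_ge0 I u).
  by apply: ae_imply (Linf_norm_ae uoo) => t H /JI.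
split => //; split => //.
- move=> W oW; have -> : J `&` u @^-1` W = J `&` (I `&` u @^-1` W).
    by rewrite setIA (setIidl JI).
  by apply: lebesgue_measurableI => //; exact: mI.
- by move=> t /JI; exact: Uu.
Qed.

(** Times before [a - s] receive the value [u0], whose norm [rho] has to bound as well. *)
Lemma Linf_bounded_input m (U : set 'rV[R]_m) (a s rho : R) u (u0 : 'rV[R]_m) :
  Linf `[a, +oo[ U u -> U u0 -> enorm u0 <= rho -> Linf_norm `[a, +oo[ u <= rho ->
  exists2 v, bounded_input U rho v & forall t, a <= t + s -> v t = u (t + s).
Proof.
move=> [mu_ Uu uoo] Uu0 u0r ur.
exists (fun t => if a <= t + s then u (t + s) else u0); last by move=> t ->.
split.
- move=> W oW.
  have -> : (fun t => if a <= t + s then u (t + s) else u0) @^-1` W =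
     ([set t | (`[a, +oo[ `&` u @^-1` W) (t + s)]) `|`
     (`]-oo, (a - s)[ `&` [set t | W u0]).
    apply/seteqP; split => t /=; rewrite !in_itv /= andbT ltrBrDr.
      by case: leP => h Wt; [left | right].
    by case=> -[]; case: leP.
  apply: lebesgue_measurableU; first exact: lebesgue_measurable_translation (mu_ W oW).
  apply: lebesgue_measurableI; first exact: lebesgue_measurable_itv.
  have [Wu0|Wu0] := pselect (W u0).
    by rewrite (_ : [set t | _] = setT); [apply: measurable_lebesgue | apply/seteqP; split].
  by rewrite (_ : [set t | _] = set0); [apply: measurable_lebesgue | apply/seteqP; split].
- by move=> t; case: ifP => // ats; apply: Uu; rewrite /= in_itv /= ats.
- apply: ae_imply (ae_translation s (Linf_norm_ae uoo)) => t H.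
  case: ifP => // ats; apply: le_trans ur; apply: H.
  by rewrite /= in_itv /= ats.
Qed.

Lemma Linf_shift m (U : set 'rV[R]_m) (a s : R) u : 0 <= s ->
  Linf `[a, +oo[ U u -> Linf `[a, +oo[ U (fun t => u (t + s)).
Proof.
move=> s0 Lu; have [mu_ Uu uoo] := Lu.
have a_a : U (u a) by apply: Uu; rewrite /= in_itv /= lexx.
pose rho := Num.max (enorm (u a)) (Linf_norm `[a, +oo[ u).
have [||v [mv Uv bv] vE] := @Linf_bounded_input m U a s rho u (u a) Lu a_a.
- by rewrite le_max lexx.
- by rewrite le_max lexx orbT.
have vE' t : `[a, +oo[%classic t -> v t = u (t + s).
  by rewrite /= in_itv /= andbT => at_; apply: vE; rewrite (le_trans at_) // lerDl.
split.
- move=> W oW.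
  have -> : `[a, +oo[ `&` (fun t => u (t + s)) @^-1` W = `[a, +oo[ `&` v @^-1` W.
    by apply/seteqP; split => t /= [it]; rewrite vE'.
  by apply: lebesgue_measurableI; [exact: lebesgue_measurable_itv | exact: mv].
- by move=> t it; rewrite -vE' //.
- have [||h _] := @Linf_norm_le m `[a, +oo[%classic (fun t => u (t + s)) rho => //.
    by rewrite le_max enorm_ge0.
  by apply: ae_imply bv => t h it; rewrite -vE'.
Qed.

End EssNorm.

(** * Partitions and piecewise absolutely continuous signals *)

Section Partition.
Context {R : realType}.
Variable tau : nat -> R.
Hypothesis tau_part : is_partition tau.

Lemma partition_le i j : (i <= j)%N -> tau i <= tau j.
Proof.
have [_ inc _] := tau_part.
elim: j => [|j IH]; first by rewrite leqn0 => /eqP ->.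
by rewrite leq_eqVlt => /orP[/eqP ->//|]; rewrite ltnS => /IH h; exact: le_trans h (ltW (inc j)).
Qed.

Lemma partition_ge0 i : 0 <= tau i.
Proof. by have [<- _ _] := tau_part; exact: partition_le. Qed.

Lemma partition_unbounded (t : R) : exists i, t < tau i.
Proof.
have [_ _ /cvgryPgt /(_ t) [i _ H]] := tau_part.
by exists i; apply: H => /=.
Qed.

Lemma partition_index (t : R) : 0 <= t -> exists i, tau i <= t < tau i.+1.
Proof.
move=> t0; have [i ti] := partition_unbounded t.
elim: i ti => [|i IH] ti; first by exfalso; move: ti; have [-> _ _] := tau_part; rewrite ltNge t0.
have [h|h] := ltP t (tau i); first exact: IH.
by exists i; rewrite h.
Qed.

Lemma partition_index_unique (t : R) i j :
  tau i <= t < tau i.+1 -> tau j <= t < tau j.+1 -> i = j.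
Proof.
move=> /andP[i1 i2] /andP[j1 j2].
have [ij|ji|//] := ltngtP i j.
  by exfalso; have := partition_le ij; clear ij; lra.
by exfalso; have := partition_le ji; clear ji; lra.
Qed.

Lemma partition_lower (b : R) : (forall i, b <= tau i.+1 - tau i) -> forall i, i%:R * b <= tau i.
Proof.
move=> tb; elim=> [|i IH]; first by rewrite mul0r partition_ge0.
by have := tb i; rewrite -natr1 mulrDl mul1r; lra.
Qed.

Lemma solves_partition n (x rhs : R -> 'rV[R]_n) :
  (forall i, abs_cont (tau i) (tau i.+1) x) ->
  (forall i, solves (tau i) (tau i.+1)%:E x rhs) -> solves 0 +oo%E x rhs.
Proof.
move=> acx sx; have [tau0 inc _] := tau_part.
have prefix i : abs_cont 0 (tau i) x /\ solves 0 (tau i)%:E x rhs.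
  elim: i => [|i [IH1 IH2]]; last first.
    split; first exact: abs_cont_cat IH1 (acx i).
    exact: solves_cat (partition_ge0 i) IH1 IH2 (sx i).
  have sub0 : abs_cont 0 0 x.
    by apply: abs_contS (acx 0%N); [rewrite tau0 | exact: partition_ge0].
  split; first by rewrite tau0.
  rewrite tau0; split.
    by move=> b b0; rewrite lte_fin => /lt_le_trans/(_ b0); rewrite ltxx.
  by apply: ae_all => t t0; rewrite lte_fin => /lt_le_trans/(_ t0); rewrite ltxx.
split.
  move=> b b0 _; have [i bi] := partition_unbounded b.
  by have [h _] := prefix i; apply: abs_contS h => //; exact: ltW.
apply: (@ae_imply R (fun t => forall i, 0 <= t -> (t%:E < (tau i)%:E)%E -> is_derive t 1 x (rhs t))).
  by move=> t H t0 _; have [i ti] := partition_unbounded t; apply: (H i) => //; rewrite lte_fin.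
pose E := \bigcup_i [set t | ~ (0 <= t -> (t%:E < (tau i)%:E)%E -> is_derive t 1 x (rhs t))].
apply: (@negligibleS _ _ _ lebesgue_measure E).
  by move=> t /= /existsNP[i Hi]; exists i.
by apply: negligible_bigcup => i; have [_ [_ h]] := prefix i; exact: h.
Qed.

End Partition.

Section Measurability.
Context {R : realType}.

(** Continuity is available on compact subintervals, which exhaust [[a, c[]. *)
Lemma abs_cont_measurable k (w : R -> 'rV[R]_k) (a c : R) :
  (forall b, a <= b -> b < c -> abs_cont a b w) ->
  forall O, open O -> lebesgue_measurable (`[a, c[ `&` w @^-1` O).
Proof.
move=> acw W oW.
have -> : `[a, c[ `&` w @^-1` W = \bigcup_i (`[a, (c - i.+1%:R^-1)] `&` w @^-1` W).
  apply/seteqP; split => t /=.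
    rewrite in_itv /= => -[/andP[at_ tc] Wt].
    have e0 : 0 < c - t by rewrite subr_gt0.
    have [j Hj] := exists_invS_lt e0.
    by exists j => //; split => //=; rewrite in_itv /= at_ /= lerBrDl -lerBrDr ltW // Hj.
  case=> i _ [/=]; rewrite !in_itv /= => /andP[-> ti] Wt; split => //=.
  by apply: le_lt_trans ti _; rewrite ltrBlDr ltrDl invr_gt0.
apply: lebesgue_measurable_bigcup => i.
have [ab|ba] := leP a (c - i.+1%:R^-1); last first.
  by rewrite set_itv_ge ?bnd_simp -?ltNge // set0I; apply: measurable_lebesgue.
have cw : {within `[a, (c - i.+1%:R^-1)], continuous w}.
  by apply: abs_cont_continuous; apply: acw => //; rewrite ltrBlDr ltrDl invr_gt0.
apply: measurable_lebesgue; apply: open_measurable_subspace; first exact: measurable_itv.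
by move/continuousP: cw; apply.
Qed.

Lemma piecewise_abs_cont_Linf_loc k (I : set R) (w : R -> 'rV[R]_k) (a c : nat -> R) :
  lebesgue_measurable I ->
  (forall t, I t -> exists i, a i <= t < c i) ->
  (forall i b, a i <= b -> b < c i -> abs_cont (a i) b w) ->
  (forall b, exists2 K : R, 0 <= K & forall t, I t -> t <= b -> enorm (w t) <= K) ->
  Linf_loc I setT w.
Proof.
move=> mI cover acw bw; split => //.
  move=> W oW.
  have -> : I `&` w @^-1` W = I `&` \bigcup_i (`[a i, c i[ `&` w @^-1` W).
    apply/seteqP; split => t /= [It]; last by case=> i _ [_ Wt].
    move=> Wt; split => //; by have [i ti] := cover t It; exists i.
  apply: lebesgue_measurableI => //; apply: lebesgue_measurable_bigcup => i.
  by apply: abs_cont_measurable => // b; exact: acw.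
move=> a' b' abI; have [K K0 HK] := bw b'.
have [|woo _] := @Linf_norm_le R k `[a', b']%classic w K K0.
  apply: ae_all => t tab; apply: HK; first exact: abI.
  by move: tab; rewrite /= in_itv /= => /andP[].
exact: woo.
Qed.

Lemma Linf_loc_truncate k (v : R -> 'rV[R]_k) (t : R) : 
  Linf_loc Rplus setT v -> Linf_loc Rplus setT (fun s => if s <= t then v s else 0).
Proof.
case=> mv _ bv; split => //.
  move=> W oW.
  have -> : Rplus `&` (fun s => if s <= t then v s else 0) @^-1` W =
      (`]-oo, t] `&` (Rplus `&` v @^-1` W)) `|` (`]t, +oo[ `&` (Rplus `&` [set _ | W 0])).
    apply/seteqP; split => s /=; rewrite !in_itv /= !andbT.
      by case: leP => st [s0 Ws]; [left | right].
    by case=> -[]; case: leP => // st _ [].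
  apply: lebesgue_measurableU; apply: lebesgue_measurableI; try exact: lebesgue_measurable_itv.
    exact: mv.
  apply: lebesgue_measurableI; first exact: lebesgue_measurable_itv.
  have [W0|W0] := pselect (W 0).
    by rewrite (_ : [set _ | _] = setT); [apply: measurable_lebesgue | apply/seteqP; split].
  by rewrite (_ : [set _ | _] = set0); [apply: measurable_lebesgue | apply/seteqP; split].
move=> a b /bv voo.
have [|woo _] := @Linf_norm_le R k `[a, b]%classic (fun s => if s <= t then v s else 0) _
  (Linf_norm_ge0 `[a, b]%classic v).
  apply: ae_imply (Linf_norm_ae voo) => s H sab.
  by case: ifP => _; [exact: H | rewrite enorm0 Linf_norm_ge0].
exact: woo.
Qed.

End Measurability.

(** * The sampled-data observer and the closed loop *)

Section RealEstimates.
Context {R : realType}.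

Lemma gain_combine (N a M M1 g G V : R) : 0 <= a -> 0 <= g ->
  M <= M1 -> G <= a * V -> N <= a * M + g * G -> N <= a * (M1 + g * V).
Proof.
move=> a0 g0 MM GV NM; apply: le_trans NM _; rewrite mulrDr mulrCA.
by apply: lerD; rewrite ler_wpM2l.
Qed.

(** The letters stand for exponentials, so that [ring] sees atoms: [d] is e^(-sigma (t - s)), [a] is
    e^(-sigma (s - r)), [et] is e^(-sigma t), [er] is e^(sigma r), [p] is e^(sigma (t - r + B)),
    [eb] is e^(sigma B). *)
Lemma gain_rescale (d a et er p eb M1 g X E c N : R) : 0 <= d ->
  d * a = et * er -> et * er * p = eb -> N <= a * (M1 + g * ((X + p * E) / c)) ->
  d * N <= et * (er * M1 + er * (g * (X / c))) + g * eb / c * E.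
Proof.
move=> d0 da pe /(ler_wpM2l d0); rewrite (mulrA d a) da -pe => H; apply: le_trans H _.
rewrite le_eqVlt; apply/orP; left; apply/eqP; ring.
Qed.

End RealEstimates.

Section Composition.
Context {R : realType}.

Lemma is_derive_row_mx n p (x : R -> 'rV[R]_n) (y : R -> 'rV[R]_p) (t : R)
    (dx : 'rV[R]_n) (dy : 'rV[R]_p) :
  is_derive t 1 x dx -> is_derive t 1 y dy ->
  is_derive t 1 (fun t => row_mx (x t) (y t)) (row_mx dx dy).
Proof.
case=> ex vx [ey vy].
have cx := (derivable_mxP x t 1).1 ex; have cy := (derivable_mxP y t 1).1 ey.
have e : derivable (fun t => row_mx (x t) (y t)) t 1.
  apply/derivable_mxP => i j; rewrite ord1; case: (split_ordP j) => j' ->.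
    by under eq_fun do rewrite row_mxEl; exact: cx.
  by under eq_fun do rewrite row_mxEr; exact: cy.
split => //; rewrite -vx -vy !derive_mx //.
apply/rowP => j; rewrite mxE; case: (split_ordP j) => j' ->.
  by rewrite row_mxEl mxE; congr ('D_1 _ t); apply/funext => s; rewrite row_mxEl.
by rewrite row_mxEr mxE; congr ('D_1 _ t); apply/funext => s; rewrite row_mxEr.
Qed.

Lemma solves_row_mx n p (a : R) (T : \bar R) (x rx : R -> 'rV[R]_n) (y ry : R -> 'rV[R]_p) :
  solves a T x rx -> solves a T y ry ->
  solves a T (fun t => row_mx (x t) (y t)) (fun t => row_mx (rx t) (ry t)).
Proof.
move=> [acx dx] [acy dy]; split.
  by move=> b ab bT; apply: abs_cont_row_mx; [exact: acx | exact: acy].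
apply: (ae_imply2 _ dx dy) => t H1 H2 at_ tT.
by apply: is_derive_row_mx; [exact: H1 | exact: H2].
Qed.

Lemma solves_comp p p' (g : 'rV[R]_p -> 'rV[R]_p') (a : R) x dx : smooth_on setT g ->
  solves a +oo%E x dx -> solves a +oo%E (fun t => g (x t)) (fun t => 'd g (x t) (dx t)).
Proof.
move=> sg [ac de]; split.
  move=> b ab bT; have acx := ac b ab bT.
  have [K K0 HK] := continuous_path_bounded (abs_cont_continuous acx).
  have [L L0 HL] := smooth_locally_lipschitz sg (p%:R * K).
  apply: (abs_cont_comp L0 _ acx) => s t sab tab.
  have b' y : a <= y <= b -> enorm (x y) <= p%:R * K.
    by move=> yab; apply: le_trans (enorm_le_norm _) _; rewrite ler_wpM2l // HK.
  by have [] := HL _ _ (b' _ tab) (b' _ sab).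
apply: ae_imply de => t H at_ tT.
by apply: is_derive_comp; [exact: smooth_differentiable | exact: H].
Qed.

Lemma derive1_near (V : normedModType R) (x y : R -> V) (t : R) :
  (\forall s \near t, x s = y s) -> derive1 x t = derive1 y t.
Proof. by move=> xy; rewrite !derive1E; apply: near_eq_derive; rewrite ?oner_neq0. Qed.

Lemma continuous_path_endpoint_bound n (a c K : R) (x : R -> 'rV[R]_n) :
  a < c -> {within `[a, c], continuous x} ->
  (forall t, a <= t -> t < c -> enorm (x t) <= K) -> enorm (x c) <= K.
Proof.
move=> ac /within_continuousP cx xK.
have cac : a <= c <= c by rewrite lexx ltW.
apply/ler_addgt0Pr => e e0.
have e1 : 0 < e / n.+1%:R by rewrite divr_gt0.
have [d d0 Hd] := cx c cac _ e1.
pose p := Num.max a (c - d / 2).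
have p1 : a <= p by rewrite /p le_max lexx.
have p2 : p < c by rewrite /p gt_max ac /=; lra.
have p3 : c - d / 2 <= p by rewrite /p le_max lexx orbT.
have pac : a <= p <= c by rewrite p1 ltW.
have pd : `|p - c| < d by rewrite ltr0_norm; lra.
have := Hd p pac pd; rewrite distrC ltr_pdivlMr // => H.
rewrite -(subrK (x p) (x c)); apply: le_trans (enormD _ _) _; rewrite addrC.
apply: lerD; first exact: xK.
apply: le_trans (enorm_le_norm _) _; apply: le_trans (ltW H).
by rewrite mulrC ler_wpM2l // ler_nat.
Qed.

End Composition.

(** * Exponentially weighted suprema *)

Section WeightedSup.
Context {R : realType}.

Lemma C0_norm_ge n (r : R) (phi : R -> 'rV[R]_n) (theta : R) : C0 r phi ->
  - r <= theta <= 0 -> enorm (phi theta) <= C0_norm r phi.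
Proof.
move=> cphi th; have [K K0 HK] := continuous_path_bounded cphi.
apply: ub_le_sup; last by exists theta => //=; rewrite in_itv.
exists (n%:R * K) => zz [s /=]; rewrite in_itv /= => sr <-.
by apply: le_trans (enorm_le_norm _) _; rewrite ler_wpM2l // HK.
Qed.

Lemma C0_norm_ge0 n (r : R) (phi : R -> 'rV[R]_n) : 0 < r -> C0 r phi -> 0 <= C0_norm r phi.
Proof.
move=> r0 cphi; apply: le_trans (enorm_ge0 (phi 0)) (C0_norm_ge cphi _).
by rewrite lexx oppr_le0 ltW.
Qed.

Variables (k : nat) (sigma : R).
Hypothesis sigma_ge0 : 0 <= sigma.
Implicit Types v : R -> 'rV[R]_k.

Lemma sup_norm_ge v (s t : R) : sup_finite v t -> 0 <= s <= t -> enorm (v s) <= sup_norm v t.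
Proof. by move=> fv st; apply: ub_le_sup => //; exists s => //=; rewrite in_itv. Qed.

Lemma exp_sup_ge v (s t : R) : sup_finite v t -> 0 <= s <= t ->
  expR (- (sigma * (t - s))) * enorm (v s) <= exp_sup sigma v t.
Proof.
move=> [K HK] st; apply: ub_le_sup; last by exists s => //=; rewrite in_itv.
exists K => zz [p /=]; rewrite in_itv /= => pt <-.
have pK : enorm (v p) <= K by apply: HK; exists p => //=; rewrite in_itv.
apply: le_trans pK; rewrite ler_piMl ?enorm_ge0 // -expR0 ler_expR oppr_le0 mulr_ge0 //.
by rewrite subr_ge0; case/andP: pt.
Qed.

Lemma exp_sup_le v (t K : R) : 0 <= t ->
  (forall s, 0 <= s <= t -> expR (- (sigma * (t - s))) * enorm (v s) <= K) ->
  exp_sup sigma v t <= K.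
Proof.
move=> t0 H; apply: ge_sup.
  by exists (expR (- (sigma * (t - t))) * enorm (v t)), t => //=; rewrite in_itv /= t0 lexx.
by move=> p [s /=]; rewrite in_itv /= => st <-; exact: H.
Qed.

Lemma exp_sup_ge0 v (t : R) : 0 <= t -> sup_finite v t -> 0 <= exp_sup sigma v t.
Proof.
move=> t0 fv; apply: le_trans (exp_sup_ge (s := t) fv _); last by rewrite t0 lexx.
by rewrite mulr_ge0 ?enorm_ge0 // expR_ge0.
Qed.

Lemma eq_exp_sup v v' (t : R) : (forall s, 0 <= s <= t -> v s = v' s) ->
  exp_sup sigma v t = exp_sup sigma v' t.
Proof.
move=> vv; rewrite /exp_sup; congr sup; apply/seteqP; split => p [s /= st <-]; exists s => //.
  by rewrite vv // -in_itv.
by rewrite vv // -in_itv.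
Qed.

End WeightedSup.

(** * Plant, intersample system and sampled-data observer *)

Section Systems.
Context {R : realType}.
Variables (n m k l : nat) (r : R) (U : set 'rV[R]_m).
Variables (f : 'rV[R]_n -> 'rV[R]_m -> 'rV[R]_n) (h : 'rV[R]_n -> 'rV[R]_k).
Variables (F : 'rV[R]_l -> 'rV[R]_k -> 'rV[R]_m -> 'rV[R]_l) (Psi : 'rV[R]_l -> 'rV[R]_n).
Hypothesis r_gt0 : 0 < r.
Hypothesis U_neq0 : U !=set0.
Hypothesis f_lip : lipschitz_field U f.
Hypothesis f_complete : forward_complete_plant U f.
Hypothesis h_smooth : smooth_on setT h.
Hypothesis Psi_smooth : smooth_on setT Psi.
Hypothesis F_lip : lipschitz_field U (fun (y : 'rV[R]_(l + k)) u => F (lsubmx y) (rsubmx y) u).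
Hypothesis intersample_complete : forward_complete_intersample r U f h F Psi.

(** [S] bounds the essential norm of [u] on its half-line, whereas [reachable_bounded] takes inputs
    on the whole line; filling in with [u0] turns [S] into [rho]. *)
Lemma plant_bounded (S T : R) : exists2 K : R, 0 <= K & forall u x (b : R),
  Linf `[- r, +oo[ U u -> Linf_norm `[- r, +oo[ u <= S -> b <= T ->
  solves 0 b%:E x (fun t => f (x t) (u t)) -> enorm (x 0) <= S ->
  forall t, 0 <= t -> t < b -> enorm (x t) <= K.
Proof.
have [u0 Uu0] := U_neq0; pose rho := Num.max S (enorm u0).
have u0r : enorm u0 <= rho by rewrite le_max lexx orbT.
have rho0 : 0 <= rho := le_trans (enorm_ge0 u0) u0r.
have complete u y0 : bounded_input U rho u -> exists y, y 0 = y0 /\ trajectory f 0 +oo%E u y.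
  move=> iu; apply: f_complete; apply: Linf_Linf_loc.
  by apply: bounded_input_Linf iu => //; exact: lebesgue_measurable_itv.
have [K K0 HK] := reachable_bounded f_lip complete Uu0 u0r S T.
exists (n%:R * K) => [|u x b Lu uS bT sx x0S t t0 tb]; first by rewrite mulr_ge0.
have uS' : Linf_norm `[- r, +oo[ u <= rho by rewrite le_max uS.
have [v iv vE] := Linf_bounded_input 0 Lu Uu0 u0r uS'.
apply: le_trans (enorm_le_norm _) _; rewrite ler_wpM2l //.
apply: (HK v x b) => //; last exact: le_trans (norm_le_enorm _) x0S.
apply: eq_solves sx => // s s0 sb; rewrite vE ?addr0 //.
by rewrite (le_trans _ (ltW s0)) // oppr_le0 ltW.
Qed.

(** [z] and [w] form one state, to which the reachability bound applies. *)
Definition intersample_field (y : 'rV[R]_(l + k)) (u : 'rV[R]_m) : 'rV[R]_(l + k) :=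
  row_mx (F (lsubmx y) (rsubmx y) u) (Lfh f h (Psi (lsubmx y)) u).

Lemma intersample_lip : lipschitz_field U intersample_field.
Proof.
apply: lipschitz_field_row_mx => //.
apply: (lipschitz_field_comp (Psi := Psi \o @lsubmx R 1 l k)).
  exact: lipschitz_field_Lfh.
apply: locally_lipschitz_comp; first exact: smooth_locally_lipschitz.
exact: locally_lipschitz_lsubmx.
Qed.

Definition intersample (a : R) (T : \bar R) (u : R -> 'rV[R]_m)
    (z : R -> 'rV[R]_l) (w : R -> 'rV[R]_k) : Prop :=
  solves a T z (fun t => F (z t) (w t) (u (t - r))) /\
  solves a T w (fun t => Lfh f h (Psi (z t)) (u (t - r))).

Lemma intersample_trajectory (a : R) (T : \bar R) u v z w : 
  intersample a T u z w -> (forall t, a < t -> v t = u (t - r)) ->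
  trajectory intersample_field a T v (fun t => row_mx (z t) (w t)).
Proof.
move=> [sz sw] uv; apply: eq_solves (solves_row_mx sz sw) => // t at_ _.
by rewrite /intersample_field row_mxKl row_mxKr uv.
Qed.

Lemma intersample_bounded (S T : R) : exists2 K : R, 0 <= K & forall u z w (a c : R),
  Linf `[- r, +oo[ U u -> Linf_norm `[- r, +oo[ u <= S -> 0 <= a -> c - a <= T ->
  intersample a c%:E u z w -> enorm (z a) <= S -> enorm (w a) <= S ->
  forall t, a <= t -> t < c -> enorm (z t) <= K /\ enorm (w t) <= K.
Proof.
have [u0 Uu0] := U_neq0; pose rho := Num.max S (enorm u0).
have u0r : enorm u0 <= rho by rewrite le_max lexx orbT.
have rho0 : 0 <= rho := le_trans (enorm_ge0 u0) u0r.
have complete u y0 : bounded_input U rho u ->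
    exists y, y 0 = y0 /\ trajectory intersample_field 0 +oo%E u y.
  move=> iu.
  (* The system reads its input at [t - r]; feeding it [u (t + r)] removes the delay. *)
  have [|z [w [z0 w0 sz sw]]] := intersample_complete (lsubmx y0) (rsubmx y0) (u := fun t => u (t + r)).
    apply: bounded_input_Linf (bounded_input_shift r iu) => //; exact: lebesgue_measurable_itv.
  exists (fun t => row_mx (z t) (w t)); split; first by rewrite z0 w0 hsubmxK.
  by apply: (intersample_trajectory (u := fun t => u (t + r))) => // t _; rewrite subrK.
have [K K0 HK] := reachable_bounded intersample_lip complete Uu0 u0r S T.
exists ((l + k)%:R * K) => [|u z w a c Lu uS a0 caT sys zS wS t at_ tc]; first by rewrite mulr_ge0.
have uS' : Linf_norm `[- r, +oo[ u <= rho by rewrite le_max uS.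
have [v iv vE] := Linf_bounded_input (a - r) Lu Uu0 u0r uS'.
have tr : trajectory intersample_field 0 (c - a)%:E v (fun t => row_mx (z (t + a)) (w (t + a))).
  apply: (intersample_trajectory (u := fun t => u (t + a))).
    case: sys => sz sw; split.
      have := @solves_shift R l 0 (c - a)%:E a z (fun t => F (z t) (w t) (u (t - r))).
      rewrite add0r -EFinD subrK => /(_ sz); apply: eq_solves => // s _ _.
      by rewrite addrAC.
    have := @solves_shift R k 0 (c - a)%:E a w (fun t => Lfh f h (Psi (z t)) (u (t - r))).
    rewrite add0r -EFinD subrK => /(_ sw); apply: eq_solves => // s _ _.
    by rewrite addrAC.
  move=> s s0; rewrite vE; first by rewrite addrAC addrA.
  by rewrite addrA lerBrDr addNr addr_ge0 // ltW.
have y0S : `|row_mx (z (0 + a)) (w (0 + a))| <= S.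
  rewrite add0r; apply: le_trans (norm_row_mx _ _) _.
  by rewrite ge_max !(le_trans (norm_le_enorm _)).
have ta0 : 0 <= t - a by rewrite subr_ge0.
have tac : t - a < c - a by rewrite ltrD2r.
have H : enorm (row_mx (z t) (w t)) <= (l + k)%:R * K.
  apply: le_trans (enorm_le_norm _) _; rewrite ler_wpM2l //.
  by have := HK v _ _ iv caT tr y0S _ ta0 tac; rewrite subrK.
split; apply: le_trans H.
  by have := enorm_lsubmx (row_mx (z t) (w t)); rewrite row_mxKl.
by have := enorm_rsubmx (row_mx (z t) (w t)); rewrite row_mxKr.
Qed.

Lemma intersample_unique (a : R) (T : \bar R) u z w z' w' :
  0 <= a -> Linf `[- r, +oo[ U u ->
  intersample a T u z w -> intersample a T u z' w' -> z a = z' a -> w a = w' a ->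
  forall t, a <= t -> (t%:E < T)%E -> z t = z' t /\ w t = w' t.
Proof.
move=> a0 Lu sys sys' za wa t at_ tT.
have [u0 Uu0] := U_neq0; pose rho := Num.max (Linf_norm `[- r, +oo[ u) (enorm u0).
have u0r : enorm u0 <= rho by rewrite le_max lexx orbT.
have uS' : Linf_norm `[- r, +oo[ u <= rho by rewrite le_max lexx.
have [v iv vE] := Linf_bounded_input (- r) Lu Uu0 u0r uS'.
have vE' s : a < s -> v s = u (s - r).
  by move=> as_; rewrite vE // lerBrDr addNr (le_trans a0) // ltW.
have := trajectory_unique intersample_lip iv (intersample_trajectory sys vE')
  (intersample_trajectory sys' vE') _ at_ tT.
rewrite za wa => /(_ erefl) e; split.
  by rewrite -(row_mxKl (z t) (w t)) e row_mxKl.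
by rewrite -(row_mxKr (z t) (w t)) e row_mxKr.
Qed.

(** The samples are an arbitrary sequence, which cuts the link to the plant: existence, uniqueness
    and bounds are proved for given samples. *)
Definition sampled_observer (tau : nat -> R) (u : R -> 'rV[R]_m) (y : nat -> 'rV[R]_k)
    (T : \bar R) (z : R -> 'rV[R]_l) (w : R -> 'rV[R]_k) : Prop :=
  solves 0 T z (fun t => F (z t) (w t) (u (t - r))) /\
  forall i : nat,
    solves (tau i) (Order.min (tau i.+1)%:E T) w
      (fun t => Lfh f h (Psi (z t)) (u (t - r))) /\
    (((tau i.+1)%:E < T)%E -> w (tau i.+1) = y i.+1).

Lemma sampled_observer_intersample tau u y T z w i : is_partition tau ->
  sampled_observer tau u y T z w ->
  intersample (tau i) (Order.min (tau i.+1)%:E T) u z w.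
Proof.
move=> tp [sz sw]; split; last by have [] := sw i.
by apply: solvesW sz; [exact: partition_ge0 | rewrite ge_min lexx orbT].
Qed.

(** At a sampling time [z] passes by continuity and [w] is reset to equal samples, so that equality
    spreads from one interval to the next. *)
Lemma sampled_observer_unique tau u y y' T z w z' w' : is_partition tau ->
  Linf `[- r, +oo[ U u ->
  sampled_observer tau u y T z w -> sampled_observer tau u y' T z' w' ->
  (forall i, ((tau i.+1)%:E < T)%E -> y i.+1 = y' i.+1) ->
  z 0 = z' 0 -> w 0 = w' 0 ->
  forall t, 0 <= t -> (t%:E < T)%E -> z t = z' t /\ w t = w' t.
Proof.
move=> tp Lu s1 s2 yy zz ww; have [tau0 inc _] := tp.
have on_piece i : z (tau i) = z' (tau i) -> w (tau i) = w' (tau i) ->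
    forall t, tau i <= t -> t < tau i.+1 -> (t%:E < T)%E -> z t = z' t /\ w t = w' t.
  move=> zi wi t ti ti' tT.
  apply: (intersample_unique (partition_ge0 tp i) Lu
    (sampled_observer_intersample i tp s1) (sampled_observer_intersample i tp s2)) => //.
  by rewrite lt_min lte_fin ti'.
have at_samples i : ((tau i)%:E < T)%E -> z (tau i) = z' (tau i) /\ w (tau i) = w' (tau i).
  elim: i => [|i IH] tT; first by rewrite tau0.
  have iT : ((tau i)%:E < T)%E by apply: lt_trans tT; rewrite lte_fin.
  have [zi wi] := IH iT.
  have [sz sw] := s1; have [sz' sw'] := s2; split; last first.
    by have [_ ->] // := sw i; have [_ ->] // := sw' i; exact: yy.
  apply: (continuous_path_endpoint (inc i)).
  - by apply: solves_continuous (solvesW (partition_ge0 tp i) (lexx _) sz) tT.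
  - by apply: solves_continuous (solvesW (partition_ge0 tp i) (lexx _) sz') tT.
  move=> t ti ti'; have [] // := on_piece i zi wi t ti ti'.
  by apply: lt_trans tT; rewrite lte_fin.
move=> t t0 tT; have [i /andP[ti ti']] := partition_index tp t0.
have [|zi wi] := at_samples i; first by apply: le_lt_trans tT; rewrite lee_fin.
exact: (on_piece i).
Qed.

Lemma sampled_observer_exists tau u y z0 w0 : is_partition tau ->
  Linf `[- r, +oo[ U u ->
  exists z w, [/\ z 0 = z0, w 0 = w0 & sampled_observer tau u y +oo%E z w].
Proof.
move=> tp Lu; have [tau0 inc _] := tp.
(* Pieces are solved from time 0 with the input advanced by [tau i], for every possible initial
   value; the recursion below only selects among them. *)
have /choice [seg Hseg] : forall p : nat * 'rV[R]_l * 'rV[R]_k,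
    exists zw : (R -> 'rV[R]_l) * (R -> 'rV[R]_k),
    [/\ zw.1 0 = p.1.2, zw.2 0 = p.2,
      solves 0 +oo%E zw.1 (fun t => F (zw.1 t) (zw.2 t) (u (t + tau p.1.1 - r))) &
      solves 0 +oo%E zw.2 (fun t => Lfh f h (Psi (zw.1 t)) (u (t + tau p.1.1 - r)))].
  move=> [[i a] b] /=.
  have [z [w [h1 h2 h3 h4]]] := intersample_complete a b (Linf_shift (partition_ge0 tp i) Lu).
  exists (z, w); split => //=.
    by apply: eq_solves h3 => // t _ _; rewrite addrAC.
  by apply: eq_solves h4 => // t _ _; rewrite addrAC.
pose om i := if i is j.+1 then y j.+1 else w0.
pose zeta := fix zeta i :=
  if i is j.+1 then (seg (j, zeta j, om j)).1 (tau j.+1 - tau j) else z0.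
pose Z i := (seg (i, zeta i, om i)).1; pose W i := (seg (i, zeta i, om i)).2.
have HZ i : [/\ Z i 0 = zeta i, W i 0 = om i,
    solves 0 +oo%E (Z i) (fun t => F (Z i t) (W i t) (u (t + tau i - r))) &
    solves 0 +oo%E (W i) (fun t => Lfh f h (Psi (Z i t)) (u (t + tau i - r)))].
  exact: (Hseg (i, zeta i, om i)).
have /choice [idx Hidx] : forall t : R, exists i, 0 <= t -> tau i <= t < tau i.+1.
  move=> t; have [t0|t0] := leP 0 t; last by exists 0%N.
  by have [i Hi] := partition_index tp t0; exists i.
have idxE t i : tau i <= t -> t < tau i.+1 -> idx t = i.
  move=> ti ti'; have t0 : 0 <= t := le_trans (partition_ge0 tp i) ti.
  by apply: (partition_index_unique tp (Hidx t t0)); rewrite ti.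
pose z t := Z (idx t) (t - tau (idx t)); pose w t := W (idx t) (t - tau (idx t)).
(* [z] is glued continuously, so that the formula includes the right end point, where [zeta i.+1] is
   the final value of piece [i]. For [w], which jumps, the interval is half-open. *)
have zE i t : tau i <= t -> t <= tau i.+1 -> z t = Z i (t - tau i).
  move=> ti; rewrite le_eqVlt => /orP[/eqP ->|ti']; last by rewrite /z (idxE t i).
  rewrite /z (idxE _ i.+1) // subrr; have [-> _ _ _] := HZ i.+1.
  by [].
have wE i t : tau i <= t -> t < tau i.+1 -> w t = W i (t - tau i).
  by move=> ti ti'; rewrite /w (idxE t i).
have shifted p (x rhs : R -> 'rV[R]_p) i : solves 0 +oo%E x rhs ->
    solves (tau i) +oo%E (fun t => x (t - tau i)) (fun t => rhs (t - tau i)).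
  by move=> sx; apply: solves_shift; rewrite subrr.
have sw i : solves (tau i) (tau i.+1)%:E w (fun t => Lfh f h (Psi (z t)) (u (t - r))).
  have [_ _ _ h4] := HZ i.
  apply: eq_solves (solvesW (lexx _) (leey _) (shifted _ _ _ i h4)) => t ti.
    by rewrite lte_fin => ti'; rewrite (wE i).
  by rewrite lte_fin => ti'; rewrite (zE i) ?(ltW ti) ?(ltW ti') // subrK.
exists z, w; split.
- by rewrite (zE 0%N) ?tau0 ?partition_ge0 // subrr; have [-> _ _ _] := HZ 0%N.
- rewrite (wE 0%N) ?tau0 // ?subrr; first by have [_ -> _ _] := HZ 0%N.
  by rewrite -tau0.
split.
  apply: (solves_partition tp) => i.
    have [_ _ h3 _] := HZ i; have [ac _] := shifted _ _ _ i h3.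
    apply: eq_abs_cont (ac (tau i.+1) (ltW (inc i)) (ltry _)) => t /andP[ti ti'].
    by rewrite (zE i).
  have [_ _ h3 _] := HZ i.
  apply: eq_solves (solvesW (lexx _) (leey _) (shifted _ _ _ i h3)) => t ti.
    by rewrite lte_fin => ti'; rewrite (zE i) // ltW.
  rewrite lte_fin => ti'; rewrite (zE i) ?(ltW ti) ?(ltW ti') // (wE i) ?(ltW ti) //.
  by rewrite subrK.
move=> i; split; first by apply: solvesW (sw i) => //; rewrite ge_min lexx.
move=> _; rewrite (wE i.+1) // subrr.
by have [_ -> _ _] := HZ i.+1.
Qed.

Lemma sampled_observer_bounded (S B : R) (N : nat) : exists2 K : R, 0 <= K &
  forall tau u y z w, is_partition tau -> (forall i, tau i.+1 - tau i <= B) ->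
  Linf `[- r, +oo[ U u -> Linf_norm `[- r, +oo[ u <= S ->
  sampled_observer tau u y +oo%E z w -> enorm (z 0) <= S -> enorm (w 0) <= S ->
  (forall i, (i < N)%N -> enorm (y i) <= S) ->
  forall t, 0 <= t -> t < tau N -> enorm (z t) <= K /\ enorm (w t) <= K.
Proof.
(* For the induction [z] has to be bounded up to and including [tau N], where the next interval
   starts, and [w] before [tau N] only, since there it takes the value of a sample. *)
suff [K K0 HK] : exists2 K : R, 0 <= K &
  forall tau u y z w, is_partition tau -> (forall i, tau i.+1 - tau i <= B) ->
  Linf `[- r, +oo[ U u -> Linf_norm `[- r, +oo[ u <= S ->
  sampled_observer tau u y +oo%E z w -> enorm (z 0) <= S -> enorm (w 0) <= S ->
  (forall i, (i < N)%N -> enorm (y i) <= S) ->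
  (forall t, 0 <= t -> t <= tau N -> enorm (z t) <= K) /\
  (forall t, 0 <= t -> t < tau N -> enorm (w t) <= K).
  exists K => // tau u y z w tp tB Lu uS so z0 w0 yS t t0 tN.
  have [h1 h2] := HK tau u y z w tp tB Lu uS so z0 w0 yS.
  by split; [apply: h1 => //; exact: ltW | exact: h2].
elim: N => [|N [K K0 HK]].
  exists `|S| => // tau u y z w [tau0 _ _] _ _ _ _ z0 _ _; rewrite tau0; split => t t0 tt.
    have -> : t = 0 by apply/eqP; rewrite eq_le tt t0.
    by apply: le_trans z0 (ler_norm _).
  by move: tt; rewrite ltNge t0.
have [K1 K10 HK1] := intersample_bounded (Num.max K S) B.
exists (K + K1) => [|tau u y z w tp tB Lu uS so z0 w0 yS]; first by rewrite addr_ge0.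
have [h1 h2] := HK tau u y z w tp tB Lu uS so z0 w0 (fun i iN => yS i (ltnW iN)).
have [tau0 inc _] := tp; have [sz sw] := so.
have sy := sampled_observer_intersample N tp so.
have wN : enorm (w (tau N)) <= S.
  case: N yS {HK h1 h2 sy} => [|N] yS; first by rewrite tau0.
  by have [_ ->] := sw N; [exact: yS | exact: ltry].
have on_last t : tau N <= t -> t < tau N.+1 -> enorm (z t) <= K1 /\ enorm (w t) <= K1.
  apply: (HK1 u z w (tau N) (tau N.+1) Lu _ _ (tB N)).
  - by rewrite le_max uS orbT.
  - exact: partition_ge0.
  - by case: sy => s1 s2; split; [apply: solvesW s1 | apply: solvesW s2] => //; rewrite le_min leey lexx.
  - by rewrite le_max h1 // partition_ge0.
  - by rewrite le_max wN orbT.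
have zlast : enorm (z (tau N.+1)) <= K1.
  apply: (continuous_path_endpoint_bound (inc N)).
    by apply: solves_continuous (solvesW (partition_ge0 tp N) (lexx _) sz) (ltry _).
  by move=> t t1 t2; have [] := on_last t t1 t2.
split => t t0.
  rewrite le_eqVlt => /orP[/eqP ->|tN]; first by apply: le_trans zlast _; rewrite lerDr.
  have [Nt|tN'] := leP (tau N) t; first by have [hz _] := on_last t Nt tN; apply: le_trans hz _; rewrite lerDr.
  by apply: le_trans (h1 _ t0 (ltW tN')) _; rewrite lerDl.
move=> tN; have [Nt|tN'] := leP (tau N) t.
  by have [_ hw] := on_last t Nt tN; apply: le_trans hw _; rewrite lerDr.
by apply: le_trans (h2 _ t0 tN') _; rewrite lerDl.
Qed.

Lemma sampled_observer_locally_bounded tau B u y z w : is_partition tau ->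
  (forall i, tau i.+1 - tau i <= B) -> Linf `[- r, +oo[ U u ->
  sampled_observer tau u y +oo%E z w ->
  forall b : R, exists2 K : R, 0 <= K & forall t, 0 <= t -> t <= b -> enorm (w t) <= K.
Proof.
move=> tp tB Lu so b; have [N bN] := partition_unbounded tp b.
pose S := Linf_norm `[- r, +oo[ u + enorm (z 0) + enorm (w 0) + \sum_(i < N) enorm (y i).
have L0 := Linf_norm_ge0 `[- r, +oo[ u; have z0 := enorm_ge0 (z 0); have w0 := enorm_ge0 (w 0).
have s0 : 0 <= \sum_(i < N) enorm (y i) by apply: sumr_ge0 => i _; exact: enorm_ge0.
have [K K0 HK] := sampled_observer_bounded S B N.
exists K => // t t0 tb.
have [||||_ //] := HK tau u y z w tp tB Lu _ so _ _ _ t t0 (le_lt_trans tb bN).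
- rewrite /S; lra.
- rewrite /S; lra.
- rewrite /S; lra.
- move=> i iN; have : enorm (y i) <= \sum_(i < N) enorm (y i).
    rewrite (bigD1 (Ordinal iN)) //= lerDl; apply: sumr_ge0 => j _; exact: enorm_ge0.
  by clear iN; rewrite /S; lra.
Qed.

(* Before time 0 the signal w is irrelevant and is replaced by 0. *)
Lemma sampled_observer_Linf_loc tau B u y z w : is_partition tau ->
  (forall i, tau i.+1 - tau i <= B) -> Linf `[- r, +oo[ U u ->
  sampled_observer tau u y +oo%E z w ->
  Linf_loc `[- r, +oo[ setT (fun t => if t < 0 then 0 else w t).
Proof.
move=> tp tB Lu so; have [tau0 inc _] := tp.
apply: (@piecewise_abs_cont_Linf_loc R k _ _
  (fun i => if i is j.+1 then tau j else - r) (fun i => if i is j.+1 then tau j.+1 else 0)).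
- exact: lebesgue_measurable_itv.
- move=> t; rewrite /= in_itv /= andbT => rt; have [t0|t0] := ltP t 0.
    by exists 0%N; rewrite rt.
  by have [i Hi] := partition_index tp t0; exists i.+1.
- case=> [|i] b ab bc.
    apply: (@eq_abs_cont _ _ _ _ (fun=> 0)).
      by move=> t /andP[_ tb]; rewrite (le_lt_trans tb bc).
    by move=> e e0; exists 1 => // N s s' _ _ _; rewrite big1 // => j _; rewrite subrr enorm0.
  have [_ sw] := so; have [[ac _] _] := sw i.
  apply: eq_abs_cont (ac b ab _).
    by move=> t /andP[it _]; rewrite ltNge (le_trans (partition_ge0 tp i) it).
  by rewrite lt_min lte_fin bc ltry.
- move=> b; have [K K0 HK] := sampled_observer_locally_bounded tp tB Lu so b.
  exists K => // t _ tb; case: ltP => t0; first by rewrite enorm0.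
  exact: HK.
Qed.

(** * Existence, uniqueness and causality of the closed loop *)

Section ClosedLoop.
Variables (q : nat) (A : set (R -> 'rV[R]_n)).
Variables (Fp : (R -> 'rV[R]_q) -> (R -> 'rV[R]_m) -> 'rV[R]_n -> 'rV[R]_n -> 'rV[R]_q).
Hypothesis A_neq0 : A !=set0.
Hypothesis predictor_exists : forall x0 xi0 u z,
  C0 r x0 -> C0 r xi0 -> Linf `[- r, +oo[ U u -> A z ->
  exists x xi, plant_predictor_solution r f Fp x0 xi0 u z +oo%E x xi.
Hypothesis predictor_unique : forall x0 xi0 u z,
  C0 r x0 -> C0 r xi0 -> Linf `[- r, +oo[ U u -> A z ->
  forall T x xi x' xi',
    plant_predictor_solution r f Fp x0 xi0 u z T x xi ->
    plant_predictor_solution r f Fp x0 xi0 u z T x' xi' ->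
    forall t, 0 <= t -> (t%:E < T)%E -> x t = x' t /\ xi t = xi' t.
Hypothesis estimate_in_A :
   forall (z0 : 'rV[R]_l) (u : R -> 'rV[R]_m) (w : R -> 'rV[R]_k),
     Linf `[- r, +oo[ U u -> Linf_loc `[- r, +oo[ setT w ->
     forall z, delayed_observer_solution r F z0 u w z -> A (Psi \o z).
Variables (tau : nat -> R) (B : R).
Hypothesis tp : is_partition tau.
Hypothesis tB : forall i, tau i.+1 - tau i <= B.

Definition samples (x : R -> 'rV[R]_n) (v : R -> 'rV[R]_k) (i : nat) : 'rV[R]_k :=
  h (x (tau i - r)) + v (tau i).

Local Notation closed_loop := (closed_loop_solution r f h F Psi Fp tau).

Lemma closed_loop_sampled x0 z0 w0 xi0 u v T x z w xi :
  closed_loop x0 z0 w0 xi0 u v T x z w xi ->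
  sampled_observer tau u (samples x v) T z w.
Proof. by case=> _ _ sz sw _; split. Qed.

Lemma estimate_in_class z0 u y z w : Linf `[- r, +oo[ U u ->
  sampled_observer tau u y +oo%E z w -> z 0 = z0 -> A (Psi \o z).
Proof.
move=> Lu so zz; have [sz sw] := so.
apply: (estimate_in_A (z0 := z0) Lu (sampled_observer_Linf_loc tp tB Lu so)).
split => //; apply: eq_solves sz => // t t0 _.
by rewrite ltNge (ltW t0).
Qed.

(* The plant equation in plant_predictor_solution does not involve z, so that any
   element of A provides x. *)
Lemma closed_loop_exists x0 z0 w0 xi0 u v :
  Linf `[- r, +oo[ U u -> C0 r x0 -> C0 r xi0 ->
  exists x z w xi, closed_loop x0 z0 w0 xi0 u v +oo%E x z w xi.
Proof.
move=> Lu cx0 cxi0; have [zA AzA] := A_neq0.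
have [x [_ [x00 _ sx _]]] := predictor_exists cx0 cxi0 Lu AzA.
have [z [w [zz ww so]]] := sampled_observer_exists (samples x v) z0 w0 tp Lu.
have Az := estimate_in_class Lu so zz.
have [_ [xi [_ xi00 _ sxi]]] := predictor_exists cx0 cxi0 Lu Az.
exists x, z, w, xi; have [sz sw] := so; split => //; by split.
Qed.

(** Agreement of [v] and [v'] at the sampling times before [T] expresses causality. The plant does
    not see the observer, so that [x'] with the global [xi] still solves the predictor system, which
    identifies [x]. Then the samples agree, hence [z] and [w], and finally [xi'] solves the
    predictor driven by the global [z]. *)
Lemma closed_loop_unique_global x0 z0 w0 xi0 u v v' T x z w xi x' z' w' xi' :
  Linf `[- r, +oo[ U u -> C0 r x0 -> C0 r xi0 ->
  (forall i, ((tau i.+1)%:E < T)%E -> v (tau i.+1) = v' (tau i.+1)) ->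
  closed_loop x0 z0 w0 xi0 u v +oo%E x z w xi ->
  closed_loop x0 z0 w0 xi0 u v' T x' z' w' xi' ->
  forall t, 0 <= t -> (t%:E < T)%E ->
    [/\ x t = x' t, z t = z' t, w t = w' t & xi t = xi' t].
Proof.
move=> Lu cx0 cxi0 vv s1 s2.
have so1 := closed_loop_sampled s1; have so2 := closed_loop_sampled s2.
have [[x00 xi00 zz ww] sx sz sw sxi] := s1; have [[x00' xi00' zz' ww'] sx' sz' sw' sxi'] := s2.
have Az := estimate_in_class Lu so1 zz.
have pp1 : plant_predictor_solution r f Fp x0 xi0 u (Psi \o z) T x xi.
  by split; [exact: x00 | exact: xi00 | apply: solvesW sx | apply: solvesW sxi]; rewrite ?leey.
have xE t : 0 <= t -> (t%:E < T)%E -> x t = x' t.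
  move=> t0 tT.
  have pp2 : plant_predictor_solution r f Fp x0 xi0 u (Psi \o z) T x' xi.
    split; [exact: x00' | exact: xi00 | exact: sx' |].
    by apply: solvesW sxi; rewrite ?leey.
  by have [] := predictor_unique cx0 cxi0 Lu Az pp1 pp2 t0 tT.
have xE' t : - r <= t -> (t%:E < T)%E -> x t = x' t.
  move=> rt tT; have [t0|t0] := leP 0 t; first exact: xE.
  by rewrite x00 ?x00' // rt ltW.
have so1' : sampled_observer tau u (samples x v) T z w.
  split; first by apply: solvesW sz; rewrite ?leey.
  move=> i; have [h1 h2] := sw i; split; last by move=> _; apply: h2; exact: ltry.
  by apply: solvesW h1 => //; rewrite le_min leey andbT ge_min lexx.
have zwE : forall t, 0 <= t -> (t%:E < T)%E -> z t = z' t /\ w t = w' t.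
  apply: (sampled_observer_unique tp Lu so1' so2); rewrite ?zz ?ww //.
  move=> i iT; rewrite /samples vv // xE' //.
    by rewrite lerBrDr addNr partition_ge0.
  by apply: lt_trans iT; rewrite lte_fin ltrBlDr ltrDl.
have pp3 : plant_predictor_solution r f Fp x0 xi0 u (Psi \o z) T x xi'.
  split; [exact: x00 | exact: xi00' | by apply: solvesW sx; rewrite ?leey |].
  apply: (eq_solves (fun t _ _ => erefl) _ sxi') => t t0 tT.
  have [zt _] := zwE t (ltW t0) tT.
  have -> : derive1 (Psi \o z) t = derive1 (Psi \o z') t.
    apply: derive1_near; apply: filterS (near_open_interval t0 tT) => s [s0 sT] /=.
    by have [-> _] := zwE s s0 sT.
  by rewrite /= zt.
move=> t t0 tT; have [zt wt] := zwE t t0 tT.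
have [_ xit] := predictor_unique cx0 cxi0 Lu Az pp1 pp3 t0 tT.
by split => //; exact: xE.
Qed.

(** Membership of the estimate in [A] is known for global solutions, so that two solutions up to [T]
    are compared through a third, global one. *)
Lemma closed_loop_unique x0 z0 w0 xi0 u v T x z w xi x' z' w' xi' :
  Linf `[- r, +oo[ U u -> C0 r x0 -> C0 r xi0 ->
  closed_loop x0 z0 w0 xi0 u v T x z w xi ->
  closed_loop x0 z0 w0 xi0 u v T x' z' w' xi' ->
  forall t, 0 <= t -> (t%:E < T)%E ->
    [/\ x t = x' t, z t = z' t, w t = w' t & xi t = xi' t].
Proof.
move=> Lu cx0 cxi0 s1 s2 t t0 tT.
have [xg [zg [wg [xig sg]]]] := closed_loop_exists z0 w0 v Lu cx0 cxi0.
have vv i : ((tau i.+1)%:E < T)%E -> v (tau i.+1) = v (tau i.+1) by [].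
have [<- <- <- <-] := closed_loop_unique_global Lu cx0 cxi0 vv sg s1 t0 tT.
exact: closed_loop_unique_global Lu cx0 cxi0 vv sg s2 t t0 tT.
Qed.

End ClosedLoop.

(** One number bounds all data, [v] even pointwise on the whole half-line; the constants below
    depend on [S] but on no particular solution. *)
Definition bounded_data (S b B : R) (tau : nat -> R) (u : R -> 'rV[R]_m) (v : R -> 'rV[R]_k)
    (x : R -> 'rV[R]_n) (z : R -> 'rV[R]_l) (w : R -> 'rV[R]_k) : Prop :=
  [/\ [/\ is_partition tau, (forall i, tau i.+1 - tau i <= B) & (forall i, b <= tau i.+1 - tau i)],
      [/\ Linf `[- r, +oo[ U u, Linf_norm `[- r, +oo[ u <= S, Linf_loc Rplus setT v &
          (forall t, 0 <= t -> enorm (v t) <= S)],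
      [/\ (forall t, - r <= t <= 0 -> enorm (x t) <= S), enorm (z 0) <= S & enorm (w 0) <= S] &
      solves 0 +oo%E x (fun t => f (x t) (u t)) /\
      sampled_observer tau u (samples tau x v) +oo%E z w].

Lemma plant_bounded_data (S b B T : R) : exists2 K : R, 0 <= K & forall tau u v x z w,
  bounded_data S b B tau u v x z w -> forall t, - r <= t -> t <= T -> enorm (x t) <= K.
Proof.
have [K K0 HK] := plant_bounded S (T + 1).
exists (`|S| + K) => [|tau u v x z w [_ [Lu uS _ _] [xS _ _] [sx _]] t rt tT].
  by rewrite addr_ge0.
have [t0|t0] := leP 0 t.
  apply: le_trans (HK u x (T + 1) Lu uS (lexx _) _ _ t t0 _) _.
  - exact: solvesW (lexx _) (leey _) sx.
  - by apply: xS; rewrite lexx oppr_le0 ltW.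
  - lra.
  - by rewrite lerDr.
apply: le_trans (xS t _) _; first by rewrite rt ltW.
by apply: le_trans (ler_norm _) _; rewrite lerDl.
Qed.

(** As intervals last at least [b], at most [N] of them matter up to time [T], where [N * b > T].
    Each sample is bounded through [h] at a bounded plant state. *)
Lemma observer_bounded_data (S b B T : R) : 0 < b -> exists2 K : R, 0 <= K &
  forall tau u v x z w, bounded_data S b B tau u v x z w ->
  forall t, 0 <= t -> t <= T -> enorm (z t) <= K /\ enorm (w t) <= K.
Proof.
move=> b0; have [N HN] := exists_nat_gt (T / b).
have NT : T < N%:R * b by have := HN N (leqnn N); rewrite ltr_pdivrMr.
(* Samples with index below [N] are taken at times at most [N * B]. *)
have [Kx Kx0 HKx] := plant_bounded_data S b B (N%:R * B).
have [Kh Kh0 HKh] := smooth_locally_lipschitz h_smooth Kx.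
have [K K0 HK] := sampled_observer_bounded (Num.max S (Kh + S)) B N.
exists K => // tau u v x z w dat t t0 tT.
have [[tp tB tb] [Lu uS Lv vS] [xS zS wS] [sx so]] := dat.
have tauN : t < tau N by apply: le_lt_trans tT (lt_le_trans NT (partition_lower tp tb N)).
apply: (HK tau u _ z w tp tB Lu _ so) => //; try by rewrite le_max ?uS ?zS ?wS.
move=> i iN; rewrite le_max; apply/orP; right; apply: le_trans (enormD _ _) _.
apply: lerD; last by apply: vS; exact: partition_ge0.
have B0 : 0 <= B by have [_ inc _] := tp; have := inc 0%N; have := tB 0%N; lra.
have upper j : tau j <= j%:R * B.
  elim: j => [|j IH]; first by have [-> _ _] := tp; rewrite mul0r.
  by have := tB j; rewrite -natr1 mulrDl mul1r; lra.
have xi : enorm (x (tau i - r)) <= Kx.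
  apply: (HKx tau u v x z w dat); first by rewrite lerBrDr addNr partition_ge0.
  apply: (@le_trans _ _ (tau i)); first by rewrite lerBlDr lerDl ltW.
  by apply: le_trans (upper i) _; rewrite ler_wpM2r // ler_nat ltnW.
by have [] := HKh _ _ xi xi.
Qed.

(* Shifting time by r turns the delayed observer into the observer of the plant
   with the measurement error w(t + r) - h(x(t)). *)
Definition output_error (x : R -> 'rV[R]_n) (w : R -> 'rV[R]_k) : R -> 'rV[R]_k :=
  fun t => w (t + r) - h (x t).

Lemma shifted_plant_observer S b B tau u v x z w : bounded_data S b B tau u v x z w ->
  plant_observer_solution f h F (x 0) (z r) u (output_error x w) x (fun t => z (t + r)).
Proof.
move=> [_ _ _ [sx [sz _]]]; split => //; first by rewrite add0r.
have := @solves_shift R l 0 +oo%E r z (fun t => F (z t) (w t) (u (t - r))).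
rewrite add0r => H; apply: (eq_solves (fun t _ _ => erefl) _ (H _)).
  by move=> t t0 _; rewrite addrK /output_error addrCA subrr addr0.
by apply: solvesW sz; rewrite ?leey // ltW.
Qed.

Lemma output_error_bounded (S b B T : R) : 0 < b -> exists2 K : R, 0 <= K &
  forall tau u v x z w, bounded_data S b B tau u v x z w ->
  forall t, 0 <= t -> t <= T -> enorm (output_error x w t) <= K.
Proof.
move=> b0; have [K K0 HK] := observer_bounded_data S B (T + r) b0.
have [Kx Kx0 HKx] := plant_bounded_data S b B T.
have [Kh Kh0 HKh] := smooth_locally_lipschitz h_smooth Kx.
exists (K + Kh) => [|tau u v x z w dat t t0 tT]; first by rewrite addr_ge0.
apply: le_trans (enormD _ _) _; rewrite enormN; apply: lerD.
  by have [] := HK tau u v x z w dat (t + r) _ _; rewrite ?lerD2r // addr_ge0 // ltW.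
have xt : enorm (x t) <= Kx.
  by apply: (HKx tau u v x z w dat) => //; rewrite (le_trans _ t0) // oppr_le0 ltW.
by have [] := HKh _ _ xt xt.
Qed.

Lemma output_error_sup_finite S b B tau u v x z w : 0 < b -> bounded_data S b B tau u v x z w ->
  forall t, sup_finite (output_error x w) t.
Proof.
move=> b0 dat t; have [K _ HK] := output_error_bounded S B t b0.
by exists K => zz [s /=]; rewrite in_itv /= => /andP[s0 st] <-; exact: (HK _ _ _ _ _ _ dat).
Qed.

Lemma output_error_Linf_loc S b B tau u v x z w : 0 < b -> bounded_data S b B tau u v x z w ->
  Linf_loc Rplus setT (output_error x w).
Proof.
move=> b0 dat; have [[tp tB tb] _ _ [sx [sz sw]]] := dat.
have [ach _] := solves_comp h_smooth sx.
(* The sampling intervals are moved back by [r] and cut at 0; those that end before 0 become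
   empty. *)
apply: (@piecewise_abs_cont_Linf_loc R k _ _ (fun i => Num.max 0 (tau i - r)) (fun i => tau i.+1 - r)).
- exact: lebesgue_measurable_itv.
- move=> t; rewrite /= in_itv /= andbT => t0.
  have tr0 : 0 <= t + r by rewrite addr_ge0 // ltW.
  have [i /andP[h1 h2]] := partition_index tp tr0.
  by exists i; rewrite ge_max t0 lerBlDr h1 ltrBrDr h2.
- move=> i c; rewrite ge_max ltrBrDr => /andP[c0 ic] ci.
  have m0 : 0 <= Num.max 0 (tau i - r) by rewrite le_max lexx.
  have m1 : tau i <= Num.max 0 (tau i - r) + r by rewrite -lerBlDr le_max lexx orbT.
  apply: abs_contB; last by apply: abs_contS (ach c c0 (ltry _)).
  apply: abs_cont_shift; have [[acw _] _] := sw i.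
  apply: (abs_contS m1 (lexx _) (acw (c + r) _ _)); first by rewrite -lerBlDr.
  by rewrite lt_min lte_fin ci ltry.
- move=> c; have [K K0 HK] := output_error_bounded S B c b0.
  by exists K => // t; rewrite /= in_itv /= andbT => t0 tc; exact: (HK _ _ _ _ _ _ dat).
Qed.

(** This is the error in the original time; [r <= tau i] ensures that the delayed plant state
    already solves its equation. *)
Lemma output_error_solves S b B tau u v x z w i : bounded_data S b B tau u v x z w ->
  r <= tau i ->
  solves (tau i) (tau i.+1)%:E (fun t => w t - h (x (t - r)))
    (fun t => Lfh f h (Psi (z t)) (u (t - r)) - Lfh f h (x (t - r)) (u (t - r))).
Proof.
move=> [[tp _ _] _ _ [sx [_ sw]]] ri; have [swi _] := sw i.
apply: solves_sub.
  by apply: solvesW swi => //; rewrite le_min lexx leey.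
have := @solves_shift R k (tau i) (tau i.+1)%:E (- r) (fun t => h (x t))
  (fun t => 'd h (x t) (f (x t) (u t))); apply.
apply: solvesW (solves_comp h_smooth sx); last by rewrite leey.
by rewrite subr_ge0.
Qed.

(** * Small gain and the error of the delayed estimate *)

Section Estimate.
Variables (sigma gamma C b B : R).
Hypothesis sigma_gt0 : 0 < sigma.
Hypothesis gamma_ge0 : 0 <= gamma.
Hypothesis observer : robust_exp_observer U f h F Psi sigma gamma.
Hypothesis C_gt0 : 0 < C.
Hypothesis output_derivative : output_derivative_bound U f h F Psi sigma C.
Hypothesis b_gt0 : 0 < b.
Hypothesis b_le_B : b <= B.
Hypothesis small_gain : C * B * expR (sigma * B) < 1.

Local Notation data S := (bounded_data S b B).
Let sigma_ge0 : 0 <= sigma := ltW sigma_gt0.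
Let B_ge0 : 0 <= B := le_trans (ltW b_gt0) b_le_B.

Lemma expR_sigma_le (s t : R) : s <= t -> expR (sigma * s) <= expR (sigma * t).
Proof. by move=> st; rewrite ler_expR ler_wpM2l. Qed.

(* Small gain: the weighted supremum V of the output error up to time t satisfies
   V <= X + C B e^(sigma B) V. *)
Lemma output_error_gain (S : R) : 0 <= S -> exists2 X : R, 0 <= X &
  forall tau u v x z w, data S tau u v x z w -> forall t, 0 <= t ->
  forall p, 0 <= p <= t ->
  exp_sup sigma (output_error x w) p <= expR (- (sigma * p)) *
    ((X + expR (sigma * (t + B)) * exp_sup sigma v (t + r)) / (1 - C * B * expR (sigma * B))).
Proof.
move=> S0; have [Tf [Nf [cT T0 [N0 Nmono] od]]] := output_derivative.
have [K1 K10 HK1] := observer_bounded_data S B r b_gt0.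
have fc : finite_coords ('rV[R]_n * 'rV[R]_l)%type.
  by apply: finite_coords_prod; exact: finite_coords_rV.
(* The waiting time of (H3) depends on the data; continuity bounds it on the bounded set of pairs
   [(x 0, z r)]. *)
have [Th Th0 HTh] := @continuous_bounded R _ R^o Tf (Num.max S K1) fc cT.
have [Ke Ke0 HKe] := output_error_bounded S B (Th + B) b_gt0.
pose N1 := Nf (S + K1 + S).
have N10 : 0 <= N1 by apply: N0; rewrite !addr_ge0.
(* The first term covers times up to [Th + B], the second the transient of (H3) accumulated over one
   sampling interval. *)
pose X := expR (sigma * (Th + B)) * Ke + B * expR (sigma * B) * N1.
have X0 : 0 <= X by rewrite addr_ge0 // !mulr_ge0 ?expR_ge0.
exists X => // tau u v x z w dat t t0.
have [[tp tB tb] [Lu uS Lv vS] [xS zS wS] [sx [sz sw]]] := dat.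
have r0 : (- r <= (0 : R)) && ((0 : R) <= 0) by apply/andP; split => //; rewrite oppr_le0 ltW.
have zr : enorm (z r) <= K1 by have [] := HK1 _ _ _ _ _ _ dat r (ltW r_gt0) (lexx r).
pose ve := output_error x w.
have vefin := output_error_sup_finite b_gt0 dat.
have Lve := output_error_Linf_loc b_gt0 dat.
have [LuR uR] : Linf Rplus U u /\ Linf_norm Rplus u <= Linf_norm `[- r, +oo[ u.
  apply: LinfS Lu; first exact: lebesgue_measurable_itv.
  by move=> s; rewrite /= !in_itv /= !andbT => s0; rewrite (le_trans _ s0) // oppr_le0 ltW.
have pos := shifted_plant_observer dat.
have argN : Nf (enorm (x 0) + enorm (z r) + Linf_norm Rplus u) <= N1.
  apply: Nmono; first by rewrite !addr_ge0 ?enorm_ge0 ?Linf_norm_ge0.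
  by apply: lerD; [apply: lerD => //; exact: xS | exact: le_trans uS].
(* Weighting by e^(sigma p) instead of e^(-sigma (t - p)) gives one number [V] that serves all times
   up to [t]; [VE] recovers the weighted suprema. *)
pose W := [set expR (sigma * p) * enorm (ve p) | p in `[0, t]].
have Wub : has_ubound W.
  have [K HK] := vefin t; exists (expR (sigma * t) * K) => y [p /=]; rewrite in_itv /= => p0t <-.
  apply: ler_pM; rewrite ?expR_ge0 ?enorm_ge0 //; first by apply: expR_sigma_le; case/andP: p0t.
  by apply: HK; exists p => //=; rewrite in_itv.
pose V := sup W.
have VW p : 0 <= p <= t -> expR (sigma * p) * enorm (ve p) <= V.
  by move=> p0t; apply: ub_le_sup => //; exists p => //=; rewrite in_itv.
have t00 : 0 <= (0 : R) <= t by apply/andP; split.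
have V0 : 0 <= V by apply: le_trans (VW 0 t00); rewrite mulr_ge0 ?expR_ge0 ?enorm_ge0.
have VE p : 0 <= p <= t -> exp_sup sigma ve p <= expR (- (sigma * p)) * V.
  move=> /andP[p0 pt]; apply: exp_sup_le => // s /andP[s0 sp].
  have -> : expR (- (sigma * (p - s))) = expR (- (sigma * p)) * expR (sigma * s).
    by rewrite -expRD; congr expR; ring.
  by rewrite -mulrA ler_wpM2l ?expR_ge0 // VW // s0 (le_trans sp).
have vfin : sup_finite v (t + r).
  by exists S => y [s /=]; rewrite in_itv /= => /andP[s0 _] <-; exact: vS.
pose E := exp_sup sigma v (t + r).
have E0 : 0 <= E by apply: exp_sup_ge0 => //; rewrite addr_ge0 // ltW.
have main p : 0 <= p <= t -> expR (sigma * p) * enorm (ve p) <=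
    X + expR (sigma * (t + B)) * E + C * B * expR (sigma * B) * V.
  move=> /andP[p0 pt].
  have tail0 : 0 <= expR (sigma * (t + B)) * E by rewrite mulr_ge0 ?expR_ge0.
  have tail1 : 0 <= C * B * expR (sigma * B) * V by rewrite !mulr_ge0 ?expR_ge0 // ltW.
  (* After [Th + B] the last sampling time before [p + r] lies beyond [Th + r], so that (H3) holds
     all the way from it to [p + r]. *)
  have [pT|pT] := leP p (Th + B).
    have h1 : expR (sigma * p) * enorm (ve p) <= expR (sigma * (Th + B)) * Ke.
      apply: ler_pM; rewrite ?expR_ge0 ?enorm_ge0 ?expR_sigma_le //.
      exact: (HKe _ _ _ _ _ _ dat).
    have h2 : 0 <= B * expR (sigma * B) * N1 by rewrite !mulr_ge0 ?expR_ge0.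
    rewrite /X; lra.
  have pr0 : 0 <= p + r by rewrite addr_ge0 // ltW.
  have [i /andP[ip pi]] := partition_index tp pr0.
  have ilow : Th + r < tau i by have := tB i; lra.
  have ri : r <= tau i by lra.
  have i0 : 0 <= tau i by lra.
  (* Index 0 is excluded by [tau 0 = 0 < r]: the initial value of [w] is no sample. *)
  have etau : w (tau i) - h (x (tau i - r)) = v (tau i).
    case: i ri {ip pi ilow i0} => [|i] ri.
      by move: ri r_gt0; have [-> _ _] := tp => h1 h2; exfalso; lra.
    by have [_ ->] := sw i; [rewrite /samples addrC addKr | exact: ltry].
  (* Bounds the derivative of the error since that sampling; the decreasing exponential is taken at
     the start of the interval. *)
  pose D := expR (- (sigma * (tau i - r))) * (N1 + C * V).
  have NCV0 : 0 <= N1 + C * V by rewrite addr_ge0 // mulr_ge0 // ltW.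
  have D0 : 0 <= D by rewrite mulr_ge0 ?expR_ge0.
  have vep : ve p = w (p + r) - h (x (p + r - r)) by rewrite addrK.
  have incr : enorm (ve p - v (tau i)) <= D * (p + r - tau i).
    rewrite -etau vep.
    apply: (solves_mean_value (output_error_solves dat ri)) => //.
    apply: ae_all => s is_ sp.
    have s0 : 0 <= s - r by lra.
    have st : 0 <= s - r <= t by rewrite s0 /=; lra.
    have Ts : Tf (x 0, z r) <= s - r.
      have Tb : `|Tf (x 0, z r)| <= Th.
        apply: HTh; rewrite prod_normE /= ge_max.
        rewrite !le_max (le_trans (norm_le_enorm (x 0)) (xS _ r0)) /=.
        by rewrite (le_trans (norm_le_enorm (z r)) zr) orbT.
      by have := ler_norm (Tf (x 0, z r)); lra.
    have := od _ _ _ _ LuR Lve _ _ pos (s - r) Ts (vefin _).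
    rewrite subrK => H; apply: le_trans H _.
    have h1 : expR (- (sigma * (s - r))) * Nf (enorm (x 0) + enorm (z r) + Linf_norm Rplus u) <=
        expR (- (sigma * (s - r))) * N1 by rewrite ler_wpM2l ?expR_ge0.
    have h2 : C * exp_sup sigma (output_error x w) (s - r) <= C * (expR (- (sigma * (s - r))) * V).
      by rewrite ler_wpM2l ?(ltW C_gt0) //; exact: VE.
    apply: le_trans (lerD h1 h2) _.
    have -> : expR (- (sigma * (s - r))) * N1 + C * (expR (- (sigma * (s - r))) * V) =
      expR (- (sigma * (s - r))) * (N1 + C * V) by ring.
    rewrite ler_wpM2r // ler_expR lerN2 ler_wpM2l //; lra.
  have vtau : enorm (v (tau i)) <= expR (sigma * (t + r - tau i)) * E.
    have it : 0 <= tau i <= t + r by rewrite i0 /=; lra.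
    have := exp_sup_ge sigma_ge0 vfin it; rewrite -/E expRN.
    by rewrite mulrC ler_pdivrMr ?expR_gt0 // mulrC.
  have ve1 : enorm (ve p) <= expR (sigma * (t + r - tau i)) * E + D * B.
    rewrite -(subrK (v (tau i)) (ve p)); apply: le_trans (enormD _ _) _; rewrite addrC.
    apply: lerD => //; apply: le_trans incr _; rewrite ler_wpM2l //.
    by have := tB i; lra.
  apply: le_trans (ler_wpM2l (expR_ge0 _) ve1) _; rewrite mulrDr.
  (* As [p + r - tau i <= B], passing from the sampling time to [p] costs at most a factor e^(sigma
     B) in either term. *)
  have t1 : expR (sigma * p) * (expR (sigma * (t + r - tau i)) * E) <= expR (sigma * (t + B)) * E.
    rewrite mulrA -expRD -mulrDr ler_wpM2r // expR_sigma_le //.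
    by have := tB i; lra.
  have t2 : expR (sigma * p) * (D * B) <= B * expR (sigma * B) * N1 + C * B * expR (sigma * B) * V.
    have -> : expR (sigma * p) * (D * B) =
        expR (sigma * p) * expR (- (sigma * (tau i - r))) * ((N1 + C * V) * B) by rewrite /D; ring.
    rewrite -expRD.
    have -> : B * expR (sigma * B) * N1 + C * B * expR (sigma * B) * V =
        expR (sigma * B) * ((N1 + C * V) * B) by ring.
    rewrite ler_wpM2r ?mulr_ge0 // ler_expR -mulrBr ler_wpM2l //.
    by have := tB i; lra.
  have h2 : 0 <= expR (sigma * (Th + B)) * Ke by rewrite mulr_ge0 ?expR_ge0.
  rewrite /X; lra.
have Vle : V <= X + expR (sigma * (t + B)) * E + C * B * expR (sigma * B) * V.
  apply: ge_sup.
    by exists (expR (sigma * 0) * enorm (ve 0)), 0 => //=; rewrite in_itv /= lexx.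
  by move=> y [p /=]; rewrite in_itv /= => p0t <-; exact: main.
have k1 : 0 < 1 - C * B * expR (sigma * B) by rewrite subr_gt0.
(* The last term can be absorbed because [V] is finite, [W] being bounded above. *)
have Vle' : V <= (X + expR (sigma * (t + B)) * E) / (1 - C * B * expR (sigma * B)).
  by rewrite ler_pdivlMr // mulrBr mulr1 lerBlDr [V * _]mulrC.
move=> p p0t; apply: le_trans (VE p p0t) _.
by rewrite ler_wpM2l ?expR_ge0.
Qed.

Lemma shifted_gain_factor (s t : R) :
  expR (- (sigma * (t - s))) * expR (- (sigma * (s - r))) = expR (- (sigma * t)) * expR (sigma * r).
Proof. by rewrite -!expRD; congr expR; ring. Qed.

(** Before time [r] the error is bounded by a constant, at the price of e^(sigma r); later the
    observer estimate is used at time [s - r]. The weights combine because observer and supremum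
    have the same rate. *)
Lemma estimate_error (S : R) : 0 <= S -> exists2 Q : R, 0 <= Q &
  forall tau u v x z w, data S tau u v x z w -> forall t, 0 <= t ->
  exp_sup sigma (fun s => Psi (z s) - x (s - r)) t <= expR (- (sigma * t)) * Q +
    gamma * expR (sigma * B) / (1 - C * B * expR (sigma * B)) * exp_sup sigma v t.
Proof.
move=> S0; have [M [M0 Mmono] obs] := observer.
have [X X0 HX] := output_error_gain S0.
have [K1 K10 HK1] := observer_bounded_data S B r b_gt0.
have [KP KP0 HKP] := smooth_locally_lipschitz Psi_smooth K1.
have k1 : 0 < 1 - C * B * expR (sigma * B) by rewrite subr_gt0.
pose M1 := M (S + K1 + S).
have M10 : 0 <= M1 by apply: M0; rewrite !addr_ge0.
have er0 : 0 <= expR (sigma * r) := expR_ge0 _.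
pose Q := expR (sigma * r) * (KP + S) + expR (sigma * r) * M1 +
  expR (sigma * r) * (gamma * (X / (1 - C * B * expR (sigma * B)))).
have Q1 : 0 <= expR (sigma * r) * (KP + S) by rewrite mulr_ge0 // addr_ge0.
have Q2 : 0 <= expR (sigma * r) * M1 by rewrite mulr_ge0.
have Q3 : 0 <= expR (sigma * r) * (gamma * (X / (1 - C * B * expR (sigma * B)))).
  by rewrite !mulr_ge0 // invr_ge0 ltW.
exists Q => [|tau u v x z w dat t t0]; first by rewrite !addr_ge0.
have [[tp tB tb] [Lu uS Lv vS] [xS zS wS] [sx so]] := dat.
have vfin : sup_finite v t.
  by exists S => y [s /=]; rewrite in_itv /= => /andP[s0 _] <-; exact: vS.
have E0 : 0 <= exp_sup sigma v t by exact: exp_sup_ge0.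
have tail0 : 0 <= gamma * expR (sigma * B) / (1 - C * B * expR (sigma * B)) * exp_sup sigma v t.
  by rewrite mulr_ge0 // divr_ge0 ?mulr_ge0 ?expR_ge0 // ltW.
have et0 : 0 <= expR (- (sigma * t)) := expR_ge0 _.
apply: exp_sup_le => // s /andP[s0 st].
have [sr|rs] := ltP s r.
  have zs : enorm (z s) <= K1 by have [] := HK1 _ _ _ _ _ _ dat s s0 (ltW sr).
  have b1 : enorm (Psi (z s) - x (s - r)) <= KP + S.
    apply: le_trans (enormD _ _) _; rewrite enormN; apply: lerD.
      by have [] := HKP _ _ zs zs.
    by apply: xS; rewrite lerBrDl subrr s0 subr_le0 ltW.
  have -> : expR (- (sigma * (t - s))) = expR (- (sigma * t)) * expR (sigma * s).
    by rewrite -expRD; congr expR; ring.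
  rewrite -mulrA; apply: (@le_trans _ _ (expR (- (sigma * t)) * Q)); last by rewrite lerDl.
  rewrite ler_wpM2l //.
  apply: (@le_trans _ _ (expR (sigma * r) * (KP + S))).
    by apply: ler_pM; rewrite ?expR_ge0 ?enorm_ge0 // expR_sigma_le // ltW.
  by rewrite /Q -addrA lerDl addr_ge0.
have sr0 : 0 <= s - r by rewrite subr_ge0.
have tr0 : 0 <= t - r by rewrite subr_ge0 (le_trans rs).
have srt : 0 <= s - r <= t - r by rewrite sr0 lerD2r.
have r0 : (- r <= (0 : R)) && ((0 : R) <= 0) by apply/andP; split => //; rewrite oppr_le0 ltW.
have zr : enorm (z r) <= K1 by have [] := HK1 _ _ _ _ _ _ dat r (ltW r_gt0) (lexx r).
have vefin := output_error_sup_finite b_gt0 dat.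
have Lve := output_error_Linf_loc b_gt0 dat.
have [LuR uR] : Linf Rplus U u /\ Linf_norm Rplus u <= Linf_norm `[- r, +oo[ u.
  apply: LinfS Lu; first exact: lebesgue_measurable_itv.
  by move=> p; rewrite /= !in_itv /= !andbT => p0; rewrite (le_trans _ p0) // oppr_le0 ltW.
have pos := shifted_plant_observer dat.
have argM : M (enorm (x 0) + enorm (z r) + Linf_norm Rplus u) <= M1.
  apply: Mmono; first by rewrite !addr_ge0 ?enorm_ge0 ?Linf_norm_ge0.
  by apply: lerD; [apply: lerD => //; exact: xS | exact: le_trans uS].
have [_ est] := obs (x 0) (z r) u (output_error x w) LuR Lve.
have := est _ _ pos (s - r) sr0 (vefin _).
rewrite subrK => H.
(* Taken at [t - r], so that only values of [v] up to [t] occur. *)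
have G := HX _ _ _ _ _ _ dat (t - r) tr0 (s - r) srt; rewrite subrK in G.
set E := exp_sup sigma v t in G E0 tail0 *.
set k0 := 1 - C * B * expR (sigma * B) in G k1 Q Q3 tail0 *.
have H' := gain_combine (expR_ge0 _) gamma_ge0 argM G H.
have e1 : expR (- (sigma * t)) * expR (sigma * r) * expR (sigma * (t - r + B)) = expR (sigma * B).
  by rewrite -!expRD; congr expR; ring.
apply: le_trans (gain_rescale (expR_ge0 _) (shifted_gain_factor s t) e1 H') _.
by rewrite lerD2r ler_wpM2l // /Q -addrA lerDr.
Qed.

(** Supplies the terms of the predictor estimate that depend on the observer. The chain rule gives
    the derivative almost everywhere, which is enough for an essential supremum. *)
Lemma initial_derivative_bound (S : R) : 0 <= S -> exists2 Q : R, 0 <= Q &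
  forall tau u v x z w, data S tau u v x z w ->
  [/\ enorm (Psi (z 0)) <= Q, (ess_norm `[0%R, r] (derive1 (Psi \o z)) < +oo)%E &
      Linf_norm `[0%R, r] (derive1 (Psi \o z)) <= Q].
Proof.
move=> S0.
have [K1 K10 HK1] := observer_bounded_data S B r b_gt0.
have [KP KP0 HKP] := smooth_locally_lipschitz Psi_smooth K1.
have [L L0 HL] := diff_lipschitz K1 Psi_smooth.
have [KF KF0 HKF] := F_lip (Num.max (K1 + K1) S).
exists (KP + L * KF) => [|tau u v x z w dat]; first by rewrite addr_ge0 // mulr_ge0.
have [_ [Lu uS _ _] _ [_ [[_ dz] _]]] := dat.
have bd t : 0 <= t -> t <= r -> enorm (z t) <= K1 /\ enorm (w t) <= K1.
  by move=> t0 tr; exact: (HK1 _ _ _ _ _ _ dat).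
have z0 : enorm (z 0) <= K1 by have [] := bd 0 (lexx 0) (ltW r_gt0).
have P0 : enorm (Psi (z 0)) <= KP by have [] := HKP _ _ z0 z0.
have LF0 : 0 <= L * KF by rewrite mulr_ge0.
have ae_bound : {ae @lebesgue_measure R, forall t, `[0%R, r]%classic t ->
    enorm (derive1 (Psi \o z) t) <= KP + L * KF}.
  have [_ Uu uoo] := Lu.
  apply: (ae_imply2 _ dz (ae_translation (- r) (Linf_norm_ae uoo))) => t H1 H2.
  rewrite /= in_itv /= => /andP[t0 tr].
  have tr0 : `[- r, +oo[%classic (t - r) by rewrite /= in_itv /= andbT lerBrDr addNr.
  have dt := is_derive_comp (smooth_differentiable Psi_smooth (z t)) (H1 t0 (ltry _)).
  have -> : derive1 (Psi \o z) t = 'd Psi (z t) (F (z t) (w t) (u (t - r))).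
    by rewrite derive1E; exact: (@derive_val _ _ _ _ _ _ _ dt).
  have [zt wt] := bd t t0 tr.
  have yt : enorm (row_mx (z t) (w t)) <= Num.max (K1 + K1) S.
    by rewrite le_max; apply/orP; left; apply: le_trans (enorm_row_mx _ _) _; exact: lerD.
  have ut : enorm (u (t - r)) <= Num.max (K1 + K1) S.
    by rewrite le_max; apply/orP; right; apply: le_trans (H2 tr0) uS.
  have [h1 _] := HL (z t) (z t) (F (z t) (w t) (u (t - r))) 0 zt zt.
  have [h2 _] := HKF _ _ (u (t - r)) yt yt (Uu _ tr0) ut.
  rewrite row_mxKl row_mxKr in h2.
  by apply: le_trans h1 _; apply: (@le_trans _ _ (L * KF)); [rewrite ler_wpM2l | rewrite lerDr].
have [doo dle] := Linf_norm_le (addr_ge0 KP0 LF0) ae_bound.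
by split => //; rewrite (le_trans P0) // lerDl.
Qed.

End Estimate.

End Systems.

(** * The main estimate *)

Section FinalSteps.
Context {R : realType}.

(* The best constant for all data of size at most s is a non-decreasing function of s. *)
Lemma nondecreasing_gain_of_bounds (K : set (R * R * R * R)) :
  (forall s a e c, K (s, a, e, c) -> 0 <= s /\ 0 < e) ->
  (forall S, 0 <= S -> exists2 q, 0 <= q & forall s a e c, K (s, a, e, c) -> s <= S -> a <= e * q + c) ->
  exists2 Q : R -> R, nondecreasing_gain Q & forall s a e c, K (s, a, e, c) -> a <= e * Q s + c.
Proof.
move=> Kpos bound.
pose good S := [set q | 0 <= q /\ forall s a e c, K (s, a, e, c) -> s <= S -> a <= e * q + c].
have good0 S : 0 <= S -> good S !=set0 by move=> /bound[q q0 Hq]; exists q.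
have lb S : lbound (good S) 0 by move=> q [].
exists (fun S => inf (good S)).
  split=> [s s0|s s' s0 ss]; first by apply: lb_le_inf; [exact: good0 | exact: lb].
  apply: lb_le_inf; first exact: good0 (le_trans s0 ss).
  move=> q [q0 Hq]; apply: ge_inf; first by exists 0; exact: lb.
  by split => // t a e c Kt ts; apply: Hq Kt _; exact: le_trans ss.
move=> s a e c Ks; have [s0 e0] := Kpos _ _ _ _ Ks.
rewrite -lerBlDr mulrC -ler_pdivrMr //.
apply: lb_le_inf; first exact: good0.
move=> q [q0 Hq]; rewrite ler_pdivrMr // lerBlDr mulrC.
exact: Hq Ks (lexx s).
Qed.

(** Histories equal on [-r, 0] are at distance 0, hence closer than every [d] that
    [continuous_output] may ask for. *)
Lemma continuous_output_ext n m q (r : R) (U : set 'rV[R]_m)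
    (G : (R -> 'rV[R]_q) -> (R -> 'rV[R]_m) -> 'rV[R]_n -> 'rV[R]_n) phi phi' mu a :
  0 < r -> continuous_output r U G -> C0 r phi -> C0 r phi' -> Linf `[- r, 0] U mu ->
  (forall theta, - r <= theta <= 0 -> phi theta = phi' theta) -> G phi mu a = G phi' mu a.
Proof.
move=> r0 cG cphi cphi' Lmu pp; apply/eqP; rewrite eq_sym -subr_eq0; apply/eqP; apply: enorm_eq0.
apply/eqP; rewrite eq_le enorm_ge0 andbT; apply/ler_addgt0Pr => e e0; rewrite add0r; apply: ltW.
have [d d0 H] := cG phi mu a cphi Lmu e e0; apply: H => //.
- rewrite /C0_norm (_ : [set _ | _ in _] = [set 0]) ?sup1 //.
  apply/seteqP; split => p /=.
    by move=> [th]; rewrite in_itv /= => thr <-; rewrite pp // subrr enorm0.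
  move=> ->; exists 0; first by rewrite in_itv /= lexx oppr_le0 ltW.
  by rewrite pp ?subrr ?enorm0 // lexx oppr_le0 ltW.
- apply: le_lt_trans d0.
  have [|_ //] := @Linf_norm_le R m `[- r, 0]%classic (mu \- mu) 0 (lexx 0).
  by apply: ae_all => t _; rewrite /= subrr enorm0.
- by rewrite subrr enorm0.
Qed.

Lemma C0_hist n (r t : R) (x y : R -> 'rV[R]_n) : 0 < r -> 0 <= t ->
  C0 r y -> (forall theta, - r <= theta <= 0 -> x theta = y theta) ->
  abs_cont 0 t x -> C0 r (hist t x).
Proof.
move=> r0 t0 cy xy acx.
have cx0 : {within `[- r, 0], continuous x}.
  apply/within_continuousP => s sr e e0.
  have [d d0 Hd] := (within_continuousP _ _ _).1 cy s sr e e0.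
  by exists d => // p pr ps; rewrite !xy //; exact: Hd.
have cxt := abs_cont_continuous acx.
have cx : {within `[- r, t], continuous x}.
  have -> : `[- r, t]%classic = `[- r, 0]%classic `|` `[0, t]%classic.
    apply/seteqP; split => s /=; rewrite !in_itv /=.
      by move=> /andP[s1 s2]; case: (leP s 0) => s0; [left; rewrite s1 | right; rewrite s2 ltW].
    by case=> /andP[s1 s2]; apply/andP; split; lra.
  by apply: withinU_continuous => //; exact: interval_closed.
apply/within_continuousP => th /andP[th1 th2] e e0.
have tr : - r <= t + th <= t by apply/andP; split; lra.
have [d d0 Hd] := (within_continuousP _ _ _).1 cx _ tr e e0.
exists d => // p /andP[p1 p2] pth; apply: Hd; first by apply/andP; split; lra.
by rewrite opprD addrACA subrr add0r.
Qed.

Lemma Linf_hist m (r t : R) (U : set 'rV[R]_m) u : 0 <= t -> Linf `[- r, +oo[ U u ->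
  Linf `[- r, 0] U (hist t u).
Proof.
move=> t0 Lu; have := Linf_shift t0 Lu.
have -> : (fun s => u (s + t)) = hist t u by apply/funext => s; rewrite /hist addrC.
move=> /(LinfS (lebesgue_measurable_itv `[- r, 0])) [] //.
by move=> s; rewrite /= !in_itv /= => /andP[->].
Qed.

Lemma closed_loop_restrict n m k l q (r : R) (f : 'rV[R]_n -> 'rV[R]_m -> 'rV[R]_n)
    (h : 'rV[R]_n -> 'rV[R]_k) (F : 'rV[R]_l -> 'rV[R]_k -> 'rV[R]_m -> 'rV[R]_l)
    (Psi : 'rV[R]_l -> 'rV[R]_n)
    (Fp : (R -> 'rV[R]_q) -> (R -> 'rV[R]_m) -> 'rV[R]_n -> 'rV[R]_n -> 'rV[R]_q)
    tau x0 z0 w0 xi0 u v T x z w xi :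
  closed_loop_solution r f h F Psi Fp tau x0 z0 w0 xi0 u v +oo%E x z w xi ->
  closed_loop_solution r f h F Psi Fp tau x0 z0 w0 xi0 u v T x z w xi.
Proof.
case=> init sx sz sw sxi.
split; [exact: init | exact: solvesW (lexx _) (leey _) sx | exact: solvesW (lexx _) (leey _) sz | |
  exact: solvesW (lexx _) (leey _) sxi].
move=> i; have [h1 h2] := sw i; split; last by move=> _; apply: h2; exact: ltry.
by apply: solvesW h1 => //; rewrite le_min leey andbT ge_min lexx.
Qed.

End FinalSteps.

Theorem theorem2p3 (R : realType) (n m k l q : nat)
  (r : R) (r_gt0 : 0 < r)
  (U : set 'rV[R]_m) (U_neq0 : U !=set0)
  (f : 'rV[R]_n -> 'rV[R]_m -> 'rV[R]_n) (h : 'rV[R]_n -> 'rV[R]_k)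
  (f_smooth : smooth_on [set p : 'rV[R]_n * 'rV[R]_m | U p.2]
                (fun p => f p.1 p.2))
  (h_smooth : smooth_on setT h)
  (f_complete : forward_complete_plant U f)
  (sigma : R) (sigma_gt0 : 0 < sigma)
  (F : 'rV[R]_l -> 'rV[R]_k -> 'rV[R]_m -> 'rV[R]_l)
  (Psi : 'rV[R]_l -> 'rV[R]_n)
  (F_smooth : smooth_on [set p : 'rV[R]_l * 'rV[R]_k * 'rV[R]_m | U p.2]
                (fun p => F p.1.1 p.1.2 p.2))
  (Psi_smooth : smooth_on setT Psi)
  (gamma : R) (gamma_ge0 : 0 <= gamma)
  (observer : robust_exp_observer U f h F Psi sigma gamma)
  (intersample_complete : forward_complete_intersample r U f h F Psi)
  (F_complete : forward_complete_delayed_observer r U F)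
  (A : set (R -> 'rV[R]_n)) (A_class : predictor_input_class A)
  (Fp : (R -> 'rV[R]_q) -> (R -> 'rV[R]_m) ->
        'rV[R]_n -> 'rV[R]_n -> 'rV[R]_q)
  (G : (R -> 'rV[R]_q) -> (R -> 'rV[R]_m) -> 'rV[R]_n -> 'rV[R]_n)
  (Fp_continuous : continuous_dynamics r U Fp)
  (G_continuous : continuous_output r U G)
  (P : R) (P_ge0 : 0 <= P)
  (predictor : robust_exp_predictor r U f Fp G A sigma P)
  (estimate_in_A :
     forall (z0 : 'rV[R]_l) (u : R -> 'rV[R]_m) (w : R -> 'rV[R]_k),
       Linf `[- r, +oo[ U u -> Linf_loc `[- r, +oo[ setT w ->
       forall z, delayed_observer_solution r F z0 u w z -> A (Psi \o z))
  (C : R) (C_gt0 : 0 < C)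
  (output_derivative : output_derivative_bound U f h F Psi sigma C)
  (b B : R) (b_gt0 : 0 < b) (b_le_B : b <= B)
  (small_gain : C * B * expR (sigma * B) < 1) :
  exists2 Q : R -> R, nondecreasing_gain Q &
  forall tau : nat -> R, is_partition tau ->
    (forall i, tau i.+1 - tau i <= B) ->
    (forall i, b <= tau i.+1 - tau i) ->
  forall (z0 : 'rV[R]_l) (w0 : 'rV[R]_k)
         (u : R -> 'rV[R]_m) (v : R -> 'rV[R]_k)
         (x0 : R -> 'rV[R]_n) (xi0 : R -> 'rV[R]_q),
    Linf `[- r, +oo[ U u -> Linf_loc Rplus setT v ->
    C0 r x0 -> C0 r xi0 ->
    let solution := closed_loop_solution r f h F Psi Fp tau
                      x0 z0 w0 xi0 u v in
    [/\ (exists x z w xi, solution +oo%E x z w xi),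
        (forall T x z w xi x' z' w' xi',
           solution T x z w xi -> solution T x' z' w' xi' ->
           forall t, 0 <= t -> (t%:E < T)%E ->
             [/\ x t = x' t, z t = z' t, w t = w' t & xi t = xi' t]) &
        (forall x z w xi, solution +oo%E x z w xi ->
         forall t, 0 <= t -> sup_finite v t ->
           enorm (G (hist t xi) (hist t u) (Psi (z t)) - x t) <=
             expR (- (sigma * t)) *
               Q (C0_norm r x0 + C0_norm r xi0 + Linf_norm `[- r, +oo[ u
                  + enorm z0 + enorm w0 + sup_norm v t)
             + gamma * P * expR (sigma * B) / (1 - C * B * expR (sigma * B))
               * exp_sup sigma v t)].
Proof.
have f_lip := smooth_lipschitz_field f_smooth.
have F_lip := smooth3_lipschitz_field F_smooth.
have [A_neq0 _ _] := A_class.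
have [a [a0 amono] pred] := predictor.
have p_exists x0 xi0 u z : C0 r x0 -> C0 r xi0 -> Linf `[- r, +oo[ U u -> A z ->
    exists x xi, plant_predictor_solution r f Fp x0 xi0 u z +oo%E x xi.
  by move=> c1 c2 Lu Az; have [] := pred x0 xi0 u z c1 c2 Lu Az.
have p_unique x0 xi0 u z : C0 r x0 -> C0 r xi0 -> Linf `[- r, +oo[ U u -> A z ->
    forall T x xi x' xi', plant_predictor_solution r f Fp x0 xi0 u z T x xi ->
    plant_predictor_solution r f Fp x0 xi0 u z T x' xi' ->
    forall t, 0 <= t -> (t%:E < T)%E -> x t = x' t /\ xi t = xi' t.
  by move=> c1 c2 Lu Az; have [] := pred x0 xi0 u z c1 c2 Lu Az.
have cl_exists tau (tp : is_partition tau) (tB : forall i, tau i.+1 - tau i <= B) x0 z0 w0 xi0 u v :=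
  @closed_loop_exists R n m k l r U f h F Psi U_neq0 f_lip h_smooth Psi_smooth F_lip
    intersample_complete q A Fp A_neq0 p_exists estimate_in_A tau B tp tB x0 z0 w0 xi0 u v.
have cl_unique_global tau (tp : is_partition tau) (tB : forall i, tau i.+1 - tau i <= B) :=
  @closed_loop_unique_global R n m k l r U f h F Psi r_gt0 U_neq0 f_lip h_smooth Psi_smooth F_lip
    intersample_complete q A Fp p_unique estimate_in_A tau B tp tB.
have cl_unique tau (tp : is_partition tau) (tB : forall i, tau i.+1 - tau i <= B) :=
  @closed_loop_unique R n m k l r U f h F Psi r_gt0 U_neq0 f_lip h_smooth Psi_smooth F_lip
    intersample_complete q A Fp A_neq0 p_exists p_unique estimate_in_A tau B tp tB.
(* The gain [P] of the predictor times the gain in [estimate_error]. *)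
pose c0 := gamma * P * expR (sigma * B) / (1 - C * B * expR (sigma * B)).
have bounded_disturbance S : 0 <= S -> exists2 Q, 0 <= Q &
    forall tau x0 z0 w0 xi0 u v x z w xi, is_partition tau ->
    (forall i, tau i.+1 - tau i <= B) -> (forall i, b <= tau i.+1 - tau i) ->
    Linf `[- r, +oo[ U u -> Linf_loc Rplus setT v -> C0 r x0 -> C0 r xi0 ->
    C0_norm r x0 <= S -> C0_norm r xi0 <= S -> Linf_norm `[- r, +oo[ u <= S ->
    enorm z0 <= S -> enorm w0 <= S -> (forall s, 0 <= s -> enorm (v s) <= S) ->
    closed_loop_solution r f h F Psi Fp tau x0 z0 w0 xi0 u v +oo%E x z w xi ->
    forall t, 0 <= t -> enorm (G (hist t xi) (hist t u) (Psi (z t)) - x t) <=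
      expR (- (sigma * t)) * Q + c0 * exp_sup sigma v t.
  move=> S0.
  have [Q1 Q10 HQ1] := initial_derivative_bound r_gt0 U_neq0 f_lip f_complete h_smooth Psi_smooth
    F_lip intersample_complete B b_gt0 S0.
  have [Q2 Q20 HQ2] := estimate_error r_gt0 U_neq0 f_lip f_complete h_smooth Psi_smooth
    F_lip intersample_complete sigma_gt0 gamma_ge0 observer C_gt0 output_derivative b_gt0 b_le_B
    small_gain S0.
  exists (a (S + S + S + Q1 + Q1) + P * Q2).
    by rewrite addr_ge0 ?mulr_ge0 // a0 // !addr_ge0.
  move=> tau x0 z0 w0 xi0 u v x z w xi tp tB tb Lu Lv cx0 cxi0 x0S xi0S uS z0S w0S vS sol t t0.
  have so := closed_loop_sampled sol.
  have [[xx0 xxi0 zz0 ww0] sx sz sw sxi] := sol.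
  have dat : bounded_data r U f h F Psi S b B tau u v x z w.
    split; [by [] | by [] | split; rewrite ?zz0 ?ww0 // | by []].
    by move=> s sr; rewrite xx0 //; apply: le_trans x0S; exact: C0_norm_ge.
  have Az : A (Psi \o z) := estimate_in_class U_neq0 f_lip h_smooth Psi_smooth F_lip
    intersample_complete estimate_in_A tp tB Lu so zz0.
  have [_ _ est] := pred x0 xi0 u (Psi \o z) cx0 cxi0 Lu Az.
  have [P0 doo dQ] := HQ1 _ _ _ _ _ _ dat.
  have pps : plant_predictor_solution r f Fp x0 xi0 u (Psi \o z) +oo%E x xi by split.
  apply: le_trans (est x xi pps t t0 doo) _.
  have h1 : a (C0_norm r x0 + C0_norm r xi0 + Linf_norm `[- r, +oo[ u + enorm ((Psi \o z) 0) +
      Linf_norm `[0%R, r] (derive1 (Psi \o z))) <= a (S + S + S + Q1 + Q1).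
    apply: amono; first by rewrite !addr_ge0 ?C0_norm_ge0 ?Linf_norm_ge0 ?enorm_ge0.
    by apply: lerD => //; apply: lerD => //; apply: lerD => //; exact: lerD.
  have h2 := HQ2 _ _ _ _ _ _ dat t t0.
  apply: le_trans (lerD (ler_wpM2l (expR_ge0 _) h1) (ler_wpM2l P_ge0 h2)) _.
  rewrite /c0 le_eqVlt; apply/orP; left; apply/eqP; ring.
have causal_bound S : 0 <= S -> exists2 Q, 0 <= Q &
    forall tau x0 z0 w0 xi0 u v x z w xi t, is_partition tau ->
    (forall i, tau i.+1 - tau i <= B) -> (forall i, b <= tau i.+1 - tau i) ->
    Linf `[- r, +oo[ U u -> Linf_loc Rplus setT v -> C0 r x0 -> C0 r xi0 ->
    closed_loop_solution r f h F Psi Fp tau x0 z0 w0 xi0 u v +oo%E x z w xi ->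
    0 <= t -> sup_finite v t ->
    C0_norm r x0 + C0_norm r xi0 + Linf_norm `[- r, +oo[ u
      + enorm z0 + enorm w0 + sup_norm v t <= S ->
    enorm (G (hist t xi) (hist t u) (Psi (z t)) - x t) <=
      expR (- (sigma * t)) * Q + c0 * exp_sup sigma v t.
  move=> S0; have [Q Q0 HQ] := bounded_disturbance S S0.
  exists Q => // tau x0 z0 w0 xi0 u v x z w xi t tp tB tb Lu Lv cx0 cxi0 sol t0 vfin sizeS.
  have n1 := C0_norm_ge0 r_gt0 cx0; have n2 := C0_norm_ge0 r_gt0 cxi0.
  have n3 := Linf_norm_ge0 `[- r, +oo[ u; have n4 := enorm_ge0 z0; have n5 := enorm_ge0 w0.
  have t0t : 0 <= t <= t by rewrite t0 lexx.
  have n6 : 0 <= sup_norm v t := le_trans (enorm_ge0 (v t)) (sup_norm_ge vfin t0t).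
  (* The solution on [0, t] does not depend on v after t.  Cutting v off there bounds
     the derivative of the estimate on all of [0, r] even if t < r. *)
  pose v' s := if s <= t then v s else 0.
  have Lv' : Linf_loc Rplus setT v' := Linf_loc_truncate t Lv.
  have v'S s : 0 <= s -> enorm (v' s) <= S.
    move=> s0; rewrite /v'; case: ifP => st; last by rewrite enorm0.
    have s0t : 0 <= s <= t by rewrite s0.
    by have := sup_norm_ge vfin s0t; lra.
  have [x' [z' [w' [xi' sol']]]] := cl_exists tau tp tB x0 z0 w0 xi0 u v' Lu cx0 cxi0.
  have [i /andP[it ti]] := partition_index tp t0.
  (* Sampling times before [tau i.+1] do not exceed [tau i <= t], where [v'] is still [v]. *)
  have vv j : ((tau j.+1)%:E < (tau i.+1)%:E)%E -> v' (tau j.+1) = v (tau j.+1).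
    rewrite lte_fin => ji; rewrite /v' ifT //; apply: le_trans it; rewrite leNgt; apply/negP => ij.
    have [ij'|ij'] := leqP j.+1 i; first by have := partition_le tp ij'; rewrite leNgt ij.
    have : tau i.+1 <= tau j.+1 := partition_le tp ij'.
    by rewrite leNgt ji.
  have eqs := cl_unique_global tau tp tB _ _ _ _ _ _ _ _ _ _ _ _ _ _ _ _ Lu cx0 cxi0 vv sol'
    (closed_loop_restrict (tau i.+1)%:E sol).
  have tT : (t%:E < (tau i.+1)%:E)%E by rewrite lte_fin.
  have [xt zt _ _] := eqs t t0 tT.
  have [[_ xi00 _ _] _ _ _ [acxi _]] := sol; have [[_ xi00' _ _] _ _ _ [acxi' _]] := sol'.
  have <- : G (hist t xi') (hist t u) (Psi (z' t)) = G (hist t xi) (hist t u) (Psi (z t)).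
    rewrite zt; apply: (continuous_output_ext (Psi (z t)) r_gt0 G_continuous).
    - by apply: C0_hist cxi0 xi00' (acxi' t t0 (ltry _)).
    - by apply: C0_hist cxi0 xi00 (acxi t t0 (ltry _)).
    - exact: Linf_hist.
    move=> th /andP[th1 th2]; rewrite /hist.
    have [tth|tth] := leP 0 (t + th).
      have [] // := eqs (t + th) tth _.
      by rewrite lte_fin; lra.
    have thr : - r <= t + th <= 0 by rewrite (le_trans th1) ?lerDr //= ltW.
    by rewrite (xi00 _ thr) (xi00' _ thr).
  rewrite -xt (@eq_exp_sup _ _ sigma v v'); last by move=> s /andP[_ st]; rewrite /v' st.
  apply: (HQ tau x0 z0 w0 xi0 u v' x' z' w' xi') => //; lra.
(* Each admissible solution and time is reduced to its size, its error, its decay factor and its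
   disturbance term; everything else is quantified away, so that one [Q] serves all partitions and
   data. *)
pose K := [set p : R * R * R * R | exists tau x0 z0 w0 xi0 u v x z w xi t,
  [/\ [/\ is_partition tau, (forall i, tau i.+1 - tau i <= B) & (forall i, b <= tau i.+1 - tau i)],
      [/\ Linf `[- r, +oo[ U u, Linf_loc Rplus setT v, C0 r x0 & C0 r xi0],
      closed_loop_solution r f h F Psi Fp tau x0 z0 w0 xi0 u v +oo%E x z w xi,
      0 <= t /\ sup_finite v t &
      p = (C0_norm r x0 + C0_norm r xi0 + Linf_norm `[- r, +oo[ u
             + enorm z0 + enorm w0 + sup_norm v t,
           enorm (G (hist t xi) (hist t u) (Psi (z t)) - x t),
           expR (- (sigma * t)), c0 * exp_sup sigma v t)]].
have [||Q Qgain HQ] := @nondecreasing_gain_of_bounds R K.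
- move=> s e d c [tau [x0 [z0 [w0 [xi0 [u [v [x [z [w [xi [t [_ [_ _ cx0 cxi0] _ [t0 vfin] [-> _ -> _]]]]]]]]]]]]]].
  split; last exact: expR_gt0.
  have t0t : 0 <= t <= t by rewrite t0 lexx.
  by rewrite !addr_ge0 ?C0_norm_ge0 ?Linf_norm_ge0 ?enorm_ge0 // (le_trans (enorm_ge0 (v t)) (sup_norm_ge vfin t0t)).
- move=> S S0; have [Q Q0 HQ] := causal_bound S S0; exists Q => // s e d c.
  move=> [tau [x0 [z0 [w0 [xi0 [u [v [x [z [w [xi [t [[tp tB tb] [Lu Lv cx0 cxi0] sol [t0 vfin] [-> -> -> ->]]]]]]]]]]]]]].
  exact: (HQ _ _ _ _ _ _ _ _ _ _ _ _ tp tB tb Lu Lv cx0 cxi0 sol t0 vfin).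
exists Q => // tau tp tB tb z0 w0 u v x0 xi0 Lu Lv cx0 cxi0 solution; split.
- exact: (cl_exists tau tp tB x0 z0 w0 xi0 u v).
- move=> T x z w xi x' z' w' xi' s1 s2; exact: (cl_unique tau tp tB _ _ _ _ _ _ _ _ _ _ _ _ _ _ _ Lu cx0 cxi0 s1 s2).
move=> x z w xi sol t t0 vfin; apply: HQ.
exists tau, x0, z0, w0, xi0, u, v, x, z, w, xi, t; split; [split | split | | split |]; assumption || exact: erefl.

Qed.
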